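(* Let $T=Q(z)\frac{d}{dz}+P(z)$ be such that its minimal $T_{CH}$-invariant set $M=M_{CH}^{T}$ has nonempty interior, and put $d=3\deg P+\deg Q-1$. Then every point $z$ of the boundary $\partial M$ belongs to one of the following types: (1) roots of the polynomials $P$ and $Q$ (at most $\deg P+\deg Q$ of them); (2) singular points of the curve of inflections, i.e. points of $\mathfrak S_R$ (at most $2d$ of them); (3) tangency points between the curve of inflections and the field $R(z)\partial_z$, i.e. points of $\mathfrak T_R$; these consist of straight segments, half-lines and lines, contained in at most $\deg P+\deg Q+1$ lines, and of at most $2d^2$ isolated points; (4) points of the transverse locus $\mathfrak I_R^{\ast}$ (not in $\mathcal Z(PQ)$) belonging to one of the four subclasses: - bouncing type: $\Delta^{+}(z)\neq\emptyset$ and $\Gamma(z)\cup\Delta^{-}(z)\neq\emptyset$; - switch type: $\Delta^{+}(z)\neq\emptyset$ and $\Gamma(z)\cup\Delta^{-}(z)=\emptyset$; - $C^1$-inflection type: $\Delta^{+}(z)=\emptyset$, $\Delta^{-}(z)\neq\emptyset$ and $\Gamma(z)=\emptyset$; - $C^2$-inflection type: $\Delta^{+}(z)=\emptyset$ and either $\Delta^{-}(z)=\emptyset$ or $\Gamma(z)\neq\emptyset$; (5) points not on the curve of inflections $\mathfrak I_R$ (and not in $\mathcal Z(PQ)$) belonging to one of the three subclasses: - local type: $\Gamma(z)\neq\emptyset$ and $\Delta(z)=\emptyset$; - global type: $\Gamma(z)=\emptyset$ and $\Delta(z)\neq\emptyset$; - extruding type: $\Gamma(z)\neq\emptyset$ and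 $\Delta(z)\neq\emptyset$.
   Context: Setup. $P,Q\in\mathbb C[z]$ are not identically zero and not both constant, $T=Q(z)\frac{d}{dz}+P(z)$, $R=Q/P$, and $\mathcal Z(PQ)$ is the set of roots of $PQ$. A closed set $S\subset\mathbb C$ is $T_{CH}$-invariant if for every $u\in S$ and every real $t\ge 0$ the image $T(f)$ of $f(z)=(z-u)^t$ either has all its roots in $S$ or vanishes identically. There is a unique minimal (for inclusion) nonempty $T_{CH}$-invariant set, denoted $M=M_{CH}^{T}$. For $PQ(z)\ne0$ the associated ray is the half-line $r(z)=\{z+tR(z): t\in\mathbb R^+\}$. (Known equivalent characterization: a closed $S$ is $T_{CH}$-invariant iff $\mathcal Z(PQ)\subset S$ and $r(z)\cap S=\emptyset$ for every $z\notin S$.) Curve of inflections. $\mathfrak I_R$ is the closure in $\mathbb C$ of $\{z:\operatorname{Im}R'(z)=0\}$, a real plane algebraic curve. Singular locus $\mathfrak S_R$: points of $\mathfrak I_R$ where several local branches of $\mathfrak I_R$ intersect. Tangency locus $\mathfrak T_R$: non-singular points of $\mathfrak I_R$ where the vector field $R(z)\partial_z$ is tangent to $\mathfrak I_R$. Transverse locus $\mathfrak I_R^{\ast}$: non-singular points of $\mathfrak I_R$ where $R(z)\partial_z$ is transverse to $\mathfrak I_R$. Extended plane. $\mathbb C\cup\mathbb S^1$ is the compactification of $\mathbb C$ by the circle of directions: neighborhoods of $x\in\mathbb C$ are the usual ones; basic neighborhoods of a direction $\theta\in\mathbb S^1$ are $I\cup C(z,I)$ with $I\ni\theta$ an open interval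 of $\mathbb S^1$ and $C(z,I)$ the open cone with apex $z\in\mathbb C$ and interval of directions $I$. Bars denote closures in $\mathbb C\cup\mathbb S^1$. Correspondences. For $z\in\partial M\setminus\mathcal Z(PQ)$: $\Gamma(z)=(\gamma_z^+\setminus\{z\})\cap\overline M$, where $\gamma_z^+$ is the positive trajectory of $R(z)\partial_z$ starting at $z$; $\Delta(z)=(\overline{r(z)}\setminus\{z\})\cap\overline M$. For $z\in\mathfrak I_R\setminus\mathcal Z(PQ)$ (so $R'(z)\in\mathbb R$): a point $u\in\Delta(z)\cap\mathbb C$ belongs to $\Delta^-(z)$ if $R'(z)\le-\frac{R(z)}{u-z}$ and to $\Delta^+(z)$ if $R'(z)\ge-\frac{R(z)}{u-z}$ (here $\frac{R(z)}{u-z}>0$); a point $u\in\Delta(z)\cap\mathbb S^1$ belongs to $\Delta^-(z)$ if $R'(z)\le0$ and to $\Delta^+(z)$ if $R'(z)\ge0$. *)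

(* Defs.v *)
From HB Require Import structures.
From mathcomp Require Import all_boot all_order all_algebra.
From mathcomp Require Import all_classical all_reals all_analysis.
From mathcomp Require Import complex.
Set Implicit Arguments.
Unset Strict Implicit.
Unset Printing Implicit Defensive.
Import Order.TTheory GRing.Theory Num.Theory numFieldNormedType.Exports.
Local Open Scope classical_set_scope.
Local Open Scope ring_scope.
Local Open Scope complex_scope.

(* K[i] has no topology in the library: give it the one of its modulus, as a
   normed module over itself, so that derive1 on K[i] -> K[i] is the complex
   derivative. *)
#[export, non_forgetful_inheritance]
HB.instance Definition _ (K : realType) := NormedModule.copy K[i] K[i]^o.

Section Definitions.
Variable K : realType.
Implicit Types (P Q : {poly K[i]}) (S X : set K[i]) (z u w : K[i]).

Definition deg P : nat := (size P).-1.

Definition curve_d P Q : nat := (3 * deg P + deg Q - 1)%N.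

Definition zeros_PQ P Q : set K[i] := [set z | root (P * Q) z].

Definition boundary S : set K[i] := closure S `\` S°.

Definition cexp z : K[i] :=
  (expR (complex.Re z))%:C * (cos (complex.Im z) +i* sin (complex.Im z)).

Definition diffop P Q (f : K[i] -> K[i]) z : K[i] :=
  Q.[z] * derive1 f z + P.[z] * f z.

(* L is, near z, a holomorphic branch of log(. - u); no such branch exists at
   z = u. *)
Definition log_branch u z (L : K[i] -> K[i]) : Prop :=
  \forall w \near z, derivable L w 1 /\ cexp (L w) = w - u.

(* (. - u)^t is multivalued for general t; its branches near z differ by a
   nonzero constant factor, so being a root of the image under T does not
   depend on the branch. The point u itself is never counted as a root, which
   is immaterial below since u belongs to S. *)
Definition image_root P Q u (t : K) z : Prop :=
  exists2 L, log_branch u z L &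
    diffop P Q (fun w => cexp (t%:C * L w)) z = 0.

Definition TCH_invariant P Q S : Prop :=
  closed S /\
  forall u (t : K), S u -> 0 <= t ->
    (forall z, z <> u -> image_root P Q u t z) \/
    (forall z, image_root P Q u t z -> S z).

Definition minimal_TCH P Q M : Prop :=
  [/\ M !=set0, TCH_invariant P Q M &
      forall S, S !=set0 -> TCH_invariant P Q S -> S `<=` M -> S = M].

(* The rational function Q/P is taken in lowest terms: at a common root of P
   and Q it has the value of its continuous extension if there is one. *)
Definition rnum P Q : {poly K[i]} := Q %/ gcdp P Q.
Definition rden P Q : {poly K[i]} := P %/ gcdp P Q.

Definition regular_pt P Q z : Prop := (rden P Q).[z] != 0.

Definition Rf P Q z : K[i] := (rnum P Q).[z] / (rden P Q).[z].

Definition dRf P Q z : K[i] := derive1 (Rf P Q) z.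

Definition inflection P Q : set K[i] :=
  closure [set z | regular_pt P Q z /\ complex.Im (dRf P Q z) = 0].

Definition curve_derivable (g : K -> K[i]) (t : K) : Prop :=
  derivable (fun s => complex.Re (g s)) t 1 /\
  derivable (fun s => complex.Im (g s)) t 1.

Definition curve_deriv (g : K -> K[i]) (t : K) : K[i] :=
  derive1 (fun s => complex.Re (g s)) t +i*
  derive1 (fun s => complex.Im (g s)) t.

(* A regular C^1 arc through z; continuity and injectivity on the closed
   interval keep its ends away from z. *)
Definition smooth_arc z (g : K -> K[i]) : Prop :=
  [/\ g 0 = z,
      {within `[-1, 1], continuous g},
      {in `[-1, 1] &, injective g} &
      forall t : K, t \in `]-1, 1[ ->
        [/\ curve_derivable g t, curve_deriv g t != 0 &
            {for t, continuous (curve_deriv g)}]].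

Definition arc_image (g : K -> K[i]) : set K[i] := g @` `[-1, 1].

(* Near z, X is the union of the n arcs g i through z, any two of which meet
   only at z. *)
Definition local_branches X z (n : nat) (g : 'I_n -> K -> K[i]) : Prop :=
  [/\ forall i, smooth_arc z (g i),
      forall i j, i != j ->
        \forall w \near z, arc_image (g i) w -> arc_image (g j) w -> w = z &
      \forall w \near z, X w <-> exists i, arc_image (g i) w].

Definition local_param X z (g : K -> K[i]) : Prop :=
  smooth_arc z g /\ (\forall w \near z, X w <-> arc_image g w).

Definition singular_locus P Q : set K[i] :=
  [set z | inflection P Q z /\
     exists n (g : 'I_n -> K -> K[i]),
       (1 < n)%N /\ local_branches (inflection P Q) z g].

(* At a zero of R the field is tangent to the curve. *)
Definition tangency_locus P Q : set K[i] :=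
  [set z | [/\ inflection P Q z, ~ singular_locus P Q z &
     exists2 g, local_param (inflection P Q) z g &
       exists s : K, Rf P Q z = s%:C * curve_deriv g 0]].

Definition transverse_locus P Q : set K[i] :=
  [set z | [/\ inflection P Q z, ~ singular_locus P Q z &
     exists2 g, local_param (inflection P Q) z g &
       forall s : K, Rf P Q z <> s%:C * curve_deriv g 0]].

Definition line (a v : K[i]) : set K[i] :=
  [set z | exists t : K, z = a + t%:C * v].

(* A segment, half-line or line, not reduced to a point, with or without its
   endpoints. *)
Definition straight_piece (A : set K[i]) : Prop :=
  exists (a v : K[i]) (I : interval K),
    [/\ v != 0, exists s t, [/\ s \in I, t \in I & s < t] &
        A = [set z | exists2 t : K, t \in I & z = a + t%:C * v]].

Definition circle : Type := {u : K[i] | `|u| == 1}.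

(* The extended plane: the complex plane compactified by the circle of
   directions. *)
Inductive xplane : Type := Fin of K[i] | Dir of circle.

Definition circle_arc (a b : K) : set circle :=
  [set e : circle | exists2 x : K, a < x < b & val e = cos x +i* sin x].

Definition cone z (I : set circle) : set K[i] :=
  [set w | exists (s : K) (e : circle), [/\ 0 < s, I e & w = z + s%:C * val e]].

Definition basic_nbhd (x : xplane) (N : set xplane) : Prop :=
  match x with
  | Fin z => exists2 U, nbhs z U & N = Fin @` U
  | Dir e => exists z a b, circle_arc a b e /\
      N = (Dir @` circle_arc a b) `|` (Fin @` cone z (circle_arc a b))
  end.

Definition xclosure (A : set xplane) : set xplane :=
  [set x | forall N, basic_nbhd x N -> N `&` A !=set0].

Definition assoc_ray P Q z : set K[i] :=
  [set w | exists2 t : K, 0 <= t & w = z + t%:C * Rf P Q z].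

(* Points reached in time tau >= 0 by the integral curve of R(z) d/dz starting
   at z, which stops at the poles of R. *)
Definition pos_trajectory P Q z : set K[i] :=
  [set w | exists (tau : K) (x : K -> K[i]),
     [/\ 0 <= tau, x 0 = z, x tau = w, {within `[0, tau], continuous x} &
         (forall t : K, t \in `[0, tau] -> regular_pt P Q (x t)) /\
         (forall t : K, t \in `]0, tau[ ->
            curve_derivable x t /\ curve_deriv x t = Rf P Q (x t))]].

Section Correspondences.
Variables (P Q : {poly K[i]}) (M : set K[i]).

Definition Gam z : set xplane :=
  ((Fin @` pos_trajectory P Q z) `\ Fin z) `&` xclosure (Fin @` M).

Definition Del z : set xplane :=
  (xclosure (Fin @` assoc_ray P Q z) `\ Fin z) `&` xclosure (Fin @` M).

(* The order of K[i] compares the real parts of numbers with equal imaginary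
   parts; both sides are real when z lies on the curve of inflections and u in
   Del z. *)
Definition Del_minus z : set xplane :=
  [set x | Del z x /\
     match x with
     | Fin u => dRf P Q z <= - (Rf P Q z / (u - z))
     | Dir _ => dRf P Q z <= 0
     end].

Definition Del_plus z : set xplane :=
  [set x | Del z x /\
     match x with
     | Fin u => - (Rf P Q z / (u - z)) <= dRf P Q z
     | Dir _ => 0 <= dRf P Q z
     end].

Definition bouncing_type z : Prop :=
  Del_plus z !=set0 /\ Gam z `|` Del_minus z !=set0.
Definition switch_type z : Prop :=
  Del_plus z !=set0 /\ Gam z `|` Del_minus z = set0.
Definition C1_inflection_type z : Prop :=
  [/\ Del_plus z = set0, Del_minus z !=set0 & Gam z = set0].
Definition C2_inflection_type z : Prop :=
  Del_plus z = set0 /\ (Del_minus z = set0 \/ Gam z !=set0).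

Definition local_type z : Prop := Gam z !=set0 /\ Del z = set0.
Definition global_type z : Prop := Gam z = set0 /\ Del z !=set0.
Definition extruding_type z : Prop := Gam z !=set0 /\ Del z !=set0.

End Correspondences.

End Definitions.

(* Main.v *)
(* With R = q / p in lowest terms, R' = A / p^2 and R'' = B / p^3 for polynomials
   A and B.  At a point where p and B do not vanish, the curve of inflections is
   a smooth arc, parallel to the conjugate of R''; at its zeros of p B at least
   two branches cross.  So the singular points are roots of p B, and the tangency
   points are the points of the curve where moreover Im (R R'') = 0.

   In z and w = conj z both conditions are polynomial equations, of total degree
   d and 2 d.  Divided by their greatest common divisor H they have at most 2 d^2
   common zeros on w = conj z, by Bezout.  Near a tangency point with H = 0 the
   whole curve consists of tangency points: it is an integral curve of R along
   which R' is real, so the direction of R is constant and the arc is straight.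
   Its line carries R / v real for a direction v, is an axis of symmetry of the
   roots of p and of q, and passes through the centroid c of the roots of p q;
   the directions are counted by a polynomial in conj v / v.

   Finally let z in M be off the curve and off the roots of P Q, and suppose that
   its trajectory and its ray leave M at once.  Normalised so that R(z) = 1 and
   Im R'(z) > 0, the trajectory is convex and stays above the ray, and every point
   in between lies on a ray issued from the trajectory, hence outside M.  So a thin
   neighbourhood W of z can be chosen which the rays issued from W only leave
   outside M.  Then M minus W is still invariant, contradicting minimality. *)
Require Import Defs.
From HB Require Import structures.
From mathcomp Require Import all_boot all_order all_algebra.
From mathcomp Require Import all_classical all_reals all_analysis.
From mathcomp Require Import complex cyclic separable cyclotomic perm.
From mathcomp Require Import ring lra zify.
Set Implicit Arguments.
Unset Strict Implicit.
Unset Printing Implicit Defensive.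
Import Order.TTheory GRing.Theory Num.Theory numFieldNormedType.Exports.
Local Open Scope classical_set_scope.
Local Open Scope card_scope.
Local Open Scope ring_scope.
Local Open Scope complex_scope.
Local Notation "x ^*" := (conjc x) : ring_scope.

(** * The topology of K[i] *)

Local Notation mod := ComplexField.Normc.normc.

(** If [num2] vanishes, R' is constant: either it is not real and the curve is empty, or the field
    is affine with real slope and M lies on finitely many lines, which its interior forbids. So
    everything about the curve may assume B nonzero. Branches have to be C^1 arcs, hence two kinds
    of work: at roots of p B on the curve the arcs are constructed, by the implicit function theorem
    after a blow-up; elsewhere a second arc is excluded, because some projection is injective on the
    curve. The powers (z - u)^t enter only through the polynomial t Q + P (X - u): a root z of it
    with P(z) nonzero satisfies u = z + t R(z), which ties invariance to rays. A disc around z would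
    not do as the neighbourhood W, since rays issued from it may leave it and still hit M. Instead W
    is a thin band around the region between the ray and the trajectory, whose width grows along the
    ray fast enough to absorb the deviation of neighbouring rays. Conjugation reduces Im R' < 0 to
    Im R' > 0. *)

Section RealContinuity.
Variables (K : realType) (T : topologicalType).
Implicit Types (f : T -> K) (t : T) (c e : K).

Lemma cont_dist f t e : {for t, continuous f} -> 0 < e ->
  \forall s \near t, `|f s - f t| < e.
Proof.
by move=> ft e0; apply: filterS (cvgr_dist_lt _ _ ft _ e0) => s; rewrite distrC.
Qed.

Lemma dist_cont f t :
  (forall e, 0 < e -> \forall s \near t, `|f s - f t| <= e) ->
  {for t, continuous f}.
Proof.
move=> h; apply/(@cvgrPdist_le _ _ _ (nbhs t)) => e /h.
by apply: filterS => s; rewrite distrC.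
Qed.

Lemma cont_lt f t c : {for t, continuous f} -> f t < c ->
  \forall s \near t, f s < c.
Proof. by move=> ft; exact: cvgr_lt ft _. Qed.

Lemma cont_gt f t c : {for t, continuous f} -> c < f t ->
  \forall s \near t, c < f s.
Proof. by move=> ft; exact: cvgr_gt ft _. Qed.

End RealContinuity.

Section ComplexPlane.
Variable K : realType.
Implicit Types (z w u : K[i]) (x y e : K).

Lemma ReD z w : complex.Re (z + w) = complex.Re z + complex.Re w.
Proof. by case: z w => [a b] [c d]. Qed.

Lemma ImD z w : complex.Im (z + w) = complex.Im z + complex.Im w.
Proof. by case: z w => [a b] [c d]. Qed.

Lemma ReN z : complex.Re (- z) = - complex.Re z.
Proof. by case: z. Qed.

Lemma ImN z : complex.Im (- z) = - complex.Im z.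
Proof. by case: z. Qed.

Lemma ReM z w : complex.Re (z * w) =
  complex.Re z * complex.Re w - complex.Im z * complex.Im w.
Proof. by case: z w => [a b] [c d]. Qed.

Lemma ImM z w : complex.Im (z * w) =
  complex.Re z * complex.Im w + complex.Im z * complex.Re w.
Proof. by case: z w => [a b] [c d]. Qed.

Lemma ReJ z : complex.Re z^* = complex.Re z.
Proof. by case: z. Qed.

Lemma ImJ z : complex.Im z^* = - complex.Im z.
Proof. by case: z. Qed.

Lemma ReC x : complex.Re x%:C = x. Proof. by []. Qed.

Lemma ImC x : complex.Im x%:C = 0. Proof. by []. Qed.

Lemma ImMC x z : complex.Im (x%:C * z) = x * complex.Im z.
Proof. by rewrite ImM ReC ImC mul0r addr0. Qed.

Lemma complex_eqP z w :
  complex.Re z = complex.Re w -> complex.Im z = complex.Im w -> z = w.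
Proof. by case: z w => [a b] [c d] /= -> ->. Qed.

Lemma normE z : `|z| = (mod z)%:C. Proof. by []. Qed.

Lemma mod_ge0 z : 0 <= mod z.
Proof. by case: z => a b; apply: sqrtr_ge0. Qed.

Lemma modD z w : mod (z + w) <= mod z + mod w.
Proof. exact: le_normcD. Qed.

Lemma modN z : mod (- z) = mod z.
Proof. by case: z => a b /=; rewrite !sqrrN. Qed.

Lemma modB z w : mod (z - w) = mod (w - z).
Proof. by rewrite -modN opprB. Qed.

Lemma modM z w : mod (z * w) = mod z * mod w.
Proof. exact: ComplexField.Normc.normcM. Qed.

Lemma modC x : mod x%:C = `|x|.
Proof. by rewrite /= expr0n /= addr0 sqrtr_sqr. Qed.

Lemma mod0 : mod (0 : K[i]) = 0.
Proof. exact: ComplexField.Normc.normc0. Qed.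

Lemma mod1 : mod (1 : K[i]) = 1.
Proof. exact: ComplexField.Normc.normc1. Qed.

Lemma mod_eq0 z : (mod z == 0) = (z == 0).
Proof.
apply/eqP/eqP => [|->]; last by rewrite mod0.
exact: ComplexField.Normc.eq0_normc.
Qed.

Lemma mod_gt0 z : (0 < mod z) = (z != 0).
Proof. by rewrite lt_def mod_eq0 mod_ge0 andbT. Qed.

Lemma modV z : mod z^-1 = (mod z)^-1.
Proof. exact: ComplexField.Normc.normcV. Qed.

Lemma modX z n : mod (z ^+ n) = mod z ^+ n.
Proof. by elim: n => [|n IH]; rewrite ?expr0 ?mod1 // !exprS modM IH. Qed.

Lemma modJ z : mod z^* = mod z.
Proof. by case: z => a b /=; rewrite sqrrN. Qed.

Lemma sqr_mod z : mod z ^+ 2 = complex.Re z ^+ 2 + complex.Im z ^+ 2.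
Proof. by case: z => a b /=; rewrite sqr_sqrtr // addr_ge0 ?sqr_ge0. Qed.

Lemma mulJ z : z * z^* = (mod z ^+ 2)%:C.
Proof.
rewrite sqr_mod; apply: complex_eqP;
  rewrite ?ReM ?ImM ReJ ImJ ?ReC ?ImC; ring.
Qed.

Lemma Re_le_mod z : `|complex.Re z| <= mod z.
Proof.
by rewrite -(ler_pXn2r (n := 2)) ?nnegrE ?mod_ge0 // sqr_mod real_normK
  ?num_real // lerDl sqr_ge0.
Qed.

Lemma Im_le_mod z : `|complex.Im z| <= mod z.
Proof.
by rewrite -(ler_pXn2r (n := 2)) ?nnegrE ?mod_ge0 // sqr_mod real_normK
  ?num_real // lerDr sqr_ge0.
Qed.

Lemma mod_le_ReIm z : mod z <= `|complex.Re z| + `|complex.Im z|.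
Proof.
rewrite -(ler_pXn2r (n := 2)) ?nnegrE ?mod_ge0 ?addr_ge0 // sqr_mod.
rewrite sqrrD !real_normK ?num_real // lerD2r lerDl.
by rewrite mulrn_wge0 // mulr_ge0.
Qed.

Lemma dist_mod z w : `|mod z - mod w| <= mod (z - w).
Proof.
have h u v : mod u <= mod (u - v) + mod v by rewrite -{1}(subrK v u) modD.
by have := h z w; have := h w z; rewrite (modB w) ler_norml; lra.
Qed.

(** The norm of [K[i]] takes values in [K[i]], and so do the radii of its balls. Positivity forces a
    radius to be real, so that real radii and the real modulus [mod] suffice. *)
Lemma nbhsCP z (U : set K[i]) :
  nbhs z U <-> exists2 e, 0 < e & forall w, mod (w - z) < e -> U w.
Proof.
split => [/nbhs_ballP[e /= e0 zU]|[e e0 zU]].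
  have eE : e = (complex.Re e)%:C.
    by move: e0; rewrite ltcE => /andP[/eqP /= ie _]; apply: complex_eqP.
  have e0' : 0 < complex.Re e by move: e0; rewrite ltcE => /andP[].
  exists (complex.Re e) => // w wz; apply: zU.
  by rewrite /ball /= eE -normrN opprB normE ltcR.
apply/nbhs_ballP; exists e%:C => /=; first by rewrite ltcR.
move=> w; rewrite /ball /= -normrN opprB normE ltcR; exact: zU.
Qed.

Lemma near_mod z e : 0 < e -> \forall w \near z, mod (w - z) < e.
Proof. by move=> e0; apply/nbhsCP; exists e. Qed.

Lemma cvgCP (T : Type) (F : set_system T) {FF : Filter F} (f : T -> K[i]) l :
  f @ F --> l <-> forall e, 0 < e -> \forall t \near F, mod (f t - l) < e.
Proof.
split=> [fl e e0|fl U].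
  by have := fl _ (near_mod l e0).
by move=> /nbhsCP[e e0 lU]; near do apply: lU; exact: fl.
Unshelve. all: by end_near. Qed.

Lemma cvg_ReIm (T : Type) (F : set_system T) {FF : Filter F} (f : T -> K[i]) l :
  f @ F --> l <-> (fun t => complex.Re (f t)) @ F --> complex.Re l /\
    (fun t => complex.Im (f t)) @ F --> complex.Im l.
Proof.
split=> [/cvgCP fl|[/cvgrPdist_lt fr /cvgrPdist_lt fi]].
  split; apply/cvgrPdist_lt => e /fl; apply: filterS => t; apply: le_lt_trans.
    by rewrite distrC -ReN -ReD Re_le_mod.
  by rewrite distrC -ImN -ImD Im_le_mod.
apply/cvgCP => e e0; have e2 : 0 < e / 2 by rewrite divr_gt0.
move: (fr _ e2) (fi _ e2); apply: filterS2 => t h1 h2.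
rewrite (le_lt_trans (mod_le_ReIm _)) // ReD ImD ReN ImN distrC.
by rewrite [`|complex.Im _ - _|]distrC [e]splitr ltrD.
Qed.

Lemma cvgC (T : Type) (F : set_system T) {FF : Filter F} (f : T -> K[i]) l :
  (fun t => complex.Re (f t)) @ F --> complex.Re l ->
  (fun t => complex.Im (f t)) @ F --> complex.Im l -> f @ F --> l.
Proof. by move=> fr fi; exact/cvg_ReIm. Qed.

Lemma cvgRe (T : Type) (F : set_system T) {FF : Filter F} (f : T -> K[i]) l :
  f @ F --> l -> (fun t => complex.Re (f t)) @ F --> complex.Re l.
Proof. by move=> /cvg_ReIm[]. Qed.

Lemma cvgIm (T : Type) (F : set_system T) {FF : Filter F} (f : T -> K[i]) l :
  f @ F --> l -> (fun t => complex.Im (f t)) @ F --> complex.Im l.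
Proof. by move=> /cvg_ReIm[]. Qed.

Lemma cvg_near_mod (T : Type) (F : set_system T) {FF : Filter F}
    (f : T -> K[i]) l e :
  f @ F --> l -> 0 < e -> \forall t \near F, mod (f t - l) < e.
Proof. by move=> /cvgCP; apply. Qed.

Lemma continuousC (T : topologicalType) (f : T -> K[i]) t :
  {for t, continuous (fun s => complex.Re (f s))} ->
  {for t, continuous (fun s => complex.Im (f s))} -> {for t, continuous f}.
Proof. exact: cvgC. Qed.

Lemma continuous_Re (T : topologicalType) (f : T -> K[i]) t :
  {for t, continuous f} -> {for t, continuous (fun s => complex.Re (f s))}.
Proof. exact: cvgRe. Qed.

Lemma continuous_Im (T : topologicalType) (f : T -> K[i]) t :
  {for t, continuous f} -> {for t, continuous (fun s => complex.Im (f s))}.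
Proof. exact: cvgIm. Qed.

Lemma Re_continuous : continuous (@complex.Re K).
Proof. by move=> z; exact: (@continuous_Re _ id). Qed.

Lemma Im_continuous : continuous (@complex.Im K).
Proof. by move=> z; exact: (@continuous_Im _ id). Qed.

Lemma conjc_continuous : continuous (@conjc K).
Proof.
move=> z; apply: continuousC.
  have -> : (fun t => complex.Re (conjc t)) = @complex.Re K.
    by apply/funext => -[].
  exact: Re_continuous.
have -> : (fun t : K[i] => complex.Im (conjc t)) = (fun t => - complex.Im t).
  by apply/funext => -[].
by apply: continuousN; exact: Im_continuous.
Qed.

Lemma real_complex_continuous : continuous (fun x : K => x%:C).
Proof. by move=> x; apply: continuousC; [exact: cvg_id|exact: cvg_cst]. Qed.

Lemma mod_continuous : continuous (@ComplexField.Normc.normc K).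
Proof.
move=> z; apply/(@cvgrPdist_lt _ _ _ (nbhs z)) => e e0; near=> w.
have h : mod (w - z) < e by near: w; exact: near_mod.
by apply: le_lt_trans h; rewrite modB dist_mod.
Unshelve. all: by end_near. Qed.

Section Continuity.
Variable T : topologicalType.
Implicit Types (f g : T -> K[i]) (h : K[i] -> K[i]) (t : T).

Lemma contC_cst (c : K[i]) t : {for t, continuous (fun _ : T => c)}.
Proof. exact: cvg_cst. Qed.

Lemma contC_D f g t : {for t, continuous f} -> {for t, continuous g} ->
  {for t, continuous (fun s => f s + g s)}.
Proof. exact: cvgD. Qed.

Lemma contC_N f t : {for t, continuous f} ->
  {for t, continuous (fun s => - f s)}.
Proof. exact: cvgN. Qed.

Lemma contC_M f g t : {for t, continuous f} -> {for t, continuous g} ->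
  {for t, continuous (fun s => f s * g s)}.
Proof. exact: cvgM. Qed.

Lemma contC_X f n t : {for t, continuous f} ->
  {for t, continuous (fun s => f s ^+ n)}.
Proof.
move=> ft; elim: n => [|n IH].
  exact: (@contC_cst 1).
have -> : (fun s => f s ^+ n.+1) = (fun s => f s * f s ^+ n).
  by apply/funext => s; rewrite exprS.
exact: contC_M.
Qed.

Lemma contC_comp h f t : {for t, continuous f} -> {for f t, continuous h} ->
  {for t, continuous (fun s => h (f s))}.
Proof. exact: continuous_comp. Qed.

Lemma contC_V f t : {for t, continuous f} -> f t != 0 ->
  {for t, continuous (fun s => (f s)^-1)}.
Proof. by move=> ft ft0; apply: cvgV. Qed.

Lemma contC_J f t : {for t, continuous f} ->
  {for t, continuous (fun s => (f s)^*)}.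
Proof. by move=> ft; exact: (contC_comp ft (@conjc_continuous _)). Qed.

Lemma contC_real (x : T -> K) t : {for t, continuous x} ->
  {for t, continuous (fun s => (x s)%:C)}.
Proof.
by move=> xt; apply: (@continuous_comp _ _ _ x) => //;
  exact: real_complex_continuous.
Qed.

End Continuity.

Lemma horner_continuous_at (p : {poly K[i]}) z : {for z, continuous (horner p)}.
Proof.
elim/poly_ind: p z => [|p c IH] z.
  have -> : horner (0 : {poly K[i]}) = cst 0.
    by apply/funext => w; rewrite horner0.
  exact: contC_cst.
have -> : horner (p * 'X + c%:P) = (fun w => p.[w] * w + c).
  by apply/funext => w; rewrite hornerMXaddC.
apply: contC_D; last exact: contC_cst.
by apply: contC_M; [exact: IH|exact: cvg_id].
Qed.

Lemma contC_horner (T : topologicalType) (p : {poly K[i]}) (f : T -> K[i]) t :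
  {for t, continuous f} -> {for t, continuous (fun s => p.[f s])}.
Proof. by move=> ft; exact: (contC_comp ft (@horner_continuous_at p _)). Qed.

Lemma closure_modP (A : set K[i]) z :
  closure A z <-> forall e, 0 < e -> exists2 w, A w & mod (w - z) < e.
Proof.
split=> [cA e e0|cA U /nbhsCP[e /cA[w Aw we] zU]].
  by have [w [Aw we]] := cA _ (near_mod z e0); exists w.
by exists w; split => //; exact: zU.
Qed.

Lemma near_neq0 (f : K[i] -> K[i]) z :
  {for z, continuous f} -> f z != 0 -> \forall w \near z, f w != 0.
Proof.
rewrite -mod_gt0 => fz fz0; near=> w.
have : mod (f w - f z) < mod (f z) by near: w; exact: cvg_near_mod.
by apply: contraTneq => ->; rewrite sub0r modN ltxx.
Unshelve. all: by end_near. Qed.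

End ComplexPlane.

(** * Curves in K[i] *)

Section CurveCalculus.
Variable K : realType.
Implicit Types (g h : K -> K[i]) (t : K) (v w : K[i]).

(** Curves of a real variable are differentiated by components, in a form that carries the value, so
    that the rules below compose without computing [curve_deriv]. *)
Definition cder g t v : Prop :=
  is_derive t 1 (fun s => complex.Re (g s)) (complex.Re v) /\
  is_derive t 1 (fun s => complex.Im (g s)) (complex.Im v).

Lemma cderP g t v :
  cder g t v <-> curve_derivable g t /\ curve_deriv g t = v.
Proof.
split=> [[[dr er] [di ei]]|[[dr di] <-]].
  split; first by split.
  by apply: complex_eqP; rewrite /= derive1E.
by split; (split => //); rewrite /= derive1E.
Qed.

Lemma cder_cst v t : cder (fun _ => v) t 0.
Proof. by split; exact: is_derive_cst. Qed.

Lemma cder_real (x : K -> K) t d : is_derive t 1 x d -> cder (fun s => (x s)%:C) t d%:C.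
Proof. by move=> ?; split => //=; exact: is_derive_cst. Qed.

Lemma cderD g h t v w : cder g t v -> cder h t w ->
  cder (fun s => g s + h s) t (v + w).
Proof.
move=> [gr gi] [hr hi]; split.
  under eq_fun do rewrite ReD.
  by rewrite ReD; exact: is_deriveD.
under eq_fun do rewrite ImD.
by rewrite ImD; exact: is_deriveD.
Qed.

Lemma cderN g t v : cder g t v -> cder (fun s => - g s) t (- v).
Proof.
move=> [gr gi]; split.
  under eq_fun do rewrite ReN.
  by rewrite ReN; exact: is_deriveN.
under eq_fun do rewrite ImN.
by rewrite ImN; exact: is_deriveN.
Qed.

Lemma cderJ g t v : cder g t v -> cder (fun s => (g s)^*) t v^*.
Proof.
move=> [gr gi]; split.
  under eq_fun do rewrite ReJ.
  by rewrite ReJ.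
under eq_fun do rewrite ImJ.
by rewrite ImJ; exact: is_deriveN.
Qed.

Lemma cderM g h t v w : cder g t v -> cder h t w ->
  cder (fun s => g s * h s) t (v * h t + g t * w).
Proof.
move=> [gr gi] [hr hi]; split.
  under eq_fun do rewrite ReM.
  have -> : complex.Re (v * h t + g t * w) =
    (complex.Re (g t) * complex.Re w + complex.Re (h t) * complex.Re v) -
    (complex.Im (g t) * complex.Im w + complex.Im (h t) * complex.Im v).
    by rewrite ReD !ReM; ring.
  by apply: is_deriveB; exact: is_deriveM.
under eq_fun do rewrite ImM.
have -> : complex.Im (v * h t + g t * w) =
    (complex.Re (g t) * complex.Im w + complex.Im (h t) * complex.Re v) +
    (complex.Im (g t) * complex.Re w + complex.Re (h t) * complex.Im v).
  by rewrite ImD !ImM; ring.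
by apply: is_deriveD; exact: is_deriveM.
Qed.

Lemma cder_horner (p : {poly K[i]}) g t v : cder g t v ->
  cder (fun s => p.[g s]) t (p^`().[g t] * v).
Proof.
move=> gv; elim/poly_ind: p => [|p c IH].
  have -> : (fun s => (0 : {poly K[i]}).[g s]) = fun=> 0.
    by apply/funext => s; rewrite horner0.
  by rewrite deriv0 horner0 mul0r; exact: cder_cst.
have -> : (fun s => (p * 'X + c%:P).[g s]) = (fun s => p.[g s] * g s + c).
  by apply/funext => s; rewrite hornerMXaddC.
rewrite derivD derivM derivX derivC addr0 mulr1 hornerD hornerMX -[X in cder _ _ X]addr0.
rewrite mulrDl mulrAC.
by apply: cderD (cder_cst _ _); apply: cderM.
Qed.

Lemma cder_cont g t v : cder g t v -> {for t, continuous g}.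
Proof.
move=> [[dr _] [di _]].
by apply: continuousC; apply: differentiable_continuous; exact/derivable1_diffP.
Qed.

Lemma cder_near g h t v : (\forall s \near t, g s = h s) -> cder g t v -> cder h t v.
Proof.
move=> gh [gr gi]; split.
  by apply: near_eq_is_derive gr; apply: filterS gh => s ->.
by apply: near_eq_is_derive gi; apply: filterS gh => s ->.
Qed.

Lemma cder_Re0 g t v : cder g t v -> (\forall s \near t, complex.Im (g s) = 0) ->
  complex.Im v = 0.
Proof.
move=> [_ gi] g0.
have h : is_derive t 1 (fun=> 0) (complex.Im v).
  by apply: near_eq_is_derive gi.
by have [_ <-] := h; rewrite derive_cst.
Qed.

End CurveCalculus.

(** * The implicit function theorem *)

Section ImplicitFunction.
Variable K : realType.

(** Caratheodory's form of the derivative: any slope function with a limit at [r] will do, in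
    particular one given by mean value points. *)
Lemma is_derive_quot (f q : K -> K) (r d : K) :
  (\forall x \near r, f x - f r = q x * (x - r)) -> q x @[x --> r] --> d ->
  is_derive r 1 f d.
Proof.
move=> fq qd.
have shr : h + r @[h --> (0 : K)] --> r.
  have : h + r @[h --> (0 : K)] --> 0 + r by apply: cvgD; [exact: cvg_id|exact: cvg_cst].
  by rewrite add0r.
have H : h^-1 *: (f (h *: 1 + r) - f r) @[h --> 0^'] --> d.
  have qd' : q (h + r) @[h --> (0 : K)^'] --> d.
    apply: (@cvg_comp _ _ _ (fun h => h + r) q (0^') (nbhs r)) => //.
    exact: cvg_within_filter.
  apply: cvg_trans qd'; apply: near_eq_cvg; near=> h.
  have h0 : h != 0 by near: h; exact: nbhs_dnbhs_neq.
  have -> : f (h *: 1 + r) - f r = q (h + r) * h.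
    rewrite [h *: 1]mulr1 -[X in _ * X](addrK r h).
    by near: h; apply: nbhs_dnbhs; exact: shr fq.
  by rewrite [_ *: _]mulrC mulfK.
apply: DeriveDef; first by apply/cvg_ex; exists d.
exact/cvg_lim.
Unshelve. all: by end_near. Qed.

Lemma is_derive_cont (F : K -> K) (x d : K) : is_derive x 1 F d -> {for x, continuous F}.
Proof.
by move=> [dF _]; apply: differentiable_continuous; exact/derivable1_diffP.
Qed.

Lemma mvt_between (F dF : K -> K) (a b : K) :
  (forall x : K, is_derive x 1 F (dF x)) ->
  exists2 c, Num.min a b <= c <= Num.max a b & F b - F a = dF c * (b - a).
Proof.
move=> dFE; have ctn (x y : K) : {within `[x, y], continuous F}.
  by apply: continuous_subspaceT => z; exact: is_derive_cont (dFE z).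
have [ab|ba] := leP a b.
  have [c /itvP cab ->] := MVT_segment ab (fun x _ => dFE x) (ctn _ _).
  by exists c => //; rewrite !cab.
have [c /itvP cab e] := MVT_segment (ltW ba) (fun x _ => dFE x) (ctn _ _).
by exists c; [rewrite !cab|rewrite -opprB e -mulrN opprB].
Qed.

Variables Psi Pr Pt : K -> K -> K.
Hypothesis der_r : forall r t : K, is_derive r 1 (Psi^~ t) (Pr r t).
Hypothesis der_t : forall r t : K, is_derive t 1 (Psi r) (Pt r t).
Hypothesis cont_r : forall p, {for p, continuous (fun p : K * K => Pr p.1 p.2)}.
Hypothesis cont_t : forall p, {for p, continuous (fun p : K * K => Pt p.1 p.2)}.
Hypothesis Psi0 : Psi 0 0 = 0.
Hypothesis Pt0 : 0 < Pt 0 0.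

Lemma box_bounds (e : K) : 0 < e -> exists a C m : K,
  [/\ 0 < a <= e, 0 < C, 0 < m &
    forall r t : K, `|r| <= a -> `|t| <= a -> `|Pr r t| <= C /\ m <= Pt r t].
Proof.
move=> e0; pose m := Pt 0 0 / 2; pose C := `|Pr 0 0| + 1.
have m0 : 0 < m by rewrite divr_gt0.
have : \forall p \near ((0, 0) : K * K), `|Pr p.1 p.2| <= C /\ m <= Pt p.1 p.2.
  near=> p; split.
    have : `|Pr 0 0 - Pr p.1 p.2| < 1.
      by rewrite distrC; near: p; exact: (cont_dist (@cont_r (0, 0)) ltr01).
    by rewrite distrC => h; have := ler_distD 0 (Pr p.1 p.2) (Pr 0 0);
      rewrite -lerBlDr => _; apply: le_trans (_ : `|Pr 0 0| + `|Pr p.1 p.2 - Pr 0 0| <= _);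
      [rewrite -[X in `|X| <= _](subrK (Pr 0 0)) addrC; exact: ler_normD|rewrite lerD2l ltW].
  have : `|Pt 0 0 - Pt p.1 p.2| < m.
    by rewrite distrC; near: p; exact: (cont_dist (@cont_t (0, 0)) m0).
  by rewrite ltr_norml /m; lra.
move=> [[U V] /= [/nbhs_ballP[u /= u0 uU] /nbhs_ballP[v /= v0 vV]] UV].
exists (Num.min e (Num.min u v / 2)), C, m; split => //.
- by rewrite lt_min e0 divr_gt0 ?lt_min ?u0 // ge_min lexx.
- by rewrite ltr_wpDl.
- move=> r t; rewrite !le_min => /andP[_ ru] /andP[_ tv].
  have uv0 : 0 < Num.min u v by rewrite lt_min u0.
  apply: (UV (r, t)); split; [apply: uU|apply: vV];
    rewrite /ball /= sub0r normrN.
    rewrite (le_lt_trans ru) // ltr_pdivrMr // (@le_lt_trans _ _ u) ?ge_min ?lexx //.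
    by rewrite ltr_pMr // ltr1n.
  rewrite (le_lt_trans tv) // ltr_pdivrMr // (@le_lt_trans _ _ v) ?ge_min ?lexx ?orbT //.
  by rewrite ltr_pMr // ltr1n.
Unshelve. all: by end_near. Qed.

(** On the box [Psi] is strictly increasing in [t]: the intermediate value theorem gives the zero
    [f r], monotonicity its uniqueness. Since only partial derivatives are given, the increment of
    [f] comes from two mean values, [0 = Pr xi (f r') * (r' - r) + Pt r eta * (f r' - f r)]. *)
Lemma implicit_function (e : K) : 0 < e -> exists (a b : K) (f df : K -> K),
  [/\ 0 < a <= e, 0 < b <= e, f 0 = 0,
    forall r : K, `|r| < b -> [/\ `|f r| <= a, Psi r (f r) = 0,
      is_derive r 1 f (df r) & {for r, continuous df}] &
    forall r t : K, `|r| < b -> `|t| <= a -> Psi r t = 0 -> t = f r].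
Proof.
move=> /box_bounds[a [C [m [/andP[a0 ae] C0 m0 bnd]]]].
have inc (r t t' : K) : `|r| <= a -> `|t| <= a -> `|t'| <= a -> t < t' ->
    m * (t' - t) <= Psi r t' - Psi r t.
  move=> ra ta t'a tt'.
  have [c] := mvt_between t t' (der_t r); rewrite (min_l (ltW tt')) (max_r (ltW tt')) => /andP[tc ct'] ->.
  rewrite ler_pM2r ?subr_gt0 //; apply: (bnd r c _ _).2 => //.
  by move: ta t'a; rewrite !ler_norml => /andP[h1 h2] /andP[h3 h4]; apply/andP; lra.
have Psi0a : Psi 0 (- a) < 0 < Psi 0 a.
  have na : `|a| <= a by rewrite ger0_norm // ltW.
  have h0 : `|0 : K| <= a by rewrite normr0 ltW.
  have hN : `|- a| <= a by rewrite normrN.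
  have aN : - a < 0 by rewrite oppr_lt0.
  have := inc 0 _ _ h0 hN h0 aN; have := inc 0 _ _ h0 h0 na a0.
  have ma : 0 < m * a by rewrite mulr_gt0.
  by rewrite Psi0 => h1 h2; apply/andP; split; lra.
have [b [b0 ba bPsi]] : exists b : K, [/\ 0 < b, b <= a &
    forall r : K, `|r| < b -> Psi r (- a) < 0 < Psi r a].
  have : \forall r \near (0 : K), Psi r (- a) < 0 < Psi r a.
    case/andP: Psi0a => h1 h2; near=> r; apply/andP; split.
      by near: r; apply: (@cont_lt _ _ (Psi^~ (- a)) 0 0) => //; exact: is_derive_cont (der_r _ _).
    by near: r; apply: (@cont_gt _ _ (Psi^~ a) 0 0) => //; exact: is_derive_cont (der_r _ _).
  move=> /nbhs_ballP[b /= b0 bP]; exists (Num.min a b); split.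
  - by rewrite lt_min a0.
  - by rewrite ge_min lexx.
  - move=> r; rewrite lt_min => /andP[_ rb]; apply: bP.
    by rewrite /ball /= sub0r normrN.
have ex (r : K) : exists t, `|r| < b -> `|t| <= a /\ Psi r t = 0.
  have [rb|] := boolP (`|r| < b); last by exists 0.
  case/andP: (bPsi _ rb) => h1 h2.
  have Na : - a <= a by rewrite ge0_cp // ltW.
  have ct : {within `[- a, a], continuous (Psi r)}.
    by apply: continuous_subspaceT => z; exact: is_derive_cont (der_t r z).
  have [|t] := @IVT _ (Psi r) (- a) a 0 Na ct.
    by rewrite ge_min (ltW h1) /= le_max (ltW h2) orbT.
  by rewrite in_itv /= => ta t0; exists t => _; rewrite ler_norml.
have [f fP] := choice ex.
have uniq (r t : K) : `|r| < b -> `|t| <= a -> Psi r t = 0 -> t = f r.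
  move=> rb ta t0; have [fa f0] := fP r rb.
  have ra : `|r| <= a by rewrite (le_trans (ltW rb)).
  have [tf|ft|//] := ltgtP t (f r).
    have := inc r _ _ ra ta fa tf; rewrite t0 f0 subrr.
    by rewrite leNgt mulr_gt0 ?subr_gt0.
  have := inc r _ _ ra fa ta ft; rewrite t0 f0 subrr.
  by rewrite leNgt mulr_gt0 ?subr_gt0.
pose df (r : K) := - Pr r (f r) / Pt r (f r).
have quot (r r' : K) : exists xi eta : K, `|r| < b -> `|r'| < b ->
    [/\ Num.min r r' <= xi <= Num.max r r',
        Num.min (f r) (f r') <= eta <= Num.max (f r) (f r'),
        `|Pr xi (f r')| <= C, m <= Pt r eta &
        f r' - f r = - Pr xi (f r') / Pt r eta * (r' - r)].
  have [rb|] := boolP (`|r| < b); last by exists 0, 0.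
  have [r'b|] := boolP (`|r'| < b); last by exists 0, 0.
  have [fa f0] := fP r rb; have [f'a f'0] := fP r' r'b.
  have [xi xiP e1] := mvt_between r r' (fun x => der_r x (f r')).
  have [eta etaP e2] := mvt_between (f r) (f r') (der_t r).
  exists xi, eta => _ _.
  have bx (x y c d : K) : Num.min x y <= c <= Num.max x y -> `|x| <= d -> `|y| <= d ->
      `|c| <= d.
    rewrite !ler_norml ge_min le_max => /andP[/orP h1 /orP h2] /andP[h3 h4] /andP[h5 h6].
    by apply/andP; case: h1; case: h2; lra.
  have xia : `|xi| <= a by apply: bx xiP _ _; apply: le_trans ba; exact: ltW.
  have ea : `|eta| <= a by apply: bx etaP _ _.
  have ra : `|r| <= a by rewrite (le_trans (ltW rb)).
  have [hC _] := bnd _ _ xia f'a; have [_ hm] := bnd _ _ ra ea.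
  split => //.
  have Pt_neq0 : Pt r eta != 0 by rewrite gt_eqF // (lt_le_trans m0).
  apply: (mulfI Pt_neq0); rewrite mulrA [_ * (_ / _)]mulrC divfK // mulNr -e1 mulrC -mulrC.
  by move: e2; rewrite [Pt r eta * _]mulrC mulrC => <-; rewrite f'0 f0; ring.
(* The quotient formula bounds the increments of [f] before [f] is known to be continuous;
   continuity then makes the mean value points converge. *)
have lip (r r' : K) : `|r| < b -> `|r'| < b -> `|f r' - f r| <= C / m * `|r' - r|.
  move=> rb r'b; have [xi [eta /(_ rb r'b)[_ _ hC hm ->]]] := quot r r'.
  have ptp : 0 < Pt r eta by rewrite (lt_le_trans m0).
  rewrite normrM ler_wpM2r // normrM normrN normfV (gtr0_norm ptp).
  by apply: ler_pM => //; [rewrite invr_ge0 ltW|rewrite lef_pV2 ?posrE].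
have near_b (r : K) : `|r| < b -> \forall x \near r, `|x| < b.
  by move=> rb; exact: (@cvgr_norm_lt _ _ _ (nbhs r) _ id r (@cvg_id _ _) b rb).
exists a, b, f, df; split; rewrite ?a0 ?b0 //.
- exact: le_trans ba ae.
- by apply/esym/uniq; rewrite ?normr0 // ltW.
move=> r rb; have [fa f0] := fP r rb.
have fc : {for r, continuous f}.
  apply: dist_cont => d d0; near=> x.
  have xb : `|x| < b by near: x; exact: (near_b r rb).
  rewrite (le_trans (lip _ _ rb xb)) // mulrC -ler_pdivlMr ?divr_gt0 //.
  by apply/ltW; near: x; apply: (@cont_dist _ _ id); [exact: cvg_id|rewrite !divr_gt0].
have Ptf : Pt r (f r) != 0.
  have [_ h] := bnd r (f r) (le_trans (ltW rb) ba) fa.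
  by rewrite gt_eqF // (lt_le_trans m0).
have cp (A : K -> K -> K) (u v : K -> K) :
    (forall p, {for p, continuous (fun p : K * K => A p.1 p.2)}) ->
    u x @[x --> r] --> r -> v x @[x --> r] --> f r ->
    A (u x) (v x) @[x --> r] --> A r (f r).
  move=> Ac ur vr.
  exact: (cvg_comp2 ur vr (Ac (r, f r))).
split => //; last first.
  by apply: cvgM; [apply: cvgN|apply: cvgV => //]; apply: cp => //; exact: cvg_id.
have [xi' xiP] := choice (quot r); have [eta etaP] := choice xiP.
have sq (u v g : K -> K) : (forall x : K, `|x| < b -> Num.min (g r) (g x) <= u x <= Num.max (g r) (g x)) ->
    {for r, continuous g} -> u x @[x --> r] --> g r.
  move=> h gc; apply/(@cvgrPdist_le _ _ _ (nbhs r)) => d d0; near=> x.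
  have xb : `|x| < b by near: x; exact: (near_b r rb).
  have : `|g r - g x| <= d by rewrite distrC ltW //; near: x; exact: (cont_dist gc).
  have := h x xb; rewrite !ler_norml ge_min le_max => /andP[/orP h1 /orP h2] /andP[h3 h4].
  by apply/andP; case: h1; case: h2; lra.
apply: (@is_derive_quot _ (fun x => - Pr (xi' x) (f x) / Pt r (eta x))).
  near=> x; have xb : `|x| < b by near: x; exact: (near_b r rb).
  by have [] := etaP x rb xb.
apply: cvgM; [apply: cvgN; apply: cp => //|apply: cvgV => //; apply: (cp _ (fun=> r)) => //].
- apply: (sq _ id id) => [x xb|]; last exact: cvg_id.
  by have [] := etaP x rb xb.
- exact: cvg_cst.
- apply: (sq _ id f) => // x xb.
  by have [] := etaP x rb xb.
Unshelve. all: by end_near. Qed.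

End ImplicitFunction.

(** * Branches of real plane curves *)

Lemma primitive_root_exists (C : numClosedFieldType) (n : nat) :
  (0 < n)%N -> exists z : C, n.-primitive_root z.
Proof.
move=> n_gt0; have [rs] := closed_field_poly_normal ('X^n - 1 : {poly C}).
rewrite (monicP (monicXnsubC 1 n_gt0)) scale1r => prodE.
have uniq_rs : uniq rs.
  rewrite -separable_prod_XsubC -prodE separable_Xn_sub_1 //.
  by rewrite pnatr_eq0 -lt0n.
have unity_rs : all n.-unity_root rs.
  by apply/allP => z; rewrite /root_of_unity prodE root_prod_XsubC.
have size_rs : (n <= size rs)%N.
  by rewrite -ltnS -(size_prod_XsubC rs id) -prodE size_XnsubC.
by have /hasP[z _ zP] := has_prim_root n_gt0 unity_rs uniq_rs size_rs; exists z.
Qed.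

Section Arc.
Variable K : realType.
Variables (z0 omega : K[i]) (k : nat) (E D : {poly K[i]}).
Hypotheses (k_gt0 : (0 < k)%N) (omega_neq0 : omega != 0).

(** Its imaginary part is the local equation of the curve in both cases: at a regular point [k] is
    the order of [A - c p^2] and [D = p^2]; at a pole of order [m], [k = m + 1], [E = p1^2] and
    [D = A1]. *)
Definition twisted (w : K[i]) : K[i] := (w - z0) ^+ k * (E.[w] * (D.[w])^*).

Hypothesis coef_neq0 : E.[z0] * (D.[z0])^* != 0.
Hypothesis dir_real : complex.Im (omega ^+ k * (E.[z0] * (D.[z0])^*)) = 0.

(** Blow-up of [z0]: [r] runs along the direction [omega] and [t] is the slope relative to it. In
    these coordinates the factor [r ^+ k] splits off ([twistedE]), and what remains can be solved
    for [t]. The real constant [beta] inside [kappa] makes the [t]-derivative of its imaginary part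
    at the origin equal to [beta ^+ 2 * k], positive whatever the sign of [beta]. *)
Let slope (t : K) : K[i] := 1 +i* t.
Let pt (r t : K) : K[i] := z0 + r%:C * omega * slope t.
Let beta : K := complex.Re (omega ^+ k * (E.[z0] * (D.[z0])^*)).
Let kappa : K[i] := beta%:C * omega ^+ k.

Let G (r t : K) : K[i] :=
  kappa * ('X^k).[slope t] * (E.[pt r t] * (D.[pt r t])^*).
Let Gr (r t : K) : K[i] := kappa * ('X^k).[slope t] *
  (E^`().[pt r t] * (omega * slope t) * (D.[pt r t])^* +
   E.[pt r t] * (D^`().[pt r t] * (omega * slope t))^*).
Let Gt (r t : K) : K[i] :=
  kappa * ('X^k)^`().[slope t] * 'i * (E.[pt r t] * (D.[pt r t])^*) +
  kappa * ('X^k).[slope t] *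
  (E^`().[pt r t] * (r%:C * omega * 'i) * (D.[pt r t])^* +
   E.[pt r t] * (D^`().[pt r t] * (r%:C * omega * 'i))^*).

Let beta_neq0 : beta != 0.
Proof.
have : omega ^+ k * (E.[z0] * (D.[z0])^*) != 0.
  by rewrite mulf_neq0 // expf_neq0.
by apply: contraNneq => b0; apply/eqP/complex_eqP.
Qed.

Let slope_cder t : cder slope t 'i.
Proof. by split => /=; [exact: is_derive_cst|exact: is_derive_id]. Qed.

Let pt_r r t : cder (pt^~ t) r (omega * slope t).
Proof.
have -> : omega * slope t = 0 + (1%:C * (omega * slope t) + r%:C * 0).
  by rewrite mulr0 add0r addr0 mul1r.
apply: cderD (cder_cst _ _) _.
have -> : (fun s : K => s%:C * omega * slope t) = (fun s => s%:C * (omega * slope t)).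
  by apply/funext => s; rewrite mulrA.
apply: cderM (cder_cst _ _); apply: cder_real; exact: is_derive_id.
Qed.

Let pt_t r t : cder (pt r) t (r%:C * omega * 'i).
Proof.
have -> : r%:C * omega * 'i = 0 + (0 * slope t + r%:C * omega * 'i).
  by rewrite mul0r !add0r.
by apply: cderD (cder_cst _ _) _; apply: cderM (cder_cst _ _) _.
Qed.

Let G_r r t : cder (G^~ t) r (Gr r t).
Proof.
rewrite -[Gr r t]add0r -[X in X + _](mul0r (E.[pt r t] * (D.[pt r t])^*)).
apply: cderM (cder_cst _ _) _; apply: cderM.
  exact: cder_horner.
by apply: cderJ; exact: cder_horner.
Qed.

Let G_t r t : cder (G r) t (Gt r t).
Proof.
apply: cderM.
  have -> : kappa * ('X^k)^`().[slope t] * 'i =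
      0 * ('X^k).[slope t] + kappa * (('X^k)^`().[slope t] * 'i).
    by rewrite mul0r add0r mulrA.
  apply: cderM (cder_cst _ _) _; exact: cder_horner.
apply: cderM; first exact: cder_horner.
by apply: cderJ; exact: cder_horner.
Qed.

Let slope_cont p : {for p, continuous (fun p : K * K => slope p.2)}.
Proof.
apply: continuousC => /=; first exact: cvg_cst.
exact: cvg_snd.
Qed.

Let r_cont p : {for p, continuous (fun p : K * K => (p.1)%:C)}.
Proof. by apply: contC_real; exact: cvg_fst. Qed.

Let pt_cont p : {for p, continuous (fun p : K * K => pt p.1 p.2)}.
Proof.
apply: contC_D; first exact: contC_cst.
apply: contC_M; last exact: slope_cont.
by apply: contC_M; [exact: r_cont|exact: contC_cst].
Qed.

Let Gr_cont p : {for p, continuous (fun p : K * K => Gr p.1 p.2)}.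
Proof.
have os : {for p, continuous (fun p : K * K => omega * slope p.2)}.
  by apply: contC_M; [exact: contC_cst|exact: slope_cont].
have hp q : {for p, continuous (fun p : K * K => q.[pt p.1 p.2])}.
  by apply: (contC_horner (p := q)); exact: pt_cont.
apply: contC_M.
  apply: contC_M; first exact: contC_cst.
  by apply: (contC_horner (p := 'X^k)); exact: slope_cont.
apply: contC_D; apply: contC_M.
- by apply: contC_M; [exact: hp|exact: os].
- by apply: contC_J; exact: hp.
- exact: hp.
- by apply: contC_J; apply: contC_M; [exact: hp|exact: os].
Qed.

Let Gt_cont p : {for p, continuous (fun p : K * K => Gt p.1 p.2)}.
Proof.
have os : {for p, continuous (fun p : K * K => (p.1)%:C * omega * 'i)}.
  apply: contC_M; last exact: contC_cst.
  by apply: contC_M; [exact: r_cont|exact: contC_cst].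
have hp q : {for p, continuous (fun p : K * K => q.[pt p.1 p.2])}.
  by apply: (contC_horner (p := q)); exact: pt_cont.
have hs q : {for p, continuous (fun p : K * K => kappa * q.[slope p.2])}.
  by apply: contC_M; [exact: contC_cst|by apply: (contC_horner (p := q)); exact: slope_cont].
apply: contC_D; apply: contC_M.
- by apply: contC_M; [exact: hs|exact: contC_cst].
- by apply: contC_M; [exact: hp|apply: contC_J; exact: hp].
- exact: hs.
- apply: contC_D; apply: contC_M.
  + by apply: contC_M; [exact: hp|exact: os].
  + by apply: contC_J; exact: hp.
  + exact: hp.
  + by apply: contC_J; apply: contC_M; [exact: hp|exact: os].
Qed.

Let slope0 : slope 0 = 1. Proof. by []. Qed.

Let pt0 t : pt 0 t = z0.
Proof. by rewrite /pt !mul0r addr0. Qed.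

Let kappaE : kappa * (E.[z0] * (D.[z0])^*) = (beta ^+ 2)%:C.
Proof.
move: dir_real; rewrite /kappa -mulrA /beta.
case: (omega ^+ k * _) => x y /= ->; apply: complex_eqP => /=; ring.
Qed.

Let G00 : complex.Im (G 0 0) = 0.
Proof. by rewrite /G slope0 hornerXn expr1n mulr1 pt0 kappaE. Qed.

Let Gt00 : 0 < complex.Im (Gt 0 0).
Proof.
have -> : Gt 0 0 = (beta ^+ 2)%:C * (k%:R * 'i).
  rewrite /Gt slope0 pt0 -kappaE derivXn hornerMn hornerXn expr1n.
  rewrite !(mul0r, mulr0, rmorph0, addr0).
  by ring.
rewrite ImM ReC ImC mul0r addr0; apply: mulr_gt0.
  by rewrite exprn_even_gt0.
rewrite -(rmorph_nat (real_complex K)) ImM ReC ImC /= mulr1 mulr0 addr0.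
by rewrite ltr0n.
Qed.

Let twistedE (r t : K) :
  complex.Im (twisted (pt r t)) * beta = r ^+ k * complex.Im (G r t).
Proof.
pose Z := omega ^+ k * slope t ^+ k * (E.[pt r t] * (D.[pt r t])^*).
have -> : twisted (pt r t) = (r ^+ k)%:C * Z.
  by rewrite /twisted {1}/pt addrAC subrr add0r !exprMn rmorphXn /Z !mulrA.
have -> : G r t = beta%:C * Z by rewrite /G hornerXn /kappa /Z !mulrA.
by rewrite !ImMC; ring.
Qed.

(** The last two clauses go opposite ways: the arc stays in the cone of slopes at most [a], and near
    [z0] it contains every zero in that cone, by uniqueness of the implicit function. The first
    separates the branches, the second shows that no zero is missed. *)
Lemma arc_exists (e : K) : 0 < e -> exists (a rho : K) (g : K -> K[i]),
  [/\ 0 < a <= e, 0 < rho, smooth_arc z0 g,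
    forall w, arc_image g w -> exists r t : K,
      [/\ `|t| <= a, w = z0 + r%:C * omega * (1 +i* t) &
          complex.Im (twisted w) = 0] &
    forall (r t : K) w, `|r| <= rho -> `|t| <= a -> r != 0 ->
      w = z0 + r%:C * omega * (1 +i* t) -> complex.Im (twisted w) = 0 ->
      arc_image g w].
Proof.
move=> e0.
have [a [b [f [df [aP bP f0 fP uniqP]]]]] := implicit_function
  (fun r t => (G_r r t).2) (fun r t => (G_t r t).2)
  (fun p => continuous_Im (@Gr_cont p)) (fun p => continuous_Im (@Gt_cont p))
  G00 Gt00 e0.
(* Half of [b], so that [g] is differentiable for [|s| < 2], beyond the closed parameter
   interval. *)
case/andP: bP => b0 _; pose rho := b / 2; have rho0 : 0 < rho by rewrite divr_gt0.
have rhob (s : K) : `|s| < 2 -> `|rho * s| < b.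
  move=> s2; rewrite normrM (gtr0_norm rho0) /rho -mulrA gtr_pMr //.
  by rewrite mulrC ltr_pdivrMr // mul1r.
pose g (s : K) := pt (rho * s) (f (rho * s)).
pose dg (s : K) := rho%:C * omega * (1 +i* (f (rho * s) + rho * s * df (rho * s))).
have drho (s : K) : is_derive s 1 (fun s => rho * s) rho.
  by apply: is_derive_eq; rewrite [LHS]mulr1.
have g_cder (s : K) : `|s| < 2 -> cder g s (dg s).
  move=> /rhob /fP[_ _ fd _].
  have -> : dg s = 0 + (rho%:C * omega * slope (f (rho * s)) +
      (rho * s)%:C * omega * ('i * (df (rho * s) * rho)%:C)).
    rewrite /dg /slope; case: (omega) => x y.
    by apply: complex_eqP => /=; ring.
  apply: cderD (cder_cst _ _) _; apply: cderM.
    rewrite -[rho%:C * omega]addr0 -[X in _ + X](mulr0 (rho * s)%:C).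
    by apply: cderM (cder_cst _ _); apply: cder_real.
  split => /=.
    by rewrite mul0r mulr0 subr0; exact: is_derive_cst.
  rewrite mul0r mul1r add0r.
  exact: (@is_derive1_comp _ f (fun s => rho * s)).
have rs_cont (s : K) : {for s, continuous (fun s => rho * s)}.
  exact: is_derive_cont (drho s).
have dg_cont (s : K) : `|s| < 2 -> {for s, continuous dg}.
  move=> /rhob /fP[_ _ fd dfc]; apply: contC_M; first exact: contC_cst.
  apply: continuousC => /=; first exact: cvg_cst.
  have fc : {for s, continuous (fun s => f (rho * s))}.
    exact: (continuous_comp (rs_cont s) (is_derive_cont fd)).
  have dfc' : {for s, continuous (fun s => df (rho * s))}.
    exact: (continuous_comp (rs_cont s) dfc).
  by apply: cvgD => //; apply: cvgM => //; exact: rs_cont.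
have ReE (r t : K) : complex.Re ((pt r t - z0) / omega) = r.
  rewrite /pt addrAC subrr add0r mulrAC -[_ * omega / omega]mulrA divff // mulr1.
  by rewrite ReM /= mul0r subr0 mulr1.
exists a, rho, g; split => //.
- split.
  + by rewrite /g mulr0 pt0.
  + apply: continuous_in_subspaceT => s /set_mem /=; rewrite in_itv /= => /andP[s1 s2].
    apply: cder_cont (g_cder s _); rewrite ltr_norml; apply/andP; lra.
  + move=> s s' _ _ /(congr1 (fun z => complex.Re ((z - z0) / omega))).
    by rewrite !ReE; apply: mulfI; rewrite gt_eqF.
  + move=> s; rewrite in_itv /= -ltr_norml => s1.
    have s2 : `|s| < 2 by rewrite (lt_trans s1) // ltr1n.
    have dgE (x : K) : `|x| < 2 -> curve_derivable g x /\ curve_deriv g x = dg x.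
      by move=> /g_cder /cderP.
    have [gd gE] := dgE s s2; split => //.
      rewrite gE mulf_neq0 ?mulf_neq0 //; first by rewrite fmorph_eq0 gt_eqF.
      by rewrite eq_complex /= oner_eq0.
    rewrite /prop_for /continuous_at gE.
    apply: cvg_trans (dg_cont s s2); apply: near_eq_cvg; near=> x.
    apply/esym; apply: (dgE x _).2; near: x.
    exact: (@cvgr_norm_lt _ _ _ (nbhs s) _ id s (@cvg_id _ _) 2 s2).
- move=> w [s /=]; rewrite in_itv /= => /andP[s1 s2] <-.
  have /rhob sb : `|s| < 2 by rewrite ltr_norml; apply/andP; lra.
  have [fa fz _ _] := fP _ sb.
  exists (rho * s), (f (rho * s)); split => //.
  have /eqP := twistedE (rho * s) (f (rho * s)); rewrite fz mulr0.
  by rewrite mulf_eq0 (negPf beta_neq0) orbF => /eqP.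
- move=> r t w rr ta r0 -> Iw.
  have rb : `|r| < b.
    by rewrite (le_lt_trans rr) // /rho ltr_pdivrMr // ltr_pMr // ltr1n.
  have rE : rho * (r / rho) = r by rewrite mulrC divfK // gt_eqF.
  exists (r / rho).
    rewrite /= in_itv /= -ler_norml normrM normfV (gtr0_norm rho0).
    by rewrite ler_pdivrMr // mul1r.
  rewrite /g rE -(uniqP r t) //.
  have /eqP := twistedE r t; rewrite /pt Iw mul0r eq_sym mulf_eq0.
  by rewrite expf_eq0 (negPf r0) andbF /= => /eqP.
Unshelve. all: by end_near. Qed.

End Arc.

Lemma common_lower_bound (K : realType) (n : nat) (f : 'I_n -> K) :
  (forall i, 0 < f i) -> exists2 m, 0 < m & forall i, m <= f i.
Proof.
move=> f0; exists (\big[Num.min/1]_i f i); first exact/lt_bigmin.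
by move=> i; exact: bigmin_le.
Qed.

Section Branches.
Variable K : realType.
Variables (z0 : K[i]) (k : nat) (E D : {poly K[i]}).
Hypothesis k_gt0 : (0 < k)%N.
Let N (w : K[i]) : K[i] := E.[w] * (D.[w])^*.
Hypothesis N0 : N z0 != 0.

Lemma k2_gt0 : (0 < 2 * k)%N. Proof. by rewrite muln_gt0. Qed.

Lemma real_direction : exists2 omega : K[i], omega ^+ k * N z0 = 1 & omega != 0.
Proof.
have h : (k.-root (N z0)^-1) ^+ k * N z0 = 1 by rewrite rootCK // mulVf.
exists (k.-root (N z0)^-1) => //; apply/eqP => w0.
by move: h; rewrite w0 expr0n eqn0Ngt k_gt0 mul0r => /esym/eqP; rewrite oner_eq0.
Qed.

Variables (omega zeta : K[i]).
Hypothesis omegaN : omega ^+ k * N z0 = 1.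
Hypothesis omega_neq0 : omega != 0.
Hypothesis zetaP : (2 * k).-primitive_root zeta.

Lemma mod_zeta i : mod (zeta ^+ i) = 1.
Proof.
rewrite modX (_ : mod zeta = 1) ?expr1n //; apply/eqP.
by rewrite -(pexpr_eq1 k2_gt0 (mod_ge0 _)) -modX (prim_expr_order zetaP) mod1.
Qed.

Lemma zeta_neq0 i : zeta ^+ i != 0.
Proof. by rewrite -mod_eq0 mod_zeta oner_eq0. Qed.

(** Hence direction [j + k] is direction [j] reversed, and [k] lines through [z0] carry all [2 * k]
    half-branches. *)
Lemma zetak : zeta ^+ k = -1.
Proof.
have : (zeta ^+ k) ^+ 2 == 1 by rewrite -exprM mulnC (prim_expr_order zetaP).
rewrite sqrf_eq1 => /orP[|/eqP //].
rewrite -(prim_order_dvd zetaP) => /dvdn_leq -/(_ k_gt0).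
by rewrite leqNgt mul2n -addnn -[X in (X < _)%N]addn0 ltn_add2l k_gt0.
Qed.

Lemma Im_zeta_neq0 m : (0 < m < k)%N -> complex.Im (zeta ^+ m) != 0.
Proof.
case/andP => m0 mk; apply/eqP => I0.
have : (zeta ^+ m) ^+ 2 == 1.
  move: (sqr_mod (zeta ^+ m)) I0; rewrite mod_zeta expr1n expr2.
  case: (zeta ^+ m) => x y /= + y0; rewrite y0 expr0n addr0 expr2 => h.
  by apply/eqP/complex_eqP => /=; rewrite ?h; ring.
rewrite -exprM -(prim_order_dvd zetaP) [(m * 2)%N]mulnC dvdn_pmul2l // => /dvdn_leq -/(_ m0).
by rewrite leqNgt mk.
Qed.

(** Thin cones around different lines meet only at their apex. At a common point, eliminating [r]
    gives [x * (t' - t) + y * (1 + t * t') = 0] with [x + i y = zeta ^+ (j - i)]; the first term is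
    at most [d / 2] and the second at least [3 * d / 4], for [d] a lower bound of the
    [|Im (zeta ^+ m)|], [0 < m < k]. *)
Lemma separated_directions : exists2 a : K, 0 < a &
  forall i j r r' t t', (i < j < k)%N -> `|t| <= a -> `|t'| <= a -> r != 0 -> r' != 0 ->
  r%:C * (omega * zeta ^+ i) * (1 +i* t) != r'%:C * (omega * zeta ^+ j) * (1 +i* t').
Proof.
pose h (m : 'I_k) : K := if (0 < m)%N then `|complex.Im (zeta ^+ m)| else 1.
have h0 m : 0 < h m.
  by rewrite /h; case: ifP => // m0; rewrite normr_gt0 Im_zeta_neq0 ?m0 /=.
have [d d0 dP] := common_lower_bound h0.
exists (Num.min (1 / 2) (d / 4)).
  by rewrite lt_min !divr_gt0.
move=> i j r r' t t' /andP[ij jk]; rewrite !le_min => /andP[ta td] /andP[t'a t'd] r0 r'0.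
apply/eqP => e; pose xi := zeta ^+ (j - i).
have {}e : r%:C * (1 +i* t) = r'%:C * xi * (1 +i* t').
  apply: (mulfI omega_neq0); apply: (mulfI (zeta_neq0 i)).
  have -> : zeta ^+ i * (omega * (r'%:C * xi * (1 +i* t'))) =
      r'%:C * (omega * zeta ^+ j) * (1 +i* t').
    by rewrite /xi -(subnKC (ltnW ij)) exprD addKn; ring.
  by rewrite -e; ring.
have mk : (j - i < k)%N by rewrite (leq_ltn_trans (leq_subr _ _)).
have := dP (Ordinal mk); rewrite /h /= subn_gt0 ij -/xi => dI.
have Rx : `|complex.Re xi| <= 1 by rewrite -(mod_zeta (j - i)) Re_le_mod.
case: xi e dI Rx => x y /eqP; rewrite eq_complex /= => /andP[/eqP e1 /eqP e2] dI Rx.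
have r'm : r' * (x * (t' - t) + y * (1 + t * t')) = 0.
  have e1' : r = r' * x - r' * y * t' by lra.
  have e2' : r * t = r' * x * t' + r' * y by lra.
  by rewrite e1' in e2'; lra.
have /eqP {}r'm : x * (t' - t) + y * (1 + t * t') == 0.
  by move/eqP: r'm; rewrite mulf_eq0 (negPf r'0).
have tt : `|t * t'| <= 1 / 4.
  rewrite normrM (_ : 1 / 4 = 1 / 2 * (1 / 2)); last by field.
  by rewrite ler_pM.
have h1 : d * (3 / 4) <= `|y * (1 + t * t')|.
  move: tt; rewrite ler_norml => /andP[tt1 tt2].
  by rewrite normrM; apply: ler_pM => //; [lra|rewrite ger0_norm; lra].
have h2 : `|x * (t' - t)| <= `|t' - t| by rewrite normrM ler_piMl.
have h3 : `|t' - t| <= d / 2.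
  by rewrite (le_trans (ler_normB _ _)) //; lra.
have : y * (1 + t * t') = - (x * (t' - t)) by lra.
by move/(congr1 Num.norm); rewrite normrN => h4; move: h1; rewrite h4; lra.
Qed.

(** Put [u = w - z0] and let [x] be the real number [u ^+ k * N w]. Squaring removes its sign: with
    [s ^+ (2 * k) = x ^+ 2], the point [v = u / (s * omega)] satisfies
    [v ^+ (2 * k) = (N z0 / N w) ^+ 2], which is close to 1. As [v ^+ (2 * k) - 1] is the product of
    the [v - zeta ^+ i], one of these factors is at most [eta]. *)
Lemma approximate_directions (eta : K) : 0 < eta <= 1 / 2 ->
  \forall w \near z0, w != z0 -> complex.Im (twisted z0 k E D w) = 0 ->
  exists (j : 'I_k) (r t : K), `|t| <= 2 * eta /\
    w = z0 + r%:C * (omega * zeta ^+ j) * (1 +i* t).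
Proof.
case/andP => eta0 eta2.
have Nc : {for z0, continuous N}.
  apply: contC_M; first exact: horner_continuous_at.
  by apply: contC_J; exact: horner_continuous_at.
have fc : {for z0, continuous (fun w => (N z0 * (N w)^-1) ^+ 2)}.
  by apply: contC_X; apply: contC_M; [exact: contC_cst|exact: contC_V].
near=> w => wz Iw.
have Nw : N w != 0 by near: w; exact: near_neq0.
have small : mod ((N z0 * (N w)^-1) ^+ 2 - 1) < eta ^+ (2 * k).
  have -> : 1 = (N z0 * (N z0)^-1) ^+ 2 :> K[i] by rewrite divff ?expr1n.
  by near: w; apply: (cvg_near_mod fc); rewrite exprn_gt0.
pose u := w - z0; have u0 : u != 0 by rewrite subr_eq0.
pose x := complex.Re (u ^+ k * N w).
have xE : u ^+ k * N w = x%:C by apply: complex_eqP.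
have x0 : x != 0.
  by rewrite -(fmorph_eq0 (real_complex K)) /= -xE mulf_neq0 ?expf_neq0.
pose s := (x ^+ 2) `^ ((2 * k)%:R^-1).
have x20 : 0 < x ^+ 2 by rewrite exprn_even_gt0.
have s0 : 0 < s by rewrite powR_gt0.
have sE : s ^+ (2 * k) = x ^+ 2.
  rewrite -powR_mulrn ?ltW // -powRrM mulVf ?powRr1 ?ltW //.
  by rewrite pnatr_eq0 -lt0n k2_gt0.
have sC0 : s%:C != 0 by rewrite fmorph_eq0 gt_eqF.
pose v := u / (s%:C * omega).
have vE : v ^+ (2 * k) = (N z0 * (N w)^-1) ^+ 2.
  rewrite /v expr_div_n exprMn -rmorphXn /= sE rmorphXn /= -xE.
  have -> : omega ^+ (2 * k) = (N z0)^-1 ^+ 2.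
    by rewrite mulnC exprM; congr (_ ^+ 2); rewrite -[LHS](mulfK N0) omegaN mul1r.
  rewrite mulnC exprM; field.
  by rewrite Nw N0 expf_neq0.
have prodE : \prod_(0 <= i < 2 * k) (v - zeta ^+ i) = v ^+ (2 * k) - 1.
  have /(congr1 (fun p => p.[v])) := factor_Xn_sub_1 zetaP.
  rewrite hornerD hornerN hornerXn hornerC horner_prod => <-.
  by apply: eq_bigr => i _; rewrite hornerXsubC.
have [i i2k iP] : exists2 i, (i < 2 * k)%N & mod (v - zeta ^+ i) <= eta.
  apply: contrapT => h.
  have {}h i : (i < 2 * k)%N -> eta <= mod (v - zeta ^+ i).
    by move=> ik; rewrite leNgt; apply/negP => /ltW hi; apply: h; exists i.
  have : eta ^+ (2 * k) <= mod (\prod_(0 <= i < 2 * k) (v - zeta ^+ i)).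
    elim: (2 * k)%N h => [_|n IH h]; first by rewrite big_nil expr0 mod1.
    rewrite big_nat_recr //= modM exprSr; apply: ler_pM.
    - by rewrite exprn_ge0 // ltW.
    - exact: ltW.
    - by apply: IH => i ni; apply: h; exact: ltn_trans ni _.
    - exact: h.
  by rewrite leNgt prodE vE small.
pose y := v / zeta ^+ i.
have y1 : mod (y - 1) <= eta.
  have -> : y - 1 = (v - zeta ^+ i) / zeta ^+ i by rewrite mulrBl divff ?zeta_neq0.
  by rewrite modM modV mod_zeta invr1 mulr1.
have Rey : 1 / 2 <= complex.Re y.
  have := le_trans (Re_le_mod _) y1; rewrite ReD ReN /= ler_norml; lra.
have Imy : `|complex.Im y| <= eta.
  by have := le_trans (Im_le_mod _) y1; rewrite ImD ImN /= oppr0 addr0.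
pose t := complex.Im y / complex.Re y.
have Rey0 : complex.Re y != 0 by rewrite gt_eqF //; lra.
have yE : y = (complex.Re y)%:C * (1 +i* t).
  rewrite /t; move: Rey0; case: (y) => p q /= p0.
  by apply: complex_eqP => /=; field.
have tE : `|t| <= 2 * eta.
  rewrite /t normrM normfV ler_pdivrMr ?normr_gt0; last by rewrite gt_eqF //; lra.
  rewrite (le_trans Imy) // ger0_norm; last by lra.
  by have := Rey; rewrite -(ler_pM2l eta0); lra.
have wE : w = z0 + (s * complex.Re y)%:C * (omega * zeta ^+ i) * (1 +i* t).
  have -> : (s * complex.Re y)%:C * (omega * zeta ^+ i) * (1 +i* t) =
      s%:C * omega * zeta ^+ i * ((complex.Re y)%:C * (1 +i* t)).
    by rewrite rmorphM /=; ring.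
  have -> : s%:C * omega * zeta ^+ i * ((complex.Re y)%:C * (1 +i* t)) = u.
    by rewrite -yE /y /v; field; rewrite sC0 omega_neq0 zeta_neq0.
  by rewrite /u addrC subrK.
have [ik|ki] := ltnP i k.
  by exists (Ordinal ik), (s * complex.Re y), t.
have ik : (i - k < k)%N by rewrite ltn_subLR // addnn -mul2n.
exists (Ordinal ik), (- (s * complex.Re y)), t; split => //.
have zi : zeta ^+ i = - zeta ^+ (i - k).
  by rewrite -[X in zeta ^+ X = _](subnKC ki) exprD zetak mulN1r.
have sN : (- (s * complex.Re y))%:C = - (s * complex.Re y)%:C by rewrite rmorphN.
by rewrite wE zi [nat_of_ord _]/= sN; ring.
Unshelve. all: by end_near. Qed.

End Branches.

Lemma branches_exist (K : realType) (X : set K[i]) (z0 : K[i]) (k : nat)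
    (E D : {poly K[i]}) : (0 < k)%N -> E.[z0] * (D.[z0])^* != 0 ->
  (\forall w \near z0, X w <-> complex.Im (twisted z0 k E D w) = 0) ->
  exists g : 'I_k -> K -> K[i], local_branches X z0 g.
Proof.
move=> k0 N0 XE.
have [omega omegaN om0] := real_direction k0 N0.
have [zeta zetaP] := @primitive_root_exists K[i] (2 * k) (k2_gt0 k0).
have [e e0 eP] := separated_directions k0 om0 zetaP.
have om_j (j : 'I_k) : omega * zeta ^+ j != 0.
  by rewrite mulf_neq0 // (zeta_neq0 k0 zetaP).
have dir_j (j : 'I_k) :
    complex.Im ((omega * zeta ^+ j) ^+ k * (E.[z0] * (D.[z0])^*)) = 0.
  rewrite exprMn mulrAC omegaN mul1r -exprM mulnC exprM (zetak k0 zetaP).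
  by rewrite -signr_odd; case: odd => /=; rewrite ?oppr0.
have /choice[a /choice[rho /choice[g gP]]] :=
  fun j => arc_exists k0 (om_j j) N0 (dir_j j) e0.
have a0 j : 0 < a j by case: (gP j) => /andP[].
have [a' a'0 a'P] := common_lower_bound a0.
have rho0 j : 0 < rho j by case: (gP j).
have [rho' rho'0 rho'P] := common_lower_bound rho0.
exists g; split.
- by move=> j; case: (gP j).
- move=> i j ij; near=> w => wi wj; apply/eqP/negPn/negP => wz.
  have repr l : arc_image (g l) w -> exists r t : K, [/\ `|t| <= e, r != 0 &
      w = z0 + r%:C * (omega * zeta ^+ l) * (1 +i* t)].
    case: (gP l) => /andP[_ ae] _ _ h _ /h[r [t [ta wE _]]].
    exists r, t; split => //; first exact: le_trans ta ae.
    by apply: contraNneq wz => r0; rewrite wE r0 !mul0r addr0.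
  have [r [t [te r0 wE]]] := repr _ wi; have [r' [t' [t'e r'0 w'E]]] := repr _ wj.
  have eq : r%:C * (omega * zeta ^+ i) * (1 +i* t) = r'%:C * (omega * zeta ^+ j) * (1 +i* t').
    by apply: (addrI z0); rewrite -wE -w'E.
  have [lt_ij|lt_ji|/val_inj eq_ij] := ltngtP i j.
  + by have := eP i j r r' t t'; rewrite lt_ij ltn_ord eq eqxx => /(_ isT te t'e r0 r'0).
  + by have := eP j i r' r t' t; rewrite lt_ji ltn_ord eq eqxx => /(_ isT t'e te r'0 r0).
  + by rewrite eq_ij eqxx in ij.
pose eta := Num.min (1 / 2) (a' / 2).
have etaP : 0 < eta <= 1 / 2 by rewrite lt_min ge_min lexx !divr_gt0.
have eta2 : 2 * eta <= a' by rewrite mulrC -ler_pdivlMr // ge_min lexx orbT.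
near=> w; have [->|wz] := eqVneq w z0.
  split=> _; last first.
    have := nbhs_singleton XE; case=> _; apply.
    by rewrite /twisted subrr expr0n eqn0Ngt k0 mul0r.
  exists (Ordinal k0); exists 0; last by case: (gP (Ordinal k0)) => _ _ [].
  by rewrite /= in_itv /= lerN10 ler01.
have XwE : X w <-> complex.Im (twisted z0 k E D w) = 0 by near: w.
rewrite XwE; split=> [Iw|[j]]; last first.
  by case: (gP j) => _ _ _ h _ /h[r [t [_ _]]].
have [j [r [t [te wE]]]] : exists (j : 'I_k) (r t : K), `|t| <= 2 * eta /\
    w = z0 + r%:C * (omega * zeta ^+ j) * (1 +i* t).
  by move: wz Iw; near: w; exact: approximate_directions.
exists j; case: (gP j) => _ _ _ _ hj; apply: (hj r t).
(* [|1 + i t| >= 1], so a point close to [z0] has a small [r]. *)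
- apply: le_trans (rho'P j); have wr : mod (w - z0) < rho' * mod omega.
    by near: w; apply: near_mod; rewrite mulr_gt0 // mod_gt0.
  rewrite -(ler_pM2r (x := mod omega)) ?mod_gt0 //; apply: le_trans (ltW wr).
  rewrite wE addrAC subrr add0r !modM modC (mod_zeta k0 zetaP) mulr1.
  by rewrite ler_peMr ?mulr_ge0 ?mod_ge0 // (le_trans _ (Re_le_mod _)) //= normr1.
- by apply: le_trans te _; apply: le_trans eta2 _; exact: a'P.
- by apply: contraNneq wz => r0; rewrite wE r0 !mul0r addr0.
- exact: wE.
- exact: Iw.
Unshelve. all: by end_near. Qed.

(** * The curve of inflections *)

Lemma conjM (K : realType) (x y : K[i]) : (x * y)^* = x^* * y^*.
Proof. exact: rmorphM. Qed.

Lemma conjX (K : realType) (x : K[i]) n : (x ^+ n)^* = x^* ^+ n.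
Proof. exact: rmorphXn. Qed.

Lemma conjD (K : realType) (a b : K[i]) : (a + b)^* = a^* + b^*.
Proof. exact: rmorphD. Qed.

Lemma is_derive_horner (K : realType) (f : {poly K[i]}) (z : K[i]) :
  is_derive z 1 (horner f) f^`().[z].
Proof.
elim/poly_ind: f => [|f c IH].
  have -> : horner (0 : {poly K[i]}) = cst 0 by apply/funext => w; rewrite horner0.
  by rewrite deriv0 horner0; exact: is_derive_cst.
have -> : horner (f * 'X + c%:P) = horner f * id + cst c.
  by apply/funext => w; rewrite hornerMXaddC.
have dX : is_derive z 1 (horner f * id) (f.[z] *: 1 + z *: f^`().[z]).
  exact: is_deriveM.
have dc : is_derive z 1 (cst c : K[i] -> K[i]) 0 by exact: is_derive_cst.
apply: (is_derive_eq (is_deriveD dX dc)).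
rewrite derivD derivM derivX derivC !hornerE /GRing.scale /=; ring.
Qed.

(** For [u = w - z], [a = A1.[w]] and [b = p1.[w]] this rewrites the equation of the curve near a
    pole of order [m]: up to a factor that is positive for [u] nonzero and a conjugation, it becomes
    the imaginary part of [u ^+ m.+1] times a function that does not vanish at the pole. *)
Lemma pole_factor (K : realType) (a b u : K[i]) (m : nat) : (0 < m)%N ->
  a * u ^+ m.-1 * (b * u ^+ m)^* ^+ 2 =
  ((mod u ^+ 2) ^+ m.-1)%:C * (u ^+ m.+1 * (b ^+ 2 * a^*))^*.
Proof.
have -> : ((mod u ^+ 2) ^+ m.-1)%:C = (u * u^*) ^+ m.-1 by rewrite mulJ rmorphXn.
rewrite !conjM !conjX conjcK; move: (u^*) (b^*) => v c; case: m => // n _ /=.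
by rewrite !exprMn !exprS !expr0; move: (u ^+ n) (v ^+ n) => x y; ring.
Qed.

Section InflectionCurve.
Variable K : realType.
Variables P Q : {poly K[i]}.
Hypotheses (P_neq0 : P != 0) (Q_neq0 : Q != 0).

Local Notation q := (rnum P Q).
Local Notation p := (rden P Q).

Definition num1 : {poly K[i]} := q^`() * p - q * p^`().
Definition num2 : {poly K[i]} := num1^`() * p - (num1 * p^`()) *+ 2.

Local Notation A := num1.
Local Notation B := num2.

Lemma rnumE : q * gcdp P Q = Q.
Proof. by rewrite divpK // dvdp_gcdr. Qed.

Lemma rdenE : p * gcdp P Q = P.
Proof. by rewrite divpK // dvdp_gcdl. Qed.

Lemma rnum_neq0 : q != 0.
Proof. by move: Q_neq0; rewrite -{1}rnumE mulf_eq0 negb_or => /andP[]. Qed.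

Lemma rden_neq0 : p != 0.
Proof. by move: P_neq0; rewrite -{1}rdenE mulf_eq0 negb_or => /andP[]. Qed.

Lemma rden_rnum_coprime : coprimep p q.
Proof. by rewrite coprimep_div_gcd // P_neq0. Qed.

Lemma size_rnum : (size q <= size Q)%N.
Proof. exact: leq_divp. Qed.

Lemma size_rden : (size p <= size P)%N.
Proof. exact: leq_divp. Qed.

Lemma rnum_root z : p.[z] = 0 -> q.[z] != 0.
Proof.
move=> pz; have /(coprimep_root rden_rnum_coprime) // : root p z by apply/eqP.
Qed.

Lemma dRfE z : p.[z] != 0 -> dRf P Q z = A.[z] / p.[z] ^+ 2.
Proof.
move=> pz; rewrite /dRf derive1E.
have dq : is_derive z 1 (horner q) q^`().[z] := is_derive_horner q z.
have dp : is_derive z 1 (horner p) p^`().[z] := is_derive_horner p z.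
have dV : is_derive z 1 (fun w => (p.[w])^-1) (- p.[z] ^- 2 *: p^`().[z]).
  case: dp => dp pE; apply: DeriveDef; first exact: derivableV.
  by rewrite deriveV // pE.
have dR : is_derive z 1 (Rf P Q)
   (q.[z] *: ((- p.[z] ^- 2) *: p^`().[z]) + (p.[z])^-1 *: q^`().[z]).
  exact: (is_deriveM dq dV).
rewrite (derive_val (is_derive := dR)) /A !hornerE.
rewrite /GRing.scale /=; field; exact: pz.
Qed.

Lemma Im_div_eq0 (a b : K[i]) : b != 0 ->
  (complex.Im (a / b) == 0) = (complex.Im (a * b^*) == 0).
Proof.
move=> b0; have -> : a * b^* = (mod b ^+ 2)%:C * (a / b).
  by rewrite -mulJ; field.
by rewrite ImMC mulf_eq0 sqrf_eq0 mod_eq0 (negPf b0).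
Qed.

(** The equation is a closed condition and [p] stays nonzero nearby, so the closure in [inflection]
    adds nothing away from the poles. *)
Lemma inflectionP z : p.[z] != 0 ->
  inflection P Q z <-> complex.Im (A.[z] * (p.[z]^* ^+ 2)) = 0.
Proof.
move=> pz; have Ac : {for z, continuous (fun w => complex.Im (A.[w] * (p.[w]^* ^+ 2)))}.
  apply: continuous_Im; apply: contC_M; first exact: horner_continuous_at.
  by apply: contC_X; apply: contC_J; exact: horner_continuous_at.
have E w : p.[w] != 0 ->
    complex.Im (dRf P Q w) = 0 <-> complex.Im (A.[w] * (p.[w]^* ^+ 2)) = 0.
  move=> pw; rewrite dRfE //; have := Im_div_eq0 A.[w] (expf_neq0 2 pw).
  by rewrite rmorphXn => h; split => /eqP; [rewrite h|rewrite -h] => /eqP.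
split=> [/closure_modP cz|Iz]; last first.
  by apply: subset_closure; split => //; exact/E.
apply/eqP; apply: contrapT => /negP; rewrite -normr_gt0 => I0.
have : \forall w \near z, complex.Im (A.[w] * (p.[w]^* ^+ 2)) != 0 /\ p.[w] != 0.
  near=> w; split; last by near: w; apply: near_neq0 => //; exact: horner_continuous_at.
  have : `|complex.Im (A.[w] * (p.[w]^* ^+ 2)) - complex.Im (A.[z] * (p.[z]^* ^+ 2))| <
     `|complex.Im (A.[z] * (p.[z]^* ^+ 2))|.
    by near: w; exact: (cont_dist Ac I0).
  by apply: contraTneq => ->; rewrite sub0r normrN ltxx.
move=> /nbhsCP[e e0 eP]; have [w [rw /E h] wz] := cz _ e0.
by have [/eqP []] := eP w wz; exact: h.
Unshelve. all: by end_near. Qed.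

Lemma near_rden z : p.[z] != 0 -> \forall w \near z, p.[w] != 0.
Proof. by move=> pz; apply: near_neq0 => //; exact: horner_continuous_at. Qed.

Lemma near_punctured_root (f : {poly K[i]}) z : f != 0 ->
  \forall w \near z, w != z -> f.[w] != 0.
Proof.
move=> f0; have [m [g gz fE]] := multiplicity_XsubC f z.
rewrite f0 /= in gz.
have : \forall w \near z, g.[w] != 0.
  by apply: near_neq0 => //; exact: horner_continuous_at.
apply: filterS => w gw wz; rewrite fE hornerM horner_exp hornerXsubC.
by rewrite mulf_neq0 // expf_neq0 // subr_eq0.
Qed.

(** A pole of order [m] of R is one of order [m + 1] of R', so [A] vanishes there exactly to order
    [m - 1]: at [z] the cofactor is [- m * q * p1], nonzero since [p] and [q] are coprime. *)
Lemma pole_multiplicity z : p.[z] = 0 -> exists (m : nat) (p1 A1 : {poly K[i]}),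
  [/\ (0 < m)%N, p = p1 * ('X - z%:P) ^+ m, A = A1 * ('X - z%:P) ^+ m.-1,
      p1.[z] != 0 & A1.[z] != 0].
Proof.
move=> pz.
have [m [p1]] := multiplicity_XsubC p z; rewrite rden_neq0 /= => p1z pE.
have m0 : (0 < m)%N.
  rewrite lt0n; apply: contraNneq p1z => m0.
  by move: pz; rewrite pE m0 expr0 mulr1 => h; apply/eqP.
pose A1 := q^`() * ('X - z%:P) * p1 - q * (p1 * (m%:R)%:P + ('X - z%:P) * p1^`()).
have AE : A = A1 * ('X - z%:P) ^+ m.-1.
  have -> : A1 * ('X - z%:P) ^+ m.-1 = q^`() * (p1 * (('X - z%:P) * ('X - z%:P) ^+ m.-1)) -
     q * (p1^`() * (('X - z%:P) * ('X - z%:P) ^+ m.-1) +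
          p1 * (('X - z%:P) ^+ m.-1 * (m%:R)%:P)) by rewrite /A1; ring.
  rewrite -exprS prednK // polyC_natr mulr_natr.
  by rewrite /A pE derivM deriv_exp derivXsubC mul1r.
have A1z : A1.[z] != 0.
  have -> : A1.[z] = - (q.[z] * (p1.[z] * m%:R)).
    rewrite /A1 hornerD hornerN !(hornerXsubC, hornerC, hornerM, hornerD) subrr; ring.
  by rewrite oppr_eq0 !mulf_neq0 ?rnum_root // pnatr_eq0 -lt0n.
by exists m, p1, A1; split.
Qed.

Hypothesis B_neq0 : B != 0.

Lemma horner_sub_sqr (F : fieldType) (a b : {poly F}) (c x : F) :
  (a - c *: b ^+ 2).[x] = a.[x] - c * b.[x] ^+ 2.
Proof. by rewrite hornerD hornerN hornerZ horner_exp. Qed.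

Lemma deriv_sub_sqr (F : fieldType) (a b : {poly F}) (c x : F) :
  (a - c *: b ^+ 2)^`().[x] = a^`().[x] - c * (b^`().[x] * b.[x] *+ 2).
Proof.
rewrite derivD derivN derivZ expr2 derivM hornerD hornerN hornerZ.
rewrite hornerD !hornerM; ring.
Qed.

Lemma num2E z : B.[z] = A^`().[z] * p.[z] - (A.[z] * p^`().[z]) *+ 2.
Proof. by rewrite hornerD hornerN hornerMn !hornerM. Qed.

Lemma num1_shift_neq0 (c : K[i]) : A - c *: p ^+ 2 != 0.
Proof.
apply: contraNneq B_neq0 => /eqP; rewrite subr_eq0 => /eqP AE.
by apply/eqP; rewrite /B AE derivZ expr2 derivM -!mul_polyC; ring.
Qed.

(** The value [c = R'(z)] is real, so subtracting [c * |p|^4] does not change imaginary parts; [k]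
    is the order of R' - c at [z], which is 1 exactly when R''(z) is nonzero. *)
Lemma inflection_branches z : p.[z] != 0 -> inflection P Q z ->
  exists k, [/\ (0 < k)%N, (k == 1)%N = (B.[z] != 0) &
    exists g : 'I_k -> K -> K[i], local_branches (inflection P Q) z g].
Proof.
move=> pz Xz; have /inflectionP Iz := Xz.
pose c := A.[z] / p.[z] ^+ 2; pose F := A - c *: p ^+ 2.
have cR : complex.Im c = 0.
  by apply/eqP; rewrite Im_div_eq0 ?expf_neq0 // rmorphXn Iz.
have F0 : F != 0 by exact: num1_shift_neq0.
have [k [E]] := multiplicity_XsubC F z; rewrite F0 /= => Ez FE.
have Fz : F.[z] = 0.
  by rewrite horner_sub_sqr /c; field.
have Fz' : F^`().[z] = B.[z] / p.[z].
  by rewrite deriv_sub_sqr num2E /c; field.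
have k0 : (0 < k)%N.
  rewrite lt0n; apply: contraNneq Ez => k0.
  by move: Fz; rewrite FE k0 expr0 mulr1 => Ez; apply/eqP.
exists k; split => //.
  have <- : (F^`().[z] != 0) = (B.[z] != 0).
    by rewrite Fz' mulf_eq0 invr_eq0 (negPf pz) orbF.
  rewrite FE derivM deriv_exp derivXsubC mul1r hornerD !hornerM hornerMn !horner_exp.
  rewrite !hornerXsubC subrr !expr0n eqn0Ngt k0 mulr0 add0r.
  case: (k) k0 => [//|[|n]] _; first by rewrite mulr1 Ez.
  by rewrite mul0rn mulr0 eqxx.
have pz2 : (p ^+ 2).[z] != 0 by rewrite expr2 hornerM mulf_neq0.
apply: (branches_exist (E := E) (D := p ^+ 2)) => //.
  by rewrite mulf_neq0 // fmorph_eq0 pz2.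
near=> w; have pw : p.[w] != 0 by near: w; exact: near_rden.
rewrite inflectionP //.
have -> : twisted z k E (p ^+ 2) w = F.[w] * (p.[w]^* ^+ 2).
  by rewrite /twisted horner_exp FE hornerM horner_exp hornerXsubC rmorphXn /=; ring.
have -> : F.[w] * (p.[w]^* ^+ 2) =
    A.[w] * (p.[w]^* ^+ 2) - c * ((mod p.[w] ^+ 2) ^+ 2)%:C.
  by rewrite horner_sub_sqr rmorphXn /= -mulJ; ring.
by rewrite ImD ImN [complex.Im (c * _)]ImM ImC cR mulr0 mul0r addr0 oppr0 addr0.
Unshelve. all: by end_near. Qed.

(** A pole of order [m] gives [m + 1] branches, at least two. *)
Lemma pole_singular z : p.[z] = 0 -> inflection P Q z -> singular_locus P Q z.
Proof.
move=> pz Xz; split => //.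
have [m [p1 [A1 [m0 pE AE p1z A1z]]]] := pole_multiplicity pz.
exists m.+1; suff [g gP] : exists g : 'I_m.+1 -> K -> K[i],
    local_branches (inflection P Q) z g by exists g; split => //; rewrite ltnS.
have p1z2 : (p1 ^+ 2).[z] != 0 by rewrite expr2 hornerM mulf_neq0.
apply: (branches_exist (E := p1 ^+ 2) (D := A1)) => //.
  by rewrite mulf_neq0 ?fmorph_eq0.
near=> w; have [->|wz] := eqVneq w z.
  by split => // _; rewrite /twisted subrr expr0n mul0r.
have pw : p.[w] != 0.
  by move: wz; near: w; apply: near_punctured_root; exact: rden_neq0.
rewrite inflectionP // AE pE !hornerM !horner_exp !hornerXsubC /twisted.
set u := w - z; have u0 : u != 0 by rewrite subr_eq0.
have -> : A1.[w] * u ^+ m.-1 * (p1.[w] * u ^+ m)^* ^+ 2 =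
  ((mod u ^+ 2) ^+ m.-1)%:C * (u ^+ m.+1 * ((p1 ^+ 2).[w] * A1.[w]^*))^*.
  by rewrite horner_exp; exact: pole_factor.
rewrite ImMC ImJ mulrN; split => [/eqP|->]; last by rewrite mulr0 oppr0.
rewrite oppr_eq0 mulf_eq0 expf_eq0 sqrf_eq0 mod_eq0 (negPf u0) andbF /=.
by move/eqP.
Unshelve. all: by end_near. Qed.

End InflectionCurve.

Lemma near_norm_lt (K : realType) (x d : K) : `|x| < d ->
  \forall t \near x, `|t| < d.
Proof. exact: (@cvgr_norm_lt _ _ _ (nbhs x) _ id x (@cvg_id _ _) d). Qed.

(** * Arcs inside a set with a locally injective projection *)

Section ArcCrossing.
Variable K : realType.
Variables (z : K[i]) (X : set K[i]) (proj : K[i] -> K) (eps : K).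
Hypothesis eps0 : 0 < eps.
Hypothesis proj_cont : continuous proj.
Hypothesis proj_inj : forall w1 w2, mod (w1 - z) < eps -> mod (w2 - z) < eps ->
  X w1 -> X w2 -> proj w1 = proj w2 -> w1 = w2.

Lemma smooth_arc_cder (g : K -> K[i]) (t : K) : smooth_arc z g -> `|t| < 1 ->
  cder g t (curve_deriv g t).
Proof.
move=> [_ _ _ h] t1; apply/cderP.
by have [|gd _ _] := h t; rewrite ?in_itv /= -?ltr_norml.
Qed.

Lemma arc_near (g : K -> K[i]) (U : set K[i]) : smooth_arc z g -> nbhs z U ->
  exists2 d : K, 0 < d < 1 & forall t : K, `|t| <= d -> U (g t).
Proof.
move=> gP zU; have g0 : g 0 = z by case: gP.
have gc : {for 0, continuous g}.
  by apply: cder_cont (smooth_arc_cder gP _); rewrite normr0.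
have : \forall t \near (0 : K), U (g t) by apply: gc; rewrite g0.
move=> /nbhs_ballP[d /= d0 dP]; exists (Num.min (d / 2) (1 / 2)).
  by rewrite lt_min gt_min !divr_gt0 //=; apply/orP; right; lra.
move=> t; rewrite le_min => /andP[td _]; apply: dP; rewrite /ball /= sub0r normrN.
by rewrite (le_lt_trans td) // ltr_pdivrMr // ltr_pMr // ltr1n.
Qed.

(** Along the arc [proj] is continuous and injective near the parameter 0, so [proj z] cannot be a
    local maximum: were both ends lower, some level would be taken on both sides of 0. The arc
    therefore reaches every level slightly above [proj z]. *)
Lemma arc_crossing (g : K -> K[i]) (e : K) : smooth_arc z g ->
  (\forall w \near z, arc_image g w -> X w) -> 0 < e ->
  exists2 eta, 0 < eta & forall y, proj z < y < proj z + eta ->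
    exists w, [/\ arc_image g w, mod (w - z) < e, X w & proj w = y].
Proof.
move=> gP gX e0; have [g0 _ ginj _] := gP.
have : \forall w \near z, [/\ mod (w - z) < e, mod (w - z) < eps & arc_image g w -> X w].
  near=> w; split; [near: w; exact: near_mod|near: w; exact: near_mod|near: w; exact: gX].
move=> /(arc_near gP)[d /andP[d0 d1] dP].
have dom (t : K) : `|t| <= d -> t \in `[-1, 1].
  by move=> td; rewrite in_itv /= -ler_norml (le_trans td) // ltW.
have img (t : K) : `|t| <= d -> arc_image g (g t) by move=> /dom td; exists t.
have Xg (t : K) : `|t| <= d -> X (g t).
  by move=> td; have [_ _] := dP t td; apply; exact: img.
pose h t := proj (g t).
have hinj (s t : K) : `|s| <= d -> `|t| <= d -> h s = h t -> s = t.
  move=> sd td st; apply: ginj; [exact: dom|exact: dom|].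
  by apply: proj_inj st; [case: (dP s sd)|case: (dP t td)|exact: Xg|exact: Xg].
have hc : forall t : K, `|t| <= d -> {for t, continuous h}.
  move=> t td; apply: continuous_comp; last exact: proj_cont.
  by apply: cder_cont (smooth_arc_cder gP _); exact: le_lt_trans d1.
have ivt (a b y : K) : a <= b -> `|a| <= d -> `|b| <= d ->
    Num.min (h a) (h b) <= y <= Num.max (h a) (h b) -> exists2 t, a <= t <= b & h t = y.
  move=> ab ad bd yP; have ct : {within `[a, b], continuous h}.
    apply: continuous_in_subspaceT => s /set_mem /=; rewrite in_itv /= => /andP[sa sb].
    by apply: hc; move: ad bd; rewrite !ler_norml; lra.
  by have [t tab ht] := IVT ab ct yP; exists t => //; move: tab; rewrite in_itv.
have n0 : `|0 : K| <= d by rewrite normr0 ltW.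
have nd : `|d| <= d by rewrite ger0_norm // ltW.
have nNd : `|- d| <= d by rewrite normrN.
have h0 : h 0 = proj z by rewrite /h g0.
have hd : h d != h 0 by apply/eqP => /(hinj _ _ nd n0) d0'; rewrite d0' ltxx in d0.
have hNd : h (- d) != h 0.
  by apply/eqP => /(hinj _ _ nNd n0) /eqP; rewrite oppr_eq0 gt_eqF.
have up : exists2 b : K, `|b| <= d & h 0 < h b.
  apply: contrapT => none.
  have lt_d : h d < h 0.
    by rewrite lt_neqAle hd leNgt; apply/negP => lt0; apply: none; exists d.
  have lt_Nd : h (- d) < h 0.
    by rewrite lt_neqAle hNd leNgt; apply/negP => lt0; apply: none; exists (- d).
  pose m := Num.max (h d) (h (- d)).
  have mlt : m < h 0 by rewrite gt_max lt_d.
  have hdm : h d <= m by rewrite le_max lexx.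
  have hNdm : h (- d) <= m by rewrite le_max lexx orbT.
  have [|s /andP[s0 sd] hs] := ivt 0 d m (ltW d0) n0 nd.
    by apply/andP; split; [rewrite ge_min hdm orbT|rewrite [m <= _]le_max (ltW mlt)].
  have Nd0 : - d <= 0 by rewrite oppr_le0 ltW.
  have [|t /andP[td t0] ht] := ivt (- d) 0 m Nd0 nNd n0.
    by apply/andP; split; [rewrite ge_min hNdm|rewrite [m <= _]le_max (ltW mlt) orbT].
  have st : s = t.
    by apply: hinj; rewrite ?hs ?ht // ler_norml; apply/andP; split; lra.
  have s00 : s = 0 by apply/le_anti; rewrite s0 andbT st.
  by rewrite -hs s00 ltxx in mlt.
case: up => b bd hb; exists (h b - h 0); first by rewrite subr_gt0.
move=> y; rewrite -h0 addrC subrK => /andP[y0 yb].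
have [t [td ht]] : exists t : K, `|t| <= d /\ h t = y.
  have [b0|b0] := leP 0 b.
    have [|t /andP[t0 tb] <-] := ivt 0 b y b0 n0 bd.
      by rewrite ge_min le_max (ltW y0) (ltW yb) orbT.
    by exists t; split=> //; move: bd; rewrite !ler_norml; lra.
  have [|t /andP[t0 tb] <-] := ivt b 0 y (ltW b0) bd n0.
    by rewrite ge_min le_max (ltW y0) (ltW yb) orbT.
  by exists t; split=> //; move: bd; rewrite !ler_norml; lra.
exists (g t); split; [exact: img| |exact: Xg|exact: ht].
by have [] := dP t td.
Unshelve. all: by end_near. Qed.

(** Both arcs have a point at the level [proj z + n / 2], and injectivity of [proj] on [X] makes
    these two points one. This is what excludes a second branch at a smooth point. *)
Lemma crossing_arcs_meet (g1 g2 : K -> K[i]) : smooth_arc z g1 -> smooth_arc z g2 ->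
  (\forall w \near z, arc_image g1 w -> X w) ->
  (\forall w \near z, arc_image g2 w -> X w) ->
  ~ (\forall w \near z, arc_image g1 w -> arc_image g2 w -> w = z).
Proof.
move=> g1P g2P X1 X2 /nbhsCP[e e0 eP].
have m0 : 0 < Num.min e eps by rewrite lt_min e0.
have [n1 n10 n1P] := arc_crossing g1P X1 m0.
have [n2 n20 n2P] := arc_crossing g2P X2 m0.
pose n := Num.min n1 n2; have n0 : 0 < n by rewrite lt_min n10.
have nn1 : n <= n1 by rewrite ge_min lexx.
have nn2 : n <= n2 by rewrite ge_min lexx orbT.
have [|w1 [i1 d1 Xw1 p1]] := n1P (proj z + n / 2); first by apply/andP; lra.
have [|w2 [i2 d2 Xw2 p2]] := n2P (proj z + n / 2); first by apply/andP; lra.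
move: d1 d2; rewrite !lt_min => /andP[d1 d1'] /andP[d2 d2'].
have w12 : w1 = w2 by apply: proj_inj => //; rewrite p1 p2.
have wz : w1 = z by apply: eP => //; rewrite w12.
by move: p1; rewrite wz; lra.
Qed.

End ArcCrossing.

(** * Smooth points of the curve and tangency with the field *)

Section RegularPoints.
Variable K : realType.
Variables P Q : {poly K[i]}.
Hypotheses (P_neq0 : P != 0) (Q_neq0 : Q != 0).

Local Notation q := (rnum P Q).
Local Notation p := (rden P Q).
Local Notation A := (num1 P Q).
Local Notation B := (num2 P Q).

Definition infl_fun (w : K[i]) : K := complex.Im (A.[w] * (p.[w]^* * p.[w]^*)).

Definition dinfl_fun (w v : K[i]) : K :=
  complex.Im (A^`().[w] * v * (p.[w]^* * p.[w]^*) +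
    A.[w] * ((p^`().[w] * v)^* * p.[w]^* + p.[w]^* * (p^`().[w] * v)^*)).

(** This is [|p|^4 R'']. It represents the differential of [infl_fun], which is [|p|^4 Im R'], at
    points of the curve only, where [A] is a real multiple of [p ^+ 2]; elsewhere the derivative of
    [|p|^4] contributes. *)
Definition infl_grad (w : K[i]) : K[i] := (p.[w]^* * p.[w]^*) * B.[w] / p.[w].

Lemma inflection_fun z : p.[z] != 0 -> inflection P Q z <-> infl_fun z = 0.
Proof. by move=> pz; rewrite inflectionP // expr2. Qed.

Lemma near_inflection_fun z : p.[z] != 0 ->
  \forall w \near z, p.[w] != 0 /\ (inflection P Q w <-> infl_fun w = 0).
Proof.
move=> pz; near=> w; have pw : p.[w] != 0 by near: w; exact: near_rden.
by split => //; exact: inflection_fun.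
Unshelve. all: by end_near. Qed.

Lemma infl_fun_cder (g : K -> K[i]) (t : K) v : cder g t v ->
  is_derive t 1 (fun s => infl_fun (g s)) (dinfl_fun (g t) v).
Proof.
move=> gv; suff [] : cder (fun s => A.[g s] * (p.[g s]^* * p.[g s]^*)) t
    (A^`().[g t] * v * (p.[g t]^* * p.[g t]^*) +
     A.[g t] * ((p^`().[g t] * v)^* * p.[g t]^* + p.[g t]^* * (p^`().[g t] * v)^*)) by [].
have pc : cder (fun s => p.[g s]^*) t (p^`().[g t] * v)^*.
  by apply: cderJ; exact: cder_horner.
by apply: cderM; [exact: cder_horner|exact: cderM].
Qed.

Lemma dinfl_funE z v : p.[z] != 0 -> infl_fun z = 0 ->
  dinfl_fun z v = complex.Im (v * infl_grad z).
Proof.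
move=> pz Iz; pose c := A.[z] / p.[z] ^+ 2.
have cR : complex.Im c = 0.
  by apply/eqP; rewrite Im_div_eq0 ?expf_neq0 // expr2 conjM; apply/eqP.
have AE : A.[z] = c * p.[z] ^+ 2 by rewrite /c; field.
rewrite /dinfl_fun /infl_grad num2E AE.
have -> : v * (p.[z]^* * p.[z]^* * (A^`().[z] * p.[z] -
    c * p.[z] ^+ 2 * p^`().[z] *+ 2) / p.[z]) =
    A^`().[z] * v * (p.[z]^* * p.[z]^*) -
    c * (p.[z]^* * p.[z]^* * p.[z] * p^`().[z] * v) *+ 2 by field.
rewrite !ImD; congr (_ + _).
have -> : c = (complex.Re c)%:C by apply: complex_eqP.
have -> : p.[z]^* * p.[z]^* * p.[z] * p^`().[z] * v =
  p.[z]^* * p.[z]^* * p.[z] * (p^`().[z] * v) by ring.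
move: (p.[z]) (p^`().[z] * v) (complex.Re c) => [a a'] [b b'] r /=.
by rewrite ?expr2 /=; ring.
Qed.

Lemma infl_grad_neq0 z : p.[z] != 0 -> B.[z] != 0 -> infl_grad z != 0.
Proof.
move=> pz Bz; rewrite /infl_grad mulf_neq0 ?invr_eq0 // mulf_neq0 //.
by rewrite -conjM -mod_eq0 modJ mod_eq0 mulf_neq0.
Qed.

Lemma dinfl_fun_cont v w : {for w, continuous (dinfl_fun^~ v)}.
Proof.
rewrite /dinfl_fun; apply: continuous_Im.
have hc f : {for w, continuous (fun w : K[i] => f.[w])} by exact: horner_continuous_at.
have pc : {for w, continuous (fun w : K[i] => p.[w]^*)} by apply: contC_J; exact: hc.
have vc : {for w, continuous (fun w : K[i] => (p^`().[w] * v)^*)}.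
  by apply: contC_J; apply: contC_M; [exact: hc|exact: contC_cst].
apply: contC_D; apply: contC_M.
- by apply: contC_M; [exact: hc|exact: contC_cst].
- by apply: contC_M; exact: pc.
- exact: hc.
- by apply: contC_D; apply: contC_M; [exact: vc|exact: pc|exact: pc|exact: vc].
Qed.

Lemma dinfl_fun_real (w v : K[i]) (y : K) :
  dinfl_fun w (y%:C * v) = y * dinfl_fun w v.
Proof.
rewrite /dinfl_fun -ImMC; congr complex.Im.
have -> : (p^`().[w] * (y%:C * v))^* = y%:C * (p^`().[w] * v)^*.
  by rewrite mulrCA conjM; congr (_ * _); rewrite conjc_real.
by ring.
Qed.

(** In the direction [v = i * conj (grad)] the differential at [z] is [|grad|^2 > 0], and it stays
    positive nearby. Two distinct zeros differing by a real multiple of [v] would contradict the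
    mean value theorem on the segment between them. *)
Lemma infl_proj z : p.[z] != 0 -> B.[z] != 0 -> infl_fun z = 0 ->
  exists (v : K[i]) (e : K), [/\ v != 0, 0 < e & forall w1 w2 : K[i],
    mod (w1 - z) < e -> mod (w2 - z) < e -> infl_fun w1 = 0 -> infl_fun w2 = 0 ->
    complex.Im (w1 * v^*) = complex.Im (w2 * v^*) -> w1 = w2].
Proof.
move=> pz Bz Iz; have S0 := infl_grad_neq0 pz Bz; pose v := 'i * (infl_grad z)^*.
have v0 : v != 0.
  rewrite /v mulf_neq0 -?mod_eq0 ?modJ ?mod_eq0 //.
  by rewrite eq_complex /= oner_eq0 andbF.
have dpos : 0 < dinfl_fun z v.
  rewrite dinfl_funE // /v -mulrA [_^* * _]mulrC mulJ mulrC ImMC /= mulr1.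
  by rewrite exprn_gt0 // mod_gt0.
have : \forall w \near z, 0 < dinfl_fun w v.
  by apply: (@cont_gt _ _ (dinfl_fun^~ v)) => //; exact: dinfl_fun_cont.
move=> /nbhsCP[e e0 eP]; exists v, e; split => // w1 w2 d1 d2 I1 I2 Iv.
have [y yE] : exists y : K, w2 - w1 = y%:C * v.
  have hr : (w2 - w1) * v^* = (complex.Re ((w2 - w1) * v^*))%:C.
    by apply: complex_eqP => //; rewrite mulrBl ImD ImN Iv subrr ImC.
  have mv : mod v ^+ 2 != 0 by rewrite expf_neq0 // mod_eq0.
  exists (complex.Re ((w2 - w1) * v^*) / mod v ^+ 2).
  have mvC : (mod v ^+ 2)%:C != 0 by rewrite fmorph_eq0.
  apply: (mulIf mvC); rewrite mulrAC -rmorphM /= divfK // -hr -mulJ; ring.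
pose g (s : K) := w1 + (s * y)%:C * v.
have gd (s : K) : cder g s (y%:C * v).
  rewrite -[y%:C * v]add0r; apply: cderD (cder_cst _ _) _.
  rewrite -[y%:C * v]addr0 -[X in _ + X](mulr0 (s * y)%:C).
  apply: cderM (cder_cst _ _); apply: cder_real.
  by apply: is_derive_eq; rewrite ?scaler0 ?add0r ?addr0 [LHS]mulr1.
have gI (s : K) := infl_fun_cder (gd s).
have ct : {within `[0, 1], continuous (fun s => infl_fun (g s))}.
  by apply: continuous_subspaceT => s; exact: is_derive_cont (gI s).
have [c] := MVT_segment ler01 (fun s _ => gI s) ct.
rewrite in_itv /= => /andP[c0 c1].
have g1 : g 1 = w2 by rewrite /g mul1r -yE addrC subrK.
have g0 : g 0 = w1 by rewrite /g !mul0r addr0.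
rewrite g1 g0 I1 I2 subrr subr0 mulr1 dinfl_fun_real => /esym/eqP.
have gc : mod (g c - z) < e.
  have -> : g c - z = (1 - c)%:C * (w1 - z) + c%:C * (w2 - z).
    have -> : w2 = w1 + y%:C * v by rewrite -yE addrC subrK.
    by rewrite /g rmorphB rmorphM /=; ring.
  rewrite (le_lt_trans (modD _ _)) // !modM !modC (ger0_norm c0) ger0_norm ?subr_ge0 //.
  have [->|c00] := eqVneq c 0; first by rewrite subr0 mul1r mul0r addr0.
  have : c * mod (w2 - z) < c * e by rewrite ltr_pM2l // lt_neqAle eq_sym c00.
  have : (1 - c) * mod (w1 - z) <= (1 - c) * e by rewrite ler_wpM2l ?subr_ge0 // ltW.
  by lra.
rewrite mulf_eq0 [dinfl_fun _ _ == 0]gt_eqF ?eP // orbF => /eqP y0.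
by move: yE; rewrite y0 mul0r => /eqP; rewrite subr_eq0 => /eqP.
Qed.

Lemma regular_not_singular z : p.[z] != 0 -> B.[z] != 0 -> ~ singular_locus P Q z.
Proof.
move=> pz Bz [Xz [n [g [n1 [gP gI gX]]]]].
have [v [e [v0 e0 inj]]] := infl_proj pz Bz ((inflection_fun pz).1 Xz).
have projc : continuous (fun w : K[i] => complex.Im (w * v^*)).
  move=> w; apply: (@continuous_Im _ _ (fun w : K[i] => w * v^*)).
  by apply: contC_M; [exact: cvg_id|exact: contC_cst].
have n0 : (0 < n)%N by exact: ltn_trans n1.
pose i0 := Ordinal n0; pose i1 := Ordinal n1.
have X' i : \forall w \near z, arc_image (g i) w -> infl_fun w = 0.
  near=> w => gw; have [_ <-] : p.[w] != 0 /\ (inflection P Q w <-> infl_fun w = 0).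
    by near: w; exact: near_inflection_fun.
  have -> : inflection P Q w <-> exists i, arc_image (g i) w by near: w.
  by exists i.
apply: (crossing_arcs_meet e0 projc inj (gP i0) (gP i1) (X' i0) (X' i1)).
exact: gI.
Unshelve. all: by end_near. Qed.

Hypothesis B_neq0 : B != 0.

Lemma irregular_singular z : inflection P Q z -> (p.[z] == 0) || (B.[z] == 0) ->
  singular_locus P Q z.
Proof.
move=> Xz /orP[/eqP pz|Bz]; first exact: pole_singular.
have [pz|pz] := eqVneq p.[z] 0; first exact: pole_singular.
have [k [k0 k1 [g gP]]] := inflection_branches B_neq0 pz Xz.
split => //; exists k, g; split => //.
by move: k0 k1; rewrite Bz /=; case: k {g gP} => [//|[|k]].
Qed.

Lemma regular_param z : p.[z] != 0 -> B.[z] != 0 -> inflection P Q z ->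
  exists g, local_param (inflection P Q) z g.
Proof.
move=> pz Bz Xz.
have [k [k0 k1 [g [gP _ gX]]]] := inflection_branches B_neq0 pz Xz.
move: k1; rewrite Bz => /eqP k1; subst k; exists (g ord0); split => //.
by apply: filterS gX => w ->; split=> [h|]; [case: h => i; rewrite ord1|exists ord0].
Qed.

Lemma arc_tangent z g (t : K) : smooth_arc z g -> `|t| < 1 -> p.[g t] != 0 ->
  (\forall s \near t, infl_fun (g s) = 0) ->
  complex.Im (curve_deriv g t * infl_grad (g t)) = 0.
Proof.
move=> gP t1 pg g0; rewrite -dinfl_funE //; last exact: (nbhs_singleton g0).
have gd := infl_fun_cder (smooth_arc_cder gP t1).
have h : is_derive t 1 (fun=> 0 : K) (dinfl_fun (g t) (curve_deriv g t)).
  exact: near_eq_is_derive gd.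
by have [_ <-] := h; rewrite derive_cst.
Qed.

Lemma param_infl_fun z g : p.[z] != 0 -> local_param (inflection P Q) z g ->
  exists2 d : K, 0 < d < 1 & forall t : K, `|t| <= d ->
    p.[g t] != 0 /\ infl_fun (g t) = 0.
Proof.
move=> pz [gP gX].
have : \forall w \near z, p.[w] != 0 /\ (arc_image g w -> infl_fun w = 0).
  near=> w; have [pw Iw] : p.[w] != 0 /\ (inflection P Q w <-> infl_fun w = 0).
    by near: w; exact: near_inflection_fun.
  split => // gw; apply/Iw.
  have -> : inflection P Q w <-> arc_image g w by near: w.
  by [].
move=> /(arc_near gP)[d /andP[d0 d1] dP]; exists d; first by rewrite d0.
move=> t td; have [pg h] := dP t td; split => //; apply: h; exists t => //.
by rewrite /= in_itv /= -ler_norml (le_trans td) // ltW.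
Unshelve. all: by end_near. Qed.

(** The velocity of the arc is nonzero and has a real product with [infl_grad]. So being a real
    multiple of the velocity amounts to having a real product with [infl_grad] as well. *)
Lemma param_tangent z g : p.[z] != 0 -> B.[z] != 0 ->
  local_param (inflection P Q) z g ->
  (exists s : K, Rf P Q z = s%:C * curve_deriv g 0) <->
  complex.Im (Rf P Q z * infl_grad z) = 0.
Proof.
move=> pz Bz gparam; have [d /andP[d0 d1] dP] := param_infl_fun pz gparam.
have [gP gX] := gparam; have g0 : g 0 = z by case: gP.
have tg : complex.Im (curve_deriv g 0 * infl_grad z) = 0.
  rewrite -[in infl_grad z]g0; apply: (arc_tangent gP); rewrite ?normr0 ?g0 //.
  near=> t; have td : `|t| < d by near: t; apply: near_norm_lt; rewrite normr0.
  exact: (dP t (ltW td)).2.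
have S0 := infl_grad_neq0 pz Bz.
have g'0 : curve_deriv g 0 != 0.
  by case: gP => _ _ _ /(_ 0); rewrite in_itv /= ltrN10 ltr01 => /(_ isT)[].
split=> [[s ->]|RS]; first by rewrite -mulrA ImMC tg mulr0.
pose x := complex.Re (Rf P Q z * infl_grad z).
pose y := complex.Re (curve_deriv g 0 * infl_grad z).
have xE : Rf P Q z * infl_grad z = x%:C by apply: complex_eqP.
have yE : curve_deriv g 0 * infl_grad z = y%:C by apply: complex_eqP.
have y0 : y%:C != 0 by rewrite -yE mulf_neq0.
exists (x / y); apply: (mulIf S0); rewrite xE -mulrA yE -rmorphM /=.
by rewrite divfK // -(fmorph_eq0 (real_complex K)).
Unshelve. all: by end_near. Qed.

Lemma tangency_locusP z : tangency_locus P Q z <->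
  [/\ p.[z] != 0, B.[z] != 0, inflection P Q z &
      complex.Im (Rf P Q z * infl_grad z) = 0].
Proof.
split=> [[Xz nS [g gparam [s sE]]]|[pz Bz Xz Iz]].
  have /negP := contra_not (irregular_singular Xz) nS.
  rewrite negb_or => /andP[pz Bz]; split => //.
  by apply/(param_tangent pz Bz gparam); exists s.
have [g gparam] := regular_param pz Bz Xz.
split => //; first exact: regular_not_singular.
by exists g => //; apply/(param_tangent pz Bz gparam).
Qed.

Lemma transverse_locusP z : inflection P Q z -> ~ singular_locus P Q z ->
  ~ tangency_locus P Q z -> transverse_locus P Q z.
Proof.
move=> Xz nS nT; have /negP := contra_not (irregular_singular Xz) nS.
rewrite negb_or => /andP[pz Bz].
have [g gparam] := regular_param pz Bz Xz; split => //; exists g => // s sE.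
apply: nT; apply/tangency_locusP; split => //.
by apply/(param_tangent pz Bz gparam); exists s.
Qed.

End RegularPoints.

(** * Exponential, logarithm and the roots of T((z - u)^t) *)

Section ComplexDerivative.
Variable K : realType.
Implicit Types (f g : K[i] -> K[i]) (z w d : K[i]).

Lemma mod_cont f z :
  (forall e, 0 < e -> \forall w \near z, mod (f w - f z) < e) ->
  {for z, continuous f}.
Proof. by move=> h; apply/(@cvgCP _ _ (nbhs z) _ f). Qed.

Lemma cont_mod f z e : {for z, continuous f} -> 0 < e ->
  \forall w \near z, mod (f w - f z) < e.
Proof. exact: (@cvg_near_mod K _ (nbhs z) _ f (f z) e). Qed.

(** With a continuous slope function in place of difference quotients, the chain rule and the
    derivative of an inverse become a product and a quotient of slopes. *)
Lemma caratheodory f z d : is_derive z 1 f d <->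
  exists h : K[i] -> K[i], [/\ {for z, continuous h}, h z = d &
    \forall w \near z, f w - f z = h w * (w - z)].
Proof.
have FF : Filter ((0 : K[i])^') by typeclasses eauto.
split=> [[fd <-]|[h [hc hd fh]]].
  pose h w := if w == z then 'D_1 f z else (f w - f z) / (w - z).
  have hz : h z = 'D_1 f z by rewrite /h eqxx.
  exists h; split; [|exact: hz|]; last first.
    apply: ((@nbhsCP K z _).2); exists 1 => // w _; rewrite /h.
    have [->|wz] := eqVneq w z; first by rewrite !subrr mulr0.
    by rewrite divfK // subr_eq0.
  apply: mod_cont => e e0.
  have lim : (fun w => w^-1 *: (f (w *: 1 + z) - f z)) @ 0^' --> 'D_1 f z by exact: fd.
  have := (@cvgCP K _ _ FF _ _).1 lim e e0; rewrite near_withinE => H.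
  have [r r0 rP] := (@nbhsCP K 0 _).1 H.
  apply: ((@nbhsCP K z _).2); exists r => // w wr; rewrite hz /h.
  have [_|wz] := eqVneq w z; first by rewrite subrr mod0.
  have wz0 : w - z != 0 by rewrite subr_eq0.
  have := rP (w - z); rewrite subr0 => /(_ wr wz0).
  by rewrite [(w - z) *: 1]mulr1 subrK [_ *: _]mulrC.
have H : w^-1 *: (f (w *: 1 + z) - f z) @[w --> (0 : K[i])^'] --> d.
  apply: ((@cvgCP K _ _ FF _ _).2) => e e0; rewrite near_withinE.
  have [r r0 rP] := (@nbhsCP K z _).1 (cont_mod hc e0).
  have [s s0 sP] := (@nbhsCP K z _).1 fh.
  apply: ((@nbhsCP K 0 _).2); exists (Num.min r s); first by rewrite lt_min r0.
  move=> w; rewrite subr0 lt_min => /andP[wr ws] w0.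
  have wz : w + z - z = w by rewrite addrK.
  have := rP (w + z); rewrite wz hd => /(_ wr) hw.
  have := sP (w + z); rewrite wz => /(_ ws) fw.
  have -> : w^-1 *: (f (w *: 1 + z) - f z) = h (w + z) => //.
  by rewrite [w *: 1]mulr1 fw [_ *: _]mulrC mulfK.
apply: DeriveDef; first by apply/cvg_ex; exists d.
exact/cvg_lim.
Qed.

Lemma is_derive_contC f z d : is_derive z 1 f d -> {for z, continuous f}.
Proof.
move=> /caratheodory[h [hc hz fh]].
have H : {for z, continuous (fun w => f z + h w * (w - z))}.
  apply: contC_D; first exact: contC_cst.
  apply: contC_M; first exact: hc.
  by apply: (@contC_D _ _ id (fun=> - z)); [exact: cvg_id|exact: contC_cst].
apply: mod_cont => e e0; near=> w.
have -> : f w - f z = f z + h w * (w - z) - (f z + h z * (z - z)).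
  by rewrite subrr mulr0 addr0 [in RHS]addrAC subrr add0r; near: w.
by near: w; exact: (cont_mod H).
Unshelve. all: by end_near. Qed.

Lemma is_deriveC_comp f g z d e : is_derive z 1 f d -> is_derive (f z) 1 g e ->
  is_derive z 1 (g \o f) (e * d).
Proof.
move=> fd; have fc := is_derive_contC fd; move: fd.
move=> /caratheodory[h [hc <- fh]] /caratheodory[k [kc <- gk]]; apply/caratheodory.
exists (fun w => k (f w) * h w); split; [|by []|].
  by apply: contC_M; [exact: (contC_comp fc kc)|exact: hc].
near=> w; rewrite /= -mulrA.
have <- : f w - f z = h w * (w - z) by near: w.
by near: w; exact: fc gk.
Unshelve. all: by end_near. Qed.

Lemma is_deriveC_inverse f g z d : {for z, continuous g} ->
  (\forall w \near z, f (g w) = w) -> is_derive (g z) 1 f d -> d != 0 ->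
  is_derive z 1 g d^-1.
Proof.
move=> gc fg /caratheodory[k [kc <- fk]] d0; apply/caratheodory.
have kg : {for z, continuous (fun w => k (g w))} := contC_comp gc kc.
exists (fun w => (k (g w))^-1); split; [exact: (contC_V kg d0)|by []|].
have fgz : f (g z) = z by exact: (nbhs_singleton fg).
near=> w; have kw0 : k (g w) != 0 by near: w; exact: (near_neq0 kg).
apply: (mulfI kw0); rewrite mulrA divff // mul1r.
have <- : f (g w) - f (g z) = k (g w) * (g w - g z) by near: w; exact: gc fk.
by rewrite fgz; congr (_ - _); near: w.
Unshelve. all: by end_near. Qed.

Lemma derive_approx (f : K -> K) (x d e : K) : is_derive x 1 f d -> 0 < e ->
  \forall y \near x, `|f y - f x - d * (y - x)| <= e * `|y - x|.
Proof.
move=> [fd <-] e0.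
have lim : (fun h => h^-1 *: (f (h *: 1 + x) - f x)) @ 0^' --> 'D_1 f x by exact: fd.
have /cvgrPdist_lt /(_ e e0) := lim; rewrite near_withinE => /nbhs_ballP[r /= r0 rP].
apply/nbhs_ballP; exists r => //= y; rewrite /ball /= => yr.
have [->|yx] := eqVneq y x; first by rewrite !subrr mulr0 subr0 normr0 mulr0.
have yx0 : y - x != 0 by rewrite subr_eq0.
have := rP (y - x); rewrite /ball /= sub0r opprB => /(_ yr yx0).
rewrite [(y - x) *: 1]mulr1 subrK distrC => /ltW h.
rewrite (_ : _ - _ = ((y - x)^-1 *: (f y - f x) - 'D_1 f x) * (y - x)).
  by rewrite normrM ler_wpM2r.
by rewrite mulrBl [_ *: _]mulrC divfK.
Qed.

Lemma cexpD z w : cexp (z + w) = cexp z * cexp w.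
Proof.
case: z w => [a b] [c d]; rewrite /cexp /= expRD cosD sinD.
by apply: complex_eqP => /=; ring.
Qed.

Lemma cexp0 : cexp (0 : K[i]) = 1.
Proof. by rewrite /cexp /= expR0 cos0 sin0; apply: complex_eqP => /=; ring. Qed.

Lemma cexp_neq0 z : cexp z != 0.
Proof.
have : cexp z * cexp (- z) != 0 by rewrite -cexpD subrr cexp0 oner_eq0.
by apply: contraNneq => ->; rewrite mul0r.
Qed.

(** By the addition law only the expansion at 0 matters, and it follows from those of [expR], [cos]
    and [sin]. *)
Lemma is_derive_cexp z : is_derive z 1 (@cexp K) (cexp z).
Proof.
apply/caratheodory.
pose h w := if w == z then cexp z else (cexp w - cexp z) / (w - z).
have hz : h z = cexp z by rewrite /h eqxx.
exists h; split; [|exact: hz|]; last first.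
  apply: ((@nbhsCP K z _).2); exists 1 => // w _; rewrite /h; have [->|wz] := eqVneq w z.
    by rewrite !subrr mulr0.
  by rewrite divfK // subr_eq0.
apply: mod_cont => e e0.
pose E := mod (cexp z); have E0 : 0 < E by rewrite mod_gt0 cexp_neq0.
(* The remainder will be at most [6 * e'] times the increment; 8 instead of 6 makes the final
   inequality strict. *)
pose e' := Num.min 1 (e / (8 * E)).
have e'0 : 0 < e' by rewrite lt_min ltr01 divr_gt0 // mulr_gt0.
have e'1 : e' <= 1 by rewrite ge_min lexx.
have e'e : 8 * (E * e') <= e.
  by rewrite mulrA mulrC -ler_pdivlMr ?mulr_gt0 // ge_min lexx orbT.
have a1 : \forall a \near (0 : K), `|expR a - 1 - a| <= e' * `|a|.
  have := derive_approx (is_derive_expR 0) e'0; apply: filterS => a.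
  by rewrite expR0 mul1r subr0.
have a2 : \forall a \near (0 : K), `|cos a - 1| <= e' * `|a|.
  have := derive_approx (is_derive_cos 0) e'0; apply: filterS => a.
  by rewrite cos0 sin0 !subr0 oppr0 mul0r subr0.
have a3 : \forall a \near (0 : K), `|sin a - a| <= e' * `|a|.
  have := derive_approx (is_derive_sin 0) e'0; apply: filterS => a.
  by rewrite cos0 sin0 mul1r !subr0.
have a4 : \forall a \near (0 : K), `|expR a - 1| <= e'.
  have ec : {for 0, continuous (@expR K)} by exact: continuous_expR.
  by have := cont_dist ec e'0; apply: filterS => a; rewrite expR0 => /ltW.
have : \forall a \near (0 : K), [/\ `|expR a - 1 - a| <= e' * `|a|,
    `|cos a - 1| <= e' * `|a|, `|sin a - a| <= e' * `|a| & `|expR a - 1| <= e'].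
  by near=> a; split; near: a.
move=> /nbhs_ballP[r /= r0 rP]; apply: ((@nbhsCP K z _).2); exists r => // w wr; rewrite hz /h.
have [_|wz] := eqVneq w z; first by rewrite subrr mod0.
have wz0 : w - z != 0 by rewrite subr_eq0.
have mwz : 0 < mod (w - z) by rewrite mod_gt0.
have -> : (cexp w - cexp z) / (w - z) - cexp z =
    cexp z * (cexp (w - z) - 1 - (w - z)) / (w - z).
  have -> : cexp w = cexp z * cexp (w - z) by rewrite -cexpD addrC subrK.
  by field.
rewrite modM [mod (cexp z * _)]modM modV ltr_pdivrMr // -/E.
suff b : mod (cexp (w - z) - 1 - (w - z)) <= 6 * e' * mod (w - z).
  apply: (@le_lt_trans _ _ (E * (6 * e' * mod (w - z)))).
  by rewrite ler_pM2l.
  have Ee : 0 < E * e' by rewrite mulr_gt0.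
  by rewrite [X in X < _]mulrA (ltr_pM2r mwz); lra.
have Rr : `|complex.Re (w - z)| <= mod (w - z) := Re_le_mod _.
have Ir : `|complex.Im (w - z)| <= mod (w - z) := Im_le_mod _.
have [] := rP (complex.Re (w - z)).
  by rewrite /ball /= sub0r normrN (le_lt_trans Rr).
have [] := rP (complex.Im (w - z)).
  by rewrite /ball /= sub0r normrN (le_lt_trans Ir).
move=> _ cb sb _ ea _ _ ea1; apply: le_trans (mod_le_ReIm _) _.
move: Rr Ir mwz cb sb ea ea1; move: (mod (w - z)) => m.
case: (w - z) => a b /= Rr Ir m0 cb sb ea ea1.
have e'm : e' * `|a| <= e' * m by rewrite ler_pM2l.
have e'b : e' * `|b| <= e' * m by rewrite ler_pM2l.
have ea2 : `|expR a| <= 2 by move: ea1 e'1; rewrite !ler_norml => /andP[] *; apply/andP; lra.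
have R1 : `|expR a * (cos b - 1)| <= 2 * (e' * m).
  by rewrite normrM ler_pM // (le_trans cb).
have I1 : `|expR a * (sin b - b)| <= 2 * (e' * m).
  by rewrite normrM ler_pM // (le_trans sb).
have I2 : `|(expR a - 1) * b| <= e' * m by rewrite normrM ler_pM.
have Re_b : `|expR a * cos b - 0 * sin b - 1 - a| <= 3 * (e' * m).
  rewrite (_ : _ - a = expR a * (cos b - 1) + (expR a - 1 - a)); last by ring.
  by rewrite (le_trans (ler_normD _ _)) //; lra.
have Im_b : `|expR a * sin b + 0 * cos b - 0 - b| <= 3 * (e' * m).
  rewrite (_ : _ - b = expR a * (sin b - b) + (expR a - 1) * b); last by ring.
  by rewrite (le_trans (ler_normD _ _)) //; lra.
lra.
Unshelve. all: by end_near. Qed.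

End ComplexDerivative.

(** * Branches of the logarithm and the algebraic form of invariance *)

Section Logarithm.
Variable K : realType.

Lemma atan_polar (m n : K) : 0 < m ->
  m +i* n = (mod (m +i* n))%:C * (cos (atan (n / m)) +i* sin (atan (n / m))).
Proof.
move=> m0; set t := n / m; set s := Num.sqrt (1 + t ^+ 2).
have t0 : 0 < 1 + t ^+ 2 by rewrite ltr_pwDl ?sqr_ge0.
have s0 : s != 0 by rewrite gt_eqF // sqrtr_gt0.
have c : cos (atan t) = s^-1 by rewrite cos_atan.
have d : sin (atan t) = t * s^-1.
  by rewrite -[t in t * _]atanK /tan c divfK // invr_eq0.
have md : mod (m +i* n) = m * s.
  rewrite /= (_ : m ^+ 2 + n ^+ 2 = m ^+ 2 * (1 + t ^+ 2)); last first.
    by rewrite /t; field; rewrite gt_eqF.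
  by rewrite sqrtrM ?sqr_ge0 // sqrtr_sqr gtr0_norm.
rewrite md c d /t; apply: complex_eqP => /=; field; rewrite ?s0 ?gt_eqF //.
Qed.

(** The principal branch, meaningful on the right half-plane only, where [atan (Im / Re)] is the
    argument. *)
Definition clog (z : K[i]) : K[i] :=
  ln (mod z) +i* atan (complex.Im z / complex.Re z).

Lemma clogK z : 0 < complex.Re z -> cexp (clog z) = z.
Proof.
move=> z0; have zE : z = complex.Re z +i* complex.Im z by case: (z).
rewrite /cexp [RHS]zE (atan_polar _ z0) -zE /= lnK // posrE mod_gt0.
by apply: contraTneq z0 => ->; rewrite ltxx.
Qed.

Lemma clog_cont z : 0 < complex.Re z -> {for z, continuous clog}.
Proof.
move=> z0; have m0 : 0 < mod z.
  by rewrite mod_gt0; apply: contraTneq z0 => ->; rewrite ltxx.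
have c1 : {for z, continuous (@ln K \o (fun z : K[i] => mod z))}.
  by apply: continuous_comp; [exact: mod_continuous|exact: continuous_ln].
have c2 : {for z, continuous (@atan K \o (fun z : K[i] => complex.Im z / complex.Re z))}.
  apply: continuous_comp; last exact: continuous_atan.
  apply: (@cvgM _ _ (nbhs z)); first exact: Im_continuous.
  by apply: (@cvgV _ _ (nbhs z)); [rewrite gt_eqF|exact: Re_continuous].
by apply: continuousC; [exact: c1|exact: c2].
Qed.

(** Multiplication by -1, by [- 'i], or by both brings a nonzero number into the right half-plane;
    adding [i pi] and [i pi / 2] to the logarithm undoes it. *)
Lemma clog_exists (c : K[i]) : c != 0 -> exists l, cexp l = c.
Proof.
have pos (d : K[i]) : 0 < complex.Re d -> exists l, cexp l = d.
  by move=> d0; exists (clog d); exact: clogK.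
have epi : cexp ('i * pi%:C) = -1 :> K[i].
  by rewrite /cexp /= !mul0r !mul1r subrr add0r expR0 cospi sinpi;
     apply: complex_eqP => /=; ring.
have epi2 : cexp ('i * (pi / 2)%:C) = 'i :> K[i].
  by rewrite /cexp /= !mul0r !mul1r subrr add0r expR0 cos_pihalf sin_pihalf;
     apply: complex_eqP => /=; ring.
have nz (d : K[i]) : complex.Re d != 0 -> exists l, cexp l = d.
  move=> d0; have [lt0|gt0|/eqP] := ltgtP (complex.Re d) 0; last by rewrite (negPf d0).
    have [|l lE] := pos (- d); first by rewrite ReN oppr_gt0.
    by exists (l + 'i * pi%:C); rewrite cexpD lE epi mulrN1 opprK.
  exact: pos.
move=> c0; have [r0|r0] := eqVneq (complex.Re c) 0; last exact: nz.
have [|l lE] := nz (c * - 'i).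
  rewrite ReM /= r0 mul0r sub0r oppr_eq0 mulrN1 oppr_eq0.
  by apply: contraNneq c0 => i0; rewrite eq_complex r0 i0 !eqxx.
exists (l + 'i * (pi / 2)%:C); rewrite cexpD lE epi2 -mulrA.
by rewrite (_ : - 'i * 'i = 1) ?mulr1 //; apply: complex_eqP => /=; ring.
Qed.

Lemma log_branch_exists (u z : K[i]) : z != u -> exists L, log_branch u z L.
Proof.
move=> zu; pose c := z - u; have c0 : c != 0 by rewrite subr_eq0.
have [l lE] := clog_exists c0.
(* Division by [c] moves the argument at [w = z] to 1, inside the half-plane where [clog] is a
   logarithm. *)
pose L w := l + clog ((w - u) / c); exists L.
have divc : continuous (fun w : K[i] => (w - u) / c).
  move=> w; apply: (@contC_M _ _ (fun w => w - u) (fun=> c^-1)); last exact: contC_cst.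
  by apply: (@contC_D _ _ id (fun=> - u)); [exact: cvg_id|exact: contC_cst].
have pos : \forall w \near z, 0 < complex.Re ((w - u) / c).
  apply: (@cont_gt _ _ (fun w => complex.Re ((w - u) / c))).
    by apply: (@continuous_Re _ _ (fun w => (w - u) / c)); exact: divc.
  by rewrite divff //= ltr01.
have LK w : 0 < complex.Re ((w - u) / c) -> cexp (L w) = w - u.
  by move=> w0; rewrite /L cexpD lE clogK // mulrC divfK.
have Lc w : 0 < complex.Re ((w - u) / c) -> {for w, continuous L}.
  move=> w0; apply: (@contC_D _ _ (fun=> l)); first exact: contC_cst.
  exact: (contC_comp (@divc w) (clog_cont w0)).
have pos' : \forall w \near z, \forall x \near w, 0 < complex.Re ((x - u) / c).
  apply: filterS pos => w w0; apply: (@cont_gt _ _ (fun w => complex.Re ((w - u) / c))).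
    by apply: (@continuous_Re _ _ (fun w => (w - u) / c)); exact: divc.
  exact: w0.
near=> w.
have w0 : 0 < complex.Re ((w - u) / c) by near: w.
have w1 : \forall x \near w, 0 < complex.Re ((x - u) / c) by near: w.
split; last exact: LK.
have dE : is_derive (L w) 1 (fun x => cexp x + u) (cexp (L w)).
  have := is_deriveD (is_derive_cexp (L w)) (is_derive_cst u (L w) (1 : K[i])).
  by rewrite addr0.
have : is_derive w 1 L (cexp (L w))^-1.
  apply: (is_deriveC_inverse (Lc w w0) _ dE (cexp_neq0 _)).
  by apply: filterS w1 => x x0; rewrite LK // subrK.
by case.
Unshelve. all: by end_near. Qed.

(** Differentiating [cexp (L w) = w - u] gives [L' = 1 / (z - u)]. *)
Lemma diffop_branch (P Q : {poly K[i]}) (u z : K[i]) (t : K) L : log_branch u z L ->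
  diffop P Q (fun w => cexp (t%:C * L w)) z =
  cexp (t%:C * L z) / (z - u) * (t%:C * Q.[z] + P.[z] * (z - u)).
Proof.
move=> Lz; have [Ld Lu] := nbhs_singleton Lz.
have zu : z - u != 0 by rewrite -Lu cexp_neq0.
have dL : is_derive z 1 L ('D_1 L z) by exact: DeriveDef.
have e1 : cexp (L z) * 'D_1 L z = 1.
  have d1 := is_deriveC_comp dL (is_derive_cexp (L z)).
  have d2 : is_derive z 1 (fun w => w - u) (1 : K[i]).
    have := is_deriveD (is_derive_id z (1 : K[i])) (is_derive_cst (- u) z (1 : K[i])).
    by rewrite addr0.
  have d3 : is_derive z 1 (fun w => w - u) (cexp (L z) * 'D_1 L z).
    by apply: near_eq_is_derive d1; apply: filterS Lz => w [].
  by rewrite -(derive_val (is_derive := d3)) (derive_val (is_derive := d2)).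
have d4 : is_derive z 1 (fun w => t%:C * L w) (t%:C * 'D_1 L z).
  exact: (is_deriveZ t%:C dL).
have d5 := is_deriveC_comp d4 (is_derive_cexp (t%:C * L z)).
rewrite /diffop derive1E (derive_val (is_derive := d5)).
have -> : 'D_1 L z = (z - u)^-1.
  by apply: (mulfI zu); rewrite divff // -{1}Lu.
by field.
Qed.

Lemma image_rootP (P Q : {poly K[i]}) (u z : K[i]) (t : K) : z != u ->
  image_root P Q u t z <-> root (t%:C *: Q + P * ('X - u%:P)) z.
Proof.
move=> zu; have zu0 : z - u != 0 by rewrite subr_eq0.
have E : (t%:C *: Q + P * ('X - u%:P)).[z] = t%:C * Q.[z] + P.[z] * (z - u).
  by rewrite hornerD hornerZ hornerM hornerXsubC.
split=> [[L Lz]|/rootP].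
  have nz : cexp (t%:C * L z) / (z - u) != 0.
    by rewrite mulf_neq0 ?invr_eq0 ?cexp_neq0.
  rewrite (diffop_branch _ _ _ Lz) => /eqP; rewrite mulf_eq0 (negPf nz) /= -E.
  by move=> /eqP h; apply/rootP.
rewrite E => h; have [L Lz] := log_branch_exists zu; exists L => //.
by rewrite (diffop_branch _ _ _ Lz) h mulr0.
Qed.

(** Images of powers are replaced by the polynomials [t Q + P (X - u)]. Where [P] does not vanish,
    [z] is a root exactly when [u] is the point of parameter [t] on the ray of [z]. *)
Definition alg_invariant (P Q : {poly K[i]}) (S : set K[i]) : Prop :=
  closed S /\ forall u (t : K), S u -> 0 <= t ->
    t%:C *: Q + P * ('X - u%:P) = 0 \/
    forall z, root (t%:C *: Q + P * ('X - u%:P)) z -> S z.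

Lemma infinite_ball_poly (f : {poly K[i]}) (z : K[i]) (e : K) : 0 < e ->
  (forall x : K, 0 < x < e -> root f (z + x%:C)) -> f = 0.
Proof.
move=> e0 fz; apply/eqP/negPn/negP => f0.
pose n := size f; pose x (i : nat) : K := e / (i.+2)%:R.
have xinj : injective x.
  move=> i j /(mulfI (lt0r_neq0 e0)) /invr_inj /eqP.
  by rewrite eqr_nat => /eqP [].
have rs : all (root f) [seq z + (x i)%:C | i <- iota 0 n].
  apply/allP => _ /mapP[i _ ->]; apply: fz.
  rewrite divr_gt0 //= ltr_pdivrMr // ltr_pMr // ltr1n //.
have us : uniq [seq z + (x i)%:C | i <- iota 0 n].
  by rewrite map_inj_uniq ?iota_uniq // => i j /addrI /complexI /xinj.
have := max_poly_roots f0 rs us.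
by rewrite size_map size_iota ltnn.
Qed.

(** Only the point [u] distinguishes the two notions: it may be a root of the polynomial, but it
    lies in [S] anyway, and a polynomial that vanishes off [u] is zero. *)
Lemma TCH_invariantP (P Q : {poly K[i]}) (S : set K[i]) :
  TCH_invariant P Q S <-> alg_invariant P Q S.
Proof.
split=> -[cS inv]; split=> // u t Su t0.
  have [h|h] := inv u t Su t0; [left|right].
    apply: (@infinite_ball_poly _ u 1) => // x /andP[x0 _].
    have xu : u + x%:C != u by rewrite addrC -subr_eq0 addrK fmorph_eq0 gt_eqF.
    by apply/image_rootP => //; apply: h; exact/eqP.
  by move=> z rz; have [->//|zu] := eqVneq z u; apply: h; exact/image_rootP.
have [h|h] := inv u t Su t0; [left|right] => z.
  by move=> /eqP zu; apply/image_rootP => //; rewrite h root0.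
have [-> //|zu] := eqVneq z u.
by move=> /image_rootP -/(_ zu); exact: h.
Qed.

(** The intersection of two invariant sets is invariant, so minimality applies to that of [M] and
    [S]. *)
Lemma minimal_sub (P Q : {poly K[i]}) (M S : set K[i]) : minimal_TCH P Q M ->
  alg_invariant P Q S -> M `&` S !=set0 -> M `<=` S.
Proof.
move=> [_ /TCH_invariantP[cM iM] minM] [cS iS] MS.
have <- : M `&` S = M; last exact: subIsetr.
apply: minM => //.
apply/TCH_invariantP; split; first exact: closedI.
move=> u t [Mu Su] t0.
have [h|hM] := iM u t Mu t0; first by left.
have [h|hS] := iS u t Su t0; first by left.
by right=> z rz; split; [exact: hM|exact: hS].
Qed.

End Logarithm.

(** * The degenerate case of a constant R' *)

Section LinearField.
Variable K : realType.

Lemma mul_deriv_XsubC_exp (z : K[i]) n :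
  ('X - z%:P) * (('X - z%:P) ^+ n)^`() = (n%:R)%:P * ('X - z%:P) ^+ n :> {poly K[i]}.
Proof.
rewrite deriv_exp derivXsubC mul1r polyC_natr mulr_natl mulrnAr.
by case: n => [|n]; rewrite ?mulr0n // exprS.
Qed.

(** R'' has a pole of order [m + 2] where R has one of order [m]. Multiplied by [X - z], derivatives
    of powers of [X - z] become multiples of these powers, and the cofactor takes at [z] the value
    [((m - 1) - 2 m) A1 p1 = - (m + 1) A1 p1]. *)
Lemma num2_pole (P Q : {poly K[i]}) z : P != 0 -> Q != 0 ->
  (rden P Q).[z] = 0 -> num2 P Q != 0.
Proof.
move=> P0 Q0 pz; have [m [p1 [A1 [m0 pE AE p1z A1z]]]] := pole_multiplicity P0 pz.
set p := rden P Q in pE pz *; set A := num1 P Q in AE *.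
have [u [uE u0 uz ud]] : exists u : {poly K[i]}, [/\ u = 'X - z%:P, u != 0, u.[z] = 0 &
    forall n, u * (u ^+ n)^`() = (n%:R)%:P * u ^+ n].
  exists ('X - z%:P); split; rewrite ?polyXsubC_eq0 ?hornerXsubC ?subrr //.
  exact: mul_deriv_XsubC_exp.
rewrite -uE in pE AE.
apply/eqP => B0; have : u * num2 P Q = 0 by rewrite B0 mulr0.
have -> : u * num2 P Q = u ^+ m.-1 * u ^+ m * ((u * A1^`() + (m.-1%:R)%:P * A1) * p1 -
    (A1 * (u * p1^`() + (m%:R)%:P * p1)) *+ 2).
  rewrite /num2 -/p -/A.
  have -> : u * (A^`() * p - (A * p^`()) *+ 2) = (u * A^`()) * p - (A * (u * p^`())) *+ 2.
    by ring.
  have -> : u * A^`() = (u * A1^`() + (m.-1%:R)%:P * A1) * u ^+ m.-1.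
    rewrite AE derivM mulrDr [u * (A1 * _)]mulrCA ud; ring.
  have -> : u * p^`() = (u * p1^`() + (m%:R)%:P * p1) * u ^+ m.
    rewrite pE derivM mulrDr [u * (p1 * _)]mulrCA ud; ring.
  by rewrite AE pE; ring.
move/eqP; rewrite mulf_eq0 mulf_eq0 !expf_eq0 (negPf u0) !andbF /=.
move=> /eqP /(congr1 (fun f => f.[z])).
rewrite /= horner0 hornerD hornerN hornerMn !(hornerM, hornerD) !hornerC uz.
rewrite !mul0r !add0r.
have -> : m.-1%:R * A1.[z] * p1.[z] - (A1.[z] * (m%:R * p1.[z])) *+ 2 =
   - (m.-1.+2%:R * (A1.[z] * p1.[z])).
  by rewrite -{2}(prednK m0) -!natr1; ring.
by move/eqP; rewrite oppr_eq0 !mulf_eq0 (negPf A1z) (negPf p1z) !orbF pnatr_eq0.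
Qed.

(** By [num2_pole] there is no pole, so [p] is a constant and the second derivative of [q]
    vanishes. *)
Lemma num2_eq0_linear (P Q : {poly K[i]}) : P != 0 -> Q != 0 -> num2 P Q = 0 ->
  exists l m : K[i], Q = (l *: 'X + m%:P) * P /\
    forall z, (rden P Q).[z] != 0 /\ dRf P Q z = l.
Proof.
move=> P0 Q0 B0; have p0 := rden_neq0 Q P0.
have pz z : (rden P Q).[z] != 0.
  by apply/eqP => pz; have := num2_pole P0 Q0 pz; rewrite B0 eqxx.
have /size_poly1P[c c0 pE] : size (rden P Q) == 1.
  by apply: contraT => /closed_rootP[z]; rewrite /root (negPf (pz z)).
have AE : num1 P Q = c *: (rnum P Q)^`() by rewrite /num1 pE derivC mulr0 subr0 mulrC mul_polyC.
have q2 : (rnum P Q)^`()^`() = 0.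
  have := B0; rewrite /num2 AE pE derivC mulr0 mul0rn subr0 derivZ => /eqP.
  by rewrite mulf_eq0 scaler_eq0 polyC_eq0 (negPf c0) orbF /= => /eqP.
have qE : rnum P Q = (rnum P Q)`_1 *: 'X + ((rnum P Q)`_0)%:P.
  apply/polyP => -[|[|i]]; rewrite coefD coefZ coefX coefC /= ?mulr0 ?mulr1 ?addr0 ?add0r //.
  have : (rnum P Q)^`()^`()`_i = 0 by rewrite q2 coef0.
  rewrite !coef_deriv -mulrnA => /eqP; rewrite mulrn_eq0 muln_eq0 /= => /eqP //.
set a := _`_1 in qE; set b := _`_0 in qE.
exists (a / c), (b / c); split.
  have QE := rnumE P Q; have PE := rdenE P Q.
  rewrite -[LHS]QE -[X in _ = _ * X]PE [in LHS]qE pE mulrA; congr (_ * _).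
  rewrite -!mul_polyC mulrDl mulrAC -!polyCM !divfK //.
move=> z; split=> //; rewrite dRfE // AE pE qE derivD derivZ derivX derivC addr0 hornerZ.
by rewrite hornerZ !hornerC; field.
Qed.

(** A pair is a base point and a direction; the direction 0 would describe the whole plane. *)
Definition lines_union (ls : seq (K[i] * K[i])) : set K[i] :=
  [set w | exists2 l, l \in ls & complex.Im ((w - l.1) * l.2^*) = 0].

Lemma lines_union_closed ls : closed (lines_union ls).
Proof.
elim: ls => [|l ls IH].
  rewrite (_ : lines_union _ = set0); first exact: closed0.
  by apply/seteqP; split => // w [].
rewrite (_ : lines_union _ =
    [set w | complex.Im ((w - l.1) * l.2^*) = 0] `|` lines_union ls).
  apply: closedU => //.
  apply: (@closed_comp _ _ (fun w : K[i] => complex.Im ((w - l.1) * l.2^*)) [set 0]).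
    move=> w _; apply: (@continuous_Im _ _ (fun w : K[i] => (w - l.1) * l.2^*)).
    apply: contC_M; last exact: contC_cst.
    by apply: (@contC_D _ _ id (fun=> - l.1)); [exact: cvg_id|exact: contC_cst].
  exact: closed_eq.
apply/seteqP; split => w.
  by move=> [l']; rewrite inE => /orP[/eqP ->|l'ls]; [left|right; exists l'].
move=> [h|[l' l'ls h]]; [exists l => //|exists l' => //]; rewrite inE ?eqxx //.
by rewrite l'ls orbT.
Qed.

(* Every line meets the parabola [w + s + i s^2] in at most two points. *)
Lemma lines_union_interior ls : (forall l, l \in ls -> l.2 != 0) ->
  (lines_union ls)° = set0.
Proof.
move=> ls0; apply/seteqP; split => // w /nbhsCP[e e0 eP].
pose g (l : K[i] * K[i]) : {poly K} :=
  complex.Re l.2 *: 'X^2 - complex.Im l.2 *: 'X +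
    (complex.Im ((w - l.1) * l.2^*))%:P.
have gE l (s : K) : (g l).[s] = complex.Im ((w + s%:C + 'i * (s ^+ 2)%:C - l.1) * l.2^*).
  rewrite /g hornerD hornerD hornerN !hornerZ hornerXn hornerX hornerC.
  case: (l.1) (l.2) => [a b] [c d]; case: (w) => x y /=; ring.
have g0 l : l \in ls -> g l != 0.
  move=> /ls0; apply: contraNneq => gl; rewrite eq_complex.
  have : (g l)`_2 = 0 by rewrite gl coef0.
  have : (g l)`_1 = 0 by rewrite gl coef0.
  rewrite /g !(coefD, coefN, coefZ, coefXn, coefX, coefC) /=.
  by rewrite !mulr0 !mulr1 !(addr0, add0r, subr0, sub0r) => /eqP; rewrite oppr_eq0 => /eqP -> ->; rewrite !eqxx.
pose f := \prod_(l <- ls) g l.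
have f0 : f != 0.
  by rewrite /f prodf_seq_neq0; apply/allP => l lls; rewrite implyTb g0.
have e1 : 0 < Num.min 1 (e / 2) by rewrite lt_min ltr01 divr_gt0.
have : map_poly (real_complex K) f = 0.
  apply: (infinite_ball_poly (z := 0) e1) => x /andP[x0]; rewrite lt_min => /andP[x1 xe].
  rewrite add0r fmorph_root /root /f horner_prod prodf_seq_eq0.
  have [|l lls lE] := eP (w + x%:C + 'i * (x ^+ 2)%:C).
    have -> : w + x%:C + 'i * (x ^+ 2)%:C - w = x +i* x ^+ 2.
      by case: (w) => a b; apply: complex_eqP => /=; ring.
    apply: le_lt_trans (mod_le_ReIm _) _; rewrite /= !ger0_norm ?sqr_ge0 ?ltW //.
    have : x ^+ 2 <= x by rewrite expr2 ler_piMl ?ltW.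
    by lra.
  by apply/hasP; exists l => //=; rewrite gE lE.
by move/eqP; rewrite map_poly_eq0 (negPf f0).
Qed.

(** Here [t Q + P (X - u)] is [P] times an affine factor whose root lies on the real line through
    [u] along the field. So finitely many lines form an invariant set: the parallels to [m] through
    the roots of [P] if [l = 0], otherwise the lines joining the zero [u0] of the field to these
    roots. It meets [M], hence contains [M]. *)
Lemma linear_real_no_interior (P Q : {poly K[i]}) (M : set K[i]) (l : K) (m : K[i]) :
  P != 0 -> Q != 0 -> (1 < size P)%N || (1 < size Q)%N ->
  minimal_TCH P Q M -> Q = (l%:C *: 'X + m%:P) * P -> M° = set0.
Proof.
move=> P0 Q0 PQ Mmin QE.
have [rs PE] := closed_field_poly_normal P.
have rsP z : root P z = (z \in rs).
  by rewrite PE rootZ ?lead_coef_eq0 // root_prod_XsubC.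
have eqE u (t : K) : t%:C *: Q + P * ('X - u%:P) =
    P * ((t * l + 1)%:C *: 'X + (t%:C * m - u)%:P).
  have -> : (t * l + 1)%:C = t%:C * l%:C + 1 by rewrite rmorphD rmorphM.
  by rewrite QE -!mul_polyC !(polyCD, polyCN, polyCM, polyC1); ring.
have evalE u (t : K) z : root ((t * l + 1)%:C *: 'X + (t%:C * m - u)%:P) z ->
    (t * l + 1)%:C * z = u - t%:C * m.
  rewrite /root hornerD hornerZ hornerX hornerC => /eqP h.
  by apply/eqP; rewrite -subr_eq0 opprB addrC -h addrC.
have [[u Mu] /TCH_invariantP[cM iM] _] := Mmin.
suff [ls [ls0 lsI lsM]] : exists ls, [/\ forall l, l \in ls -> l.2 != 0,
    alg_invariant P Q (lines_union ls) & M `&` lines_union ls !=set0].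
  apply/seteqP; split => // z Mz.
  by rewrite -(lines_union_interior ls0); apply: interiorS Mz; exact: minimal_sub lsI lsM.
have [l0|l0] := eqVneq l 0.
  have m0 : m != 0.
    by apply: contraNneq Q0 => m0; rewrite QE l0 m0 scale0r add0r mul0r.
  have Ppos : (1 < size P)%N.
    move: PQ; rewrite QE l0 scale0r add0r mul_polyC size_scale // => /orP[] //.
  have [r rr] : exists r, root P r by apply/closed_rootP; rewrite gtn_eqF.
  exists [seq (a, m) | a <- rs]; split.
  - by move=> _ /mapP[a _ ->].
  - split; first exact: lines_union_closed.
    move=> x t [_ /mapP[a ars ->] /= Iu] t0; right=> z.
    rewrite eqE rootM => /orP[|/evalE]; first rewrite rsP => zrs.
      exists (z, m); first by apply/mapP; exists z.
      by rewrite subrr mul0r.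
    rewrite l0 mulr0 add0r mul1r => ->; exists (a, m); first by apply/mapP; exists a.
    rewrite /= addrAC mulrBl -mulrA mulJ ImD ImN Iu -rmorphM ImC subrr //.
  - have Mr : M r.
      have [h|h] := iM u 0 Mu (lexx _); last by apply: h; rewrite scale0r add0r rootM rr.
      by move/eqP: h; rewrite scale0r add0r mulf_eq0 (negPf P0) polyXsubC_eq0.
    exists r; split => //; exists (r, m); last by rewrite subrr mul0r.
    by apply/mapP; exists r; rewrite -?rsP.
pose u0 := - m / l%:C; have lC : l%:C != 0 by rewrite fmorph_eq0.
have mE : m = - (l%:C * u0) by rewrite /u0 mulrC divfK ?opprK.
have Mu0 : M u0.
  have [<-//|uu0] := eqVneq u u0.
  apply: cM; apply/closure_modP => e e0; pose N := mod (u - u0) / e.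
  have N0 : 0 <= N by rewrite divr_ge0 ?mod_ge0 ?ltW.
  (* [M] contains the points [u0 + (u - u0) / (t l + 1)], which tend to [u0] as [t] grows; this [t]
     gives [|t l + 1| >= N + 1], more than [|u - u0| / e]. *)
  pose t := (N + 2) / `|l|; have t0 : 0 <= t by rewrite divr_ge0 ?addr_ge0.
  have tl : N + 1 <= `|t * l + 1|.
    have tlN : `|t * l| = N + 2.
      by rewrite normrM ger0_norm // divfK // normr_eq0.
    have := ler_normB (t * l + 1) 1; rewrite addrK tlN normr1; lra.
  have tlp : 0 < `|t * l + 1| by lra.
  have tl0 : t * l + 1 != 0 by rewrite -normr_gt0.
  have tlC : (t * l + 1)%:C != 0 by rewrite fmorph_eq0.
  exists (u0 + ((t * l + 1)^-1)%:C * (u - u0)).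
    have [h|] := iM u t Mu t0.
      move/eqP: h; rewrite eqE mulf_eq0 (negPf P0) /= => /eqP h.
      have := coef0 K[i] 1; rewrite -h coefD coefZ coefX coefC mulr1 addr0 => /eqP.
      by rewrite (negPf tlC).
    apply; rewrite eqE rootM; apply/orP; right.
    have e1 : (t * l + 1)%:C * ((t * l + 1)^-1)%:C = 1 by rewrite -rmorphM divff.
    have e2 : (t * l + 1)%:C * (u0 + ((t * l + 1)^-1)%:C * (u - u0)) + (t%:C * m - u) = 0.
      rewrite mulrDr (mulrA (t * l + 1)%:C) e1 mul1r mE rmorphD rmorphM /=; ring.
    by apply/rootP; rewrite hornerD hornerZ hornerX hornerC; exact: e2.
  rewrite addrAC subrr add0r modM modC normfV mulrC ltr_pdivrMr //.
  by rewrite mulrC -ltr_pdivrMr //; rewrite -/N; lra.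
(* The line of direction 1 keeps [u0] in the union even if [P] has no root other than [u0]. *)
have rline z : root P z ->
    lines_union ((u0, 1) :: [seq (u0, a - u0) | a <- [seq a <- rs | a != u0]]) z.
  move=> rz; have [->|zu0] := eqVneq z u0.
    by exists (u0, 1); rewrite ?inE ?eqxx //= subrr mul0r.
  exists (u0, z - u0); last by rewrite /= mulJ ImC.
  by rewrite inE; apply/orP; right; apply/mapP; exists z; rewrite // mem_filter zu0 -rsP.
exists ((u0, 1) :: [seq (u0, a - u0) | a <- [seq a <- rs | a != u0]]); split.
- move=> v; rewrite inE => /orP[/eqP -> /=|/mapP[a]]; first exact: oner_neq0.
  by rewrite mem_filter => /andP[au0 _] ->; rewrite /= subr_eq0.
- split; first exact: lines_union_closed.
  have on (v : K[i] * K[i]) : v \in (u0, 1) :: [seq (u0, a - u0) | a <- [seq a <- rs | a != u0]] ->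
      v.1 = u0.
    by rewrite inE => /orP[/eqP -> //|/mapP[a _ ->]].
  (* For [t l = -1] the affine factor is the constant [u0 - x]: zero if [x = u0], without roots
     otherwise. *)
  move=> x t [v vls Ix] t0; have [tl|tl] := eqVneq (t * l + 1) 0.
    have [xu|xu] := eqVneq x u0.
      left; rewrite eqE tl scale0r add0r mE xu.
      have -> : t%:C * - (l%:C * u0) - u0 = - ((t * l + 1)%:C * u0).
        by rewrite rmorphD rmorphM /=; ring.
      by rewrite tl mul0r oppr0 mulr0.
    right=> z; rewrite eqE rootM => /orP[/rline //|/evalE].
    rewrite tl mul0r mE => h; case/eqP: xu.
    have -> : x = t%:C * - (l%:C * u0) by apply/eqP; rewrite -subr_eq0 -h.
    have -> : t%:C * - (l%:C * u0) = - ((t * l + 1)%:C * u0) + u0.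
      by rewrite rmorphD rmorphM /=; ring.
    by rewrite tl mul0r oppr0 add0r.
  right=> z; rewrite eqE rootM => /orP[/rline //|/evalE].
  move=> h; exists v => //; rewrite (on v vls) in Ix *.
  have tlC : (t * l + 1)%:C != 0 by rewrite fmorph_eq0.
  have -> : z - u0 = ((t * l + 1)^-1)%:C * (x - u0).
    have e1 : (t * l + 1)%:C * ((t * l + 1)^-1)%:C = 1 by rewrite -rmorphM divff.
    apply: (mulfI tlC); rewrite mulrA e1 mul1r mulrBr h mE.
    by rewrite rmorphD rmorphM /=; ring.
  by rewrite -mulrA ImMC Ix mulr0.
- by exists u0; split => //; exists (u0, 1); rewrite ?inE ?eqxx //= subrr mul0r.
Qed.

(** R' is a constant [l]: the interior of [M] excludes a real [l], and for any other [l] no point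
    satisfies the equation. *)
Lemma inflection_empty (P Q : {poly K[i]}) (M : set K[i]) :
  P != 0 -> Q != 0 -> (1 < size P)%N || (1 < size Q)%N ->
  minimal_TCH P Q M -> M° !=set0 -> num2 P Q = 0 -> inflection P Q = set0.
Proof.
move=> P0 Q0 PQ Mmin M0 B0.
have [l [m [QE lE]]] := num2_eq0_linear P0 Q0 B0.
have [Il|Il] := eqVneq (complex.Im l) 0.
  have lr : l = (complex.Re l)%:C by apply: complex_eqP.
  rewrite lr in QE; have := linear_real_no_interior P0 Q0 PQ Mmin QE.
  by move=> Me; move: M0; rewrite Me => -[].
rewrite /inflection (_ : [set z | _] = set0) ?closure0 //.
by apply/seteqP; split => // z [_]; case: (lE z) => _ -> /eqP; rewrite (negPf Il).
Qed.

End LinearField.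

(** * Trajectories *)

Section Picard.
Variable K : realType.

Lemma curve_cont_mod (g : K -> K[i]) (t e : K) : {for t, continuous g} -> 0 < e ->
  \forall s \near t, mod (g s - g t) < e.
Proof. exact: (@cvg_near_mod K K (nbhs t) _ g (g t) e). Qed.

Lemma mod_cont_curve (g : K -> K[i]) (t : K) :
  (forall e, 0 < e -> \forall s \near t, mod (g s - g t) < e) ->
  {for t, continuous g}.
Proof. by move=> h; apply/(@cvgCP _ _ (nbhs t) _ g). Qed.

Lemma geometric_le0 (b m : K) : (forall n, m <= b / 2 ^+ n) -> m <= 0.
Proof.
move=> h; rewrite leNgt; apply/negP => m0.
have b0 : 0 <= b by have := h 0%N; rewrite expr0 divr1; apply: le_trans; exact: ltW.
have bm : 0 <= b / m by rewrite divr_ge0 // ltW.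
pose n := Num.bound (b / m).
have h1 : b / m < n%:R by exact: archi_boundP.
have h2 : n%:R < 2 ^+ n :> K by rewrite -natrX ltr_nat ltn_expl.
have := h n; rewrite ler_pdivlMr ?exprn_gt0 // leNgt.
rewrite ltr_pdivrMr // in h1; rewrite (lt_trans h1) //.
by rewrite mulrC ltr_pM2l.
Qed.

(** The intervals of centre [u n] and radius [2 * a / 2 ^+ n] are nested, and the supremum of their
    left ends lies in all of them. *)
Lemma geometric_limit (u : nat -> K) (a : K) :
  (forall n, `|u n.+1 - u n| <= a / 2 ^+ n) ->
  exists l, forall n, `|l - u n| <= 2 * a / 2 ^+ n.
Proof.
move=> ua; pose e n := 2 * a / 2 ^+ n.
have eS n : e n.+1 = a / 2 ^+ n.
  by rewrite /e exprS invfM; field; rewrite expf_neq0.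
have e2 n : e n = a / 2 ^+ n + a / 2 ^+ n by rewrite /e; field; rewrite expf_neq0.
have e0 n : 0 <= e n.
  by have := ua n; have := normr_ge0 (u n.+1 - u n); rewrite e2; lra.
have lo n : u n - e n <= u n.+1 - e n.+1.
  by have := ua n; rewrite (e2 n) (eS n) ler_norml => /andP[]; lra.
have hi n : u n.+1 + e n.+1 <= u n + e n.
  by have := ua n; rewrite (e2 n) (eS n) ler_norml => /andP[]; lra.
have lom n k : u n - e n <= u (n + k)%N - e (n + k)%N.
  by elim: k => [|k IH]; rewrite ?addn0 // addnS (le_trans IH).
have him n k : u (n + k)%N + e (n + k)%N <= u n + e n.
  by elim: k => [|k IH]; rewrite ?addn0 // addnS (le_trans _ IH).
have lohi n m : u n - e n <= u m + e m.
  apply: le_trans (lom n m) _; rewrite addnC; apply: le_trans (him m n).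
  by have := e0 (m + n)%N; lra.
pose S := [set u n - e n | n in [set: nat]].
have S0 : S !=set0 by exists (u 0%N - e 0%N); exists 0%N.
exists (sup S) => n; rewrite ler_distl; apply/andP; split.
  apply: ub_le_sup; last by exists n.
  by exists (u 0%N + e 0%N) => _ [k _ <-].
by apply: sup_le_ub => // _ [k _ <-].
Qed.

Lemma primitive_exists (g : K -> K) (h : K) : 0 < h -> continuous g ->
  exists2 G : K -> K, G 0 = 0 & forall t : K, `|t| < h -> is_derive t 1 G (g t).
Proof.
move=> h0 gc.
pose F (x : K) := (\int[lebesgue_measure]_(t in `[(- h)%R, x]) g t)%R.
exists (fun x => F x - F 0); first by rewrite subrr.
move=> t th; move: (th); rewrite ltr_norml => /andP[t1 t2].
have int : lebesgue_measure.-integrable `[- h, h] (EFin \o g).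
  apply: continuous_compact_integrable; first exact: segment_compact.
  exact: continuous_subspaceT.
have [|dF FE] := continuous_FTC1 t2 int _ (gc t); first by rewrite /= lte_fin.
have dF' : is_derive t 1 F (g t) by apply: DeriveDef; [exact: dF|rewrite -derive1E].
by have := is_deriveB dF' (is_derive_cst (F 0) t 1); rewrite subr0.
Qed.

(** Projection onto [[-h, h]] for [h > 0]. Composing with it lets the Picard iterates be functions
    on the whole line. *)
Definition clamp (h t : K) : K := (`|t + h| - `|t - h|) / 2.

Lemma clamp_le (h t : K) : 0 < h -> `|clamp h t| <= h.
Proof.
move=> h0; rewrite normrM [`|2^-1|]ger0_norm // ler_pdivrMr //.
apply: le_trans (ler_dist_dist _ _) _.
have -> : t + h - (t - h) = h * 2 by ring.
by rewrite ger0_norm // mulr_ge0 // ltW.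
Qed.

Lemma clamp_id (h t : K) : `|t| <= h -> clamp h t = t.
Proof.
rewrite ler_norml => /andP[t1 t2]; rewrite /clamp ger0_norm; last by lra.
by rewrite ler0_norm; lra.
Qed.

Lemma clamp_continuous (h : K) : 0 < h -> continuous (clamp h).
Proof.
move=> h0 t; apply: dist_cont => e e0.
have lip (s : K) : `|clamp h s - clamp h t| <= `|s - t|.
  have -> : clamp h s - clamp h t =
      (`|s + h| - `|t + h|) / 2 + (`|t - h| - `|s - h|) / 2 by rewrite /clamp; field.
  apply: le_trans (ler_normD _ _) _; rewrite !normrM [`|2^-1|]ger0_norm //.
  have := ler_dist_dist (s + h) (t + h); have := ler_dist_dist (t - h) (s - h).
  have -> : t - h - (s - h) = - (s - t) by ring.
  have -> : s + h - (t + h) = s - t by ring.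
  by rewrite normrN; lra.
have := @cont_dist _ _ (id : K -> K) t e (@cvg_id _ _) e0.
by apply: filterS => s /ltW; apply: le_trans.
Qed.

(** The mean value theorem is applied to each component separately, whence the factor 2. *)
Lemma cder_bound (Y V : K -> K[i]) (B : K) (d : K) :
  (forall t : K, `|t| < d -> cder Y t (V t)) ->
  (forall t : K, `|t| < d -> mod (V t) <= B) ->
  forall t : K, `|t| < d -> mod (Y t - Y 0) <= 2 * B * `|t|.
Proof.
move=> YV VB t td.
have bnd (y v : K -> K) : (forall s : K, `|s| < d -> is_derive s 1 y (v s)) ->
    (forall s : K, `|s| < d -> `|v s| <= B) -> `|y t - y 0| <= B * `|t|.
  move=> yv vB.
  have dom (s : K) : Num.min 0 t <= s <= Num.max 0 t -> `|s| < d.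
    move: td; rewrite ge_min le_max !ltr_norml => /andP[t1 t2].
    by move=> /andP[/orP s1 /orP s2]; apply/andP; case: s1; case: s2; lra.
  have [t0|t0] := leP 0 t.
    have [c cI| |c /itvP cI ->] := @MVT_segment _ y v 0 t t0.
    - by apply: yv; apply: dom; move: cI; rewrite in_itv /= min_l // max_r // => /andP[/ltW -> /ltW ->].
    - apply: continuous_in_subspaceT => s /set_mem /=; rewrite in_itv /= => sI.
      by apply: is_derive_cont; apply: yv; apply: dom; rewrite min_l // max_r.
    - by rewrite subr0 normrM ler_wpM2r // vB // dom // min_l // max_r // !cI.
  have [c cI| |c /itvP cI e] := @MVT_segment _ y v t 0 (ltW t0).
  - by apply: yv; apply: dom; move: cI; rewrite in_itv /= (min_r (ltW t0)) (max_l (ltW t0)) => /andP[/ltW -> /ltW ->].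
  - apply: continuous_in_subspaceT => s /set_mem /=; rewrite in_itv /= => sI.
    by apply: is_derive_cont; apply: yv; apply: dom; rewrite (min_r (ltW t0)) (max_l (ltW t0)).
  - rewrite distrC e sub0r normrM normrN ler_wpM2r // vB // dom //.
    by rewrite (min_r (ltW t0)) (max_l (ltW t0)) !cI.
apply: le_trans (mod_le_ReIm _) _; rewrite ReD ImD ReN ImN.
have -> : 2 * B * `|t| = B * `|t| + B * `|t| by ring.
apply: lerD; [apply: (bnd (fun s => complex.Re (Y s)) (fun s => complex.Re (V s)))|
  apply: (bnd (fun s => complex.Im (Y s)) (fun s => complex.Im (V s)))] => s sd.
- by have [] := YV s sd.
- exact: le_trans (Re_le_mod _) (VB s sd).
- by have [] := YV s sd.
- exact: le_trans (Im_le_mod _) (VB s sd).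
Qed.

Variables (f : K[i] -> K[i]) (z : K[i]) (r L C : K).
Hypotheses (r0 : 0 < r) (L0 : 0 < L) (C0 : 0 < C).
Hypothesis f_lip : forall w w', mod (w - z) <= r -> mod (w' - z) <= r ->
  mod (f w - f w') <= L * mod (w - w').
Hypothesis f_bnd : forall w, mod (w - z) <= r -> mod (f w) <= C.

(** [2 * C * h <= r] keeps the iterates in the ball and [2 * L * h <= 1 / 2] makes a step halve
    distances; the factors 2 are those of [cder_bound]. *)
Let h : K := Num.min (r / (2 * C)) (1 / (4 * L)).

Let h0 : 0 < h.
Proof. by rewrite lt_min !divr_gt0 ?mulr_gt0. Qed.

Let hC : 2 * C * h <= r.
Proof. by rewrite mulrC -ler_pdivlMr ?mulr_gt0 // ge_min lexx. Qed.

Let hL : 2 * L * h <= 1 / 2.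
Proof.
have : h <= 1 / (4 * L) by rewrite ge_min lexx orbT.
by rewrite ler_pdivlMr ?mulr_gt0 //; lra.
Qed.

Let admissible (x : K -> K[i]) : Prop :=
  (forall t, {for t, continuous x}) /\ forall t, mod (x t - z) <= r.

Let f_cont (x : K -> K[i]) : admissible x -> forall t, {for t, continuous (fun t => f (x t))}.
Proof.
move=> [xc xr] t; apply: mod_cont_curve => e e0.
have Le : 0 < e / L by rewrite divr_gt0.
apply: filterS (curve_cont_mod (xc t) Le) => s hs.
by apply: le_lt_trans (f_lip (xr s) (xr t)) _; rewrite mulrC -ltr_pdivlMr.
Qed.

Let primitiveC (v : K -> K[i]) : (forall t, {for t, continuous v}) ->
  exists2 V : K -> K[i], V 0 = 0 & forall t : K, `|t| < 2 * h -> cder V t (v t).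
Proof.
move=> vc; have h20 : 0 < 2 * h by rewrite mulr_gt0.
have [A A0 dA] := primitive_exists h20 (fun t => continuous_Re (vc t)).
have [B B0 dB] := primitive_exists h20 (fun t => continuous_Im (vc t)).
exists (fun t => A t +i* B t); first by rewrite A0 B0.
by move=> t th; split; [exact: dA|exact: dB].
Qed.

(** One Picard iteration: [V] is the primitive of [f (x t)]. It is taken on an interval twice as
    long, so that it is differentiable up to the ends of [[-h, h]]. *)
Let step (x y : K -> K[i]) : Prop :=
  exists V : K -> K[i], [/\ V 0 = 0,
    forall t : K, `|t| < 2 * h -> cder V t (f (x t)) &
    forall t, y t = z + V (clamp h t)].

Let clamp2 (t : K) : `|clamp h t| < 2 * h.
Proof. by have := clamp_le t h0; have := h0; lra. Qed.

Let step_exists (x : K -> K[i]) : admissible x -> exists2 y, step x y & admissible y.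
Proof.
move=> ax; have [V V0 dV] := primitiveC (f_cont ax).
have yr t : mod (z + V (clamp h t) - z) <= r.
  have := cder_bound dV (fun t _ => f_bnd (ax.2 t)) (clamp2 t).
  rewrite V0 subr0 addrAC subrr add0r => /le_trans; apply; apply: le_trans hC.
  by rewrite ler_pM2l ?mulr_gt0 // clamp_le.
exists (fun t => z + V (clamp h t)); first by exists V.
split => [t|t]; last exact: yr.
apply: contC_D; first exact: contC_cst.
apply: (@continuous_comp _ _ _ (clamp h) V t); first exact: (clamp_continuous h0).
exact: cder_cont (dV _ (clamp2 t)).
Qed.

Let step_contract (x x' y y' : K -> K[i]) (d : K) : admissible x -> admissible x' ->
  step x y -> step x' y' -> (forall t, mod (x t - x' t) <= d) ->
  forall t, mod (y t - y' t) <= d / 2.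
Proof.
move=> ax ax' [V [V0 dV yE]] [V' [V'0 dV' y'E]] xd t.
have d0 : 0 <= d := le_trans (mod_ge0 _) (xd 0).
have dW (s : K) : `|s| < 2 * h -> cder (fun s => V s - V' s) s (f (x s) - f (x' s)).
  by move=> sh; apply: cderD; [exact: dV|apply: cderN; exact: dV'].
have bW (s : K) : `|s| < 2 * h -> mod (f (x s) - f (x' s)) <= L * d.
  by move=> _; rewrite (le_trans (f_lip (ax.2 s) (ax'.2 s))) // ler_pM2l.
have := cder_bound dW bW (clamp2 t); rewrite V0 V'0 !subr0 yE y'E.
have -> : z + V (clamp h t) - (z + V' (clamp h t)) = V (clamp h t) - V' (clamp h t) by ring.
move=> /le_trans; apply.
have c1 := clamp_le t h0.
have : L * d * `|clamp h t| <= L * d * h by rewrite ler_wpM2l // mulr_ge0 // ltW.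
have : d * (2 * L * h) <= d * (1 / 2) by rewrite ler_wpM2l.
lra.
Qed.

Let Re_diff (w w' : K[i]) (b : K) : mod (w - w') <= b ->
  `|complex.Re w - complex.Re w'| <= b.
Proof. by apply: le_trans; rewrite -ReN -ReD Re_le_mod. Qed.

Let Im_diff (w w' : K[i]) (b : K) : mod (w - w') <= b ->
  `|complex.Im w - complex.Im w'| <= b.
Proof. by apply: le_trans; rewrite -ImN -ImD Im_le_mod. Qed.

Lemma picard : exists2 d : K, 0 < d & exists2 c : K -> K[i], c 0 = z &
  forall t : K, `|t| < d -> cder c t (f (c t)).
Proof.
have next (x : {x : K -> K[i] | admissible x}) :
    exists y : {y : K -> K[i] | admissible y}, step (sval x) (sval y).
  by have [y xy ay] := step_exists (svalP x); exists (exist _ y ay).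
have [F FP] := choice next.
have a0 : admissible (fun=> z).
  by split => t; [exact: contC_cst|rewrite subrr mod0 ltW].
pose x n := iter n F (exist _ (fun=> z) a0).
have xS n : step (sval (x n)) (sval (x n.+1)) by exact: FP.
have xa n := svalP (x n).
have xd n t : mod (sval (x n.+1) t - sval (x n) t) <= r / 2 ^+ n.
  elim: n t => [|n IH] t; first by rewrite expr0 divr1; exact: (xa 1%N).2.
  have := step_contract (xa n.+1) (xa n) (xS n.+1) (xS n) IH t.
  by rewrite (_ : r / 2 ^+ n / 2 = r / 2 ^+ n.+1) // exprS; field; rewrite expf_neq0.
have lim t : exists l : K[i], forall n, mod (l - sval (x n) t) <= 4 * r / 2 ^+ n.
  have [a aP] := @geometric_limit (fun n => complex.Re (sval (x n) t)) r
    (fun n => Re_diff (xd n t)).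
  have [b bP] := @geometric_limit (fun n => complex.Im (sval (x n) t)) r
    (fun n => Im_diff (xd n t)).
  exists (a +i* b) => n; apply: le_trans (mod_le_ReIm _) _.
  rewrite ReD ImD ReN ImN /= (_ : 4 * r / 2 ^+ n = 2 * r / 2 ^+ n + 2 * r / 2 ^+ n).
    exact: lerD.
  by field; rewrite expf_neq0.
have [c cP] := choice lim; exists h => //.
have small (w w' : K[i]) (b : K) : (forall n, mod (w - w') <= b / 2 ^+ n) -> w = w'.
  move=> /geometric_le0 wb; apply/eqP; rewrite -subr_eq0 -mod_eq0.
  by apply/eqP/le_anti; rewrite wb mod_ge0.
have c0 : c 0 = z.
  apply: (small _ _ (4 * r)) => n; have := cP 0 n.
  suff -> : sval (x n) 0 = z by [].
  case: n => [//|n]; have [V [V0 _ ->]] := xS n.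
  by rewrite clamp_id ?normr0 ?ltW // V0 addr0.
have ac : admissible c.
  split=> t.
    apply: mod_cont_curve => e e0.
    have [n nP] : exists n, 4 * r / 2 ^+ n < e / 3.
      apply: contrapT => H; have : e / 3 <= 0.
        by apply: (@geometric_le0 (4 * r)) => n; rewrite leNgt; apply/negP => ?; apply: H; exists n.
      by rewrite leNgt divr_gt0.
    have e3 : 0 < e / 3 by rewrite divr_gt0.
    apply: filterS (curve_cont_mod ((xa n).1 t) e3) => s hs.
    have -> : c s - c t = (c s - sval (x n) s) + (sval (x n) s - sval (x n) t) +
        (sval (x n) t - c t) by ring.
    have := modD (c s - sval (x n) s + (sval (x n) s - sval (x n) t)) (sval (x n) t - c t).
    have := modD (c s - sval (x n) s) (sval (x n) s - sval (x n) t).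
    have := cP s n; have := cP t n; rewrite (modB (c t)); lra.
  rewrite -subr_le0; apply: (@geometric_le0 (4 * r)) => n.
  have := cP t n; have := (xa n).2 t; have := modD (c t - sval (x n) t) (sval (x n) t - z).
  rewrite addrA subrK; lra.
have [y yS ya] := step_exists ac.
have yc t : y t = c t.
  apply: (small _ _ (4 * r)) => n.
  have h1 := step_contract ac (xa n) yS (xS n) (fun t => cP t n) t.
  have h2 := cP t n.+1; have h3 := modD (y t - sval (x n.+1) t) (sval (x n.+1) t - c t).
  move: h2 h3; rewrite addrA subrK (modB (c t)) exprS => h2 h3.
  have e1 : 4 * r / (2 * 2 ^+ n) = 4 * r / 2 ^+ n / 2 by field; rewrite expf_neq0.
  by rewrite e1 in h2; lra.
(* The limit is a fixed point of [step], so it has the form [z + V (clamp h t)]; where [clamp] is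
   the identity, its derivative is that of [V]. *)
exists c => // t th; have [V [V0 dV yE]] := yS.
have -> : c = fun t => z + V (clamp h t) by apply/funext => s; rewrite -yc yE.
have dt : cder (fun t => z + V t) t (f (c t)).
  rewrite -[f (c t)]add0r; apply: cderD (cder_cst _ _) (dV t _).
  by have := h0; lra.
have <- : c t = z + V (clamp h t) by rewrite -yc yE.
apply: cder_near dt; have := near_norm_lt th; apply: filterS => s sh.
by rewrite clamp_id // ltW.
Qed.

End Picard.

(** * The barrier *)

Section GraphBarrier.
Variable K : realType.
Variables (s : K -> K -> K) (g : K -> K) (N : K -> K -> Prop) (b L : K).
Hypotheses (b_gt0 : 0 < b) (L_gt0 : 0 < L).
Hypothesis s_lip : forall x y x' y', `|x| <= b -> `|y| <= b -> `|x'| <= b ->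
  `|y'| <= b -> `|s x y - s x' y'| <= L * (`|x - x'| + `|y - y'|).
Hypothesis s00 : s 0 0 = 0.
Hypothesis s_base : forall x, 0 <= x <= b -> 0 <= s x 0.
Hypothesis g0 : g 0 = 0.
Hypothesis g_lip : forall x y, `|x| <= b -> `|y| <= b -> `|g x - g y| <= `|x - y|.
Hypothesis g_tan : forall x y, `|x| <= b -> `|y| <= b -> x <= y ->
  s x (g x) * (y - x) <= g y - g x.
Hypothesis N_closed : forall x y, ~ N x y -> exists2 e : K, 0 < e &
  forall x' y', `|x' - x| < e -> `|y' - y| < e -> ~ N x' y'.
Hypothesis N_ray : forall x y t, `|x| <= b -> `|y| <= b -> 0 <= t -> ~ N x y ->
  ~ N (x + t) (y + t * s x y).
Hypothesis g_out : forall x, 0 < x <= b -> ~ N x (g x).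
Hypothesis base_out : forall x, 0 < x -> ~ N x 0.
Hypothesis ray_far : forall t0 : K, 0 < t0 -> exists2 r : K, 0 < r &
  forall x y t, `|x| < r -> `|y| < r -> t0 <= t -> ~ N (x + t) (y + t * s x y).

Let g_le x : `|x| <= b -> `|g x| <= `|x|.
Proof.
move=> xb; have := @g_lip x 0 xb; rewrite normr0 g0 !subr0; apply; exact: ltW.
Qed.

Let g_ge0 x : 0 <= x <= b -> 0 <= g x.
Proof.
move=> /andP[x0 xb]; have := @g_tan 0 x; rewrite normr0 ger0_norm // g0 s00 mul0r subr0.
by apply => //; exact: ltW.
Qed.

(** At abscissa [x] the ray issued from the point of the graph over [u] has height [h u], which
    moves continuously from 0 at [u = 0] to [g x] at [u = x]. *)
Let below_graph_out x y : 0 < x <= b -> 0 <= y <= g x -> ~ N x y.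
Proof.
move=> /andP[x0 xb] /andP[y0 yg].
have B (u : K) : 0 <= u <= x -> `|u| <= b by move=> /andP[u0 ux]; rewrite ger0_norm // (le_trans ux).
have Bg (u : K) : 0 <= u <= x -> `|g u| <= b.
  by move=> ux; apply: le_trans (g_le (B u ux)) (B u ux).
pose h u := g u + s u (g u) * (x - u).
have ct : {within `[0, x], continuous h}.
  apply/subspace_continuousP => u /=; rewrite in_itv /= => ux.
  have cg : g @ within `[0, x] (nbhs u) --> g u.
    apply/cvgrPdist_lt => e e0; rewrite near_withinE; near=> w.
    rewrite /= in_itv /= => wx; apply: le_lt_trans (g_lip (B u ux) (B w wx)) _.
    by near: w; exact: nbhsx_ballx.
  have cs : (fun w => s w (g w)) @ within `[0, x] (nbhs u) --> s u (g u).
    apply/cvgrPdist_lt => e e0; rewrite near_withinE; near=> w.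
    rewrite /= in_itv /= => wx.
    apply: le_lt_trans (s_lip (B u ux) (Bg u ux) (B w wx) (Bg w wx)) _.
    have gl := g_lip (B u ux) (B w wx).
    have : `|u - w| < e / (2 * L) by near: w; apply: nbhsx_ballx; rewrite divr_gt0 // mulr_gt0.
    rewrite ltr_pdivlMr ?mulr_gt0 // => H; apply: le_lt_trans H.
    rewrite [leRHS]mulrC [2 * L]mulrC -mulrA ler_wpM2l ?(ltW L_gt0) //; lra.
  apply: cvgD => //; apply: cvgM => //; apply: cvgB; first exact: cvg_cst.
  exact: cvg_within.
have [|u] := @IVT _ h 0 x y (ltW x0) ct.
  rewrite /h g0 s00 mul0r addr0 subrr mulr0 addr0.
  by rewrite ge_min le_max y0 yg orbT.
rewrite in_itv /= => ux hu; case/andP: (ux) => u0 u1.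
have [e|un] := eqVneq u 0.
  by move: hu; rewrite /h e g0 s00 mul0r addr0 => <-; exact: base_out.
have up : 0 < u by rewrite lt_neqAle eq_sym un.
have := @N_ray u (g u) (x - u) (B u ux) (Bg u ux).
rewrite subr_ge0 => /(_ u1); rewrite addrCA subrr addr0 [_ * s _ _]mulrC.
rewrite -[g u + _]/(h u) hu; apply; apply: g_out; rewrite up; exact: le_trans xb.
Unshelve. all: by end_near.
Qed.

(** Compactness makes the preceding exclusion uniform. Writing heights as fractions of [g x] turns
    the region into a rectangle, and [e <= x] stays away from the origin, which is not excluded. *)
Let strip_out (e a : K) : 0 < e -> e <= a -> a <= b -> exists2 k : K, 0 < k &
  forall x y, e <= x <= a -> - k <= y <= g x + k -> ~ N x y.
Proof.
move=> e0 ea ab.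
have cK : compact (`[e, a] `*` `[0, 1] : set (K * K)).
  by apply: compact_setX; exact: segment_compact.
pose P (k : K) (w : K * K) := e <= w.1 <= a -> 0 <= w.2 <= 1 ->
  forall y, `|y - w.2 * g w.1| <= k -> ~ N w.1 y.
have H : forall w, (`[e, a] `*` `[0, 1] : set (K * K)) w ->
    \forall w' \near w & k \near (0 : K)^'+, P k w'.
  move=> [x th] [/=]; rewrite !in_itv /= => /andP[x1 x2] /andP[t1 t2].
  have xb : `|x| <= b by rewrite ger0_norm; lra.
  have gx : 0 <= g x by apply: g_ge0; lra.
  have nN : ~ N x (th * g x).
    apply: below_graph_out; first lra.
    by rewrite mulr_ge0 //= -[leRHS]mul1r ler_wpM2r.
  have [d d0 dP] := N_closed nN.
  pose c := d / (4 * (1 + b)); have b4 : 0 < 4 * (1 + b) by rewrite mulr_gt0 //; lra.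
  have c0 : 0 < c by rewrite divr_gt0.
  have cE : c * (4 * (1 + b)) = d by rewrite /c divfK // gt_eqF.
  have cb : 0 <= c * b by rewrite mulr_ge0 // ltW.
  exists (ball (x, th) c, [set k | k < c]).
    split; first exact: nbhsx_ballx.
    by apply: nbhs_right_lt.
  move=> [[x' th'] k] [/= [/= bx bt] kc]; rewrite /P /= => /andP[x1' x2'] /andP[t1' t2'] y yk.
  move: bx bt; rewrite /ball /= => bx bt.
  have xb' : `|x'| <= b by rewrite ger0_norm; lra.
  have gl := g_lip xb xb'; have gxb := le_trans (g_le xb) xb.
  apply: dP; first by rewrite distrC; lra.
  have -> : y - th * g x = (y - th' * g x') + (th' * (g x' - g x) + (th' - th) * g x) by ring.
  have h1 : `|th' * (g x' - g x)| <= c.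
    rewrite normrM ger0_norm // -[leRHS]mul1r ler_pM // distrC; lra.
  have h2 : `|(th' - th) * g x| <= c * b by rewrite normrM ler_pM // distrC; lra.
  have h3 := ler_normD (y - th' * g x') (th' * (g x' - g x) + (th' - th) * g x).
  have h4 := ler_normD (th' * (g x' - g x)) ((th' - th) * g x).
  lra.
have : \forall k \near (0 : K)^'+, (`[e, a] `*` `[0, 1] : set (K * K)) `<=` P k.
  by move/compact_near_coveringP: cK => /(_ _ _ P _ H).
move=> nk; have [k [k0 kP]] : exists k : K, 0 < k /\ (`[e, a] `*` `[0, 1] : set (K * K)) `<=` P k.
  apply: (@filter_ex _ ((0 : K)^'+)); near=> k; split; near: k => //.
  exact: nbhs_right_gt.
exists k => // x y /andP[x1 x2] /andP[y1 y2].
have xb : `|x| <= b by rewrite ger0_norm; lra.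
have gx : 0 <= g x by apply: g_ge0; lra.
have main (th : K) : 0 <= th <= 1 -> `|y - th * g x| <= k -> ~ N x y.
  move=> t01; have tI := t01; case/andP: tI => t1 t2.
  apply: (kP (x, th)) => //=; last by rewrite x1 x2.
  by split => /=; rewrite in_itv /= ?x1 ?x2 ?t1 ?t2.
have [yl|yl] := leP y 0.
  by apply: (main 0); rewrite ?lexx ?ler01 // mul0r subr0 ler0_norm //; lra.
have [yg|yg] := leP (g x) y.
  by apply: (main 1); rewrite ?lexx ?ler01 // mul1r ger0_norm; lra.
have gp : 0 < g x by lra.
apply: (main (y / g x)); last by rewrite divfK ?gt_eqF // subrr normr0 ltW.
by rewrite divr_ge0 ?(ltW yl) //= ler_pdivrMr // mul1r ltW.
Unshelve. all: by end_near.
Qed.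

(** [W] is the part [- nu / 2 < x < eta] of a band of margin [D] around the region between base and
    graph. Up to [x = a] a ray cannot cross the sides of the band, as [D] grows faster than rays
    deviate ([key]), so it leaves [W] only through [x = eta]. From there to [a] the band avoids [N]
    by [strip_out], and beyond [a] the ray avoids it by [ray_far]. *)
Lemma graph_barrier (ep : K) : 0 < ep -> exists W : K -> K -> Prop,
  [/\ W 0 0, forall x y, W x y -> `|x| < ep /\ `|y| < ep,
   forall x y, W x y -> exists2 e : K, 0 < e &
     forall x' y', `|x' - x| < e -> `|y' - y| < e -> W x' y' &
   forall x y t, W x y -> 0 <= t -> N (x + t) (y + t * s x y) ->
     W (x + t) (y + t * s x y)].
Proof.
move=> ep0.
have [a [a0 a1 a2 a3]] : exists a : K, [/\ 0 < a, 4 * a <= b, 8 * (L * a) <= 1 & 4 * a <= ep].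
  have p8 : 0 < 8 * L by rewrite mulr_gt0.
  exists (Num.min (b / 4) (Num.min (1 / (8 * L)) (ep / 4))).
  set m := Num.min _ _; have m1 : m <= b / 4 by rewrite ge_min lexx.
  have m2 : m <= 1 / (8 * L) by rewrite ge_min ge_min lexx orbT.
  have m3 : m <= ep / 4 by rewrite ge_min ge_min lexx !orbT.
  split; [|lra| |lra].
    by rewrite lt_min lt_min !divr_gt0.
  by move: m2; rewrite ler_pdivlMr //; lra.
have [r r0 far] : exists2 r : K, 0 < r &
    forall x y t, `|x| < r -> `|y| < r -> a / 4 <= t -> ~ N (x + t) (y + t * s x y).
  by apply: ray_far; lra.
pose eta := Num.min (a / 4) (r / 4).
have [et0 et1 et2] : [/\ 0 < eta, eta <= a / 4 & eta <= r / 4].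
  by rewrite /eta lt_min !ge_min !lexx orbT; split => //; rewrite !divr_gt0.
have [k k0 out] := @strip_out eta a et0 (ltac:(lra)) (ltac:(lra)).
have [nu [n0 n1 n2 n3]] : exists nu : K, [/\ 0 < nu, nu <= k / 2, nu <= eta & 2 * L * nu <= 1].
  have p2 : 0 < 2 * L by rewrite mulr_gt0.
  exists (Num.min (k / 2) (Num.min eta (1 / (2 * L)))).
  set m := Num.min _ _; have m1 : m <= k / 2 by rewrite ge_min lexx.
  have m2 : m <= 1 / (2 * L) by rewrite ge_min ge_min lexx !orbT.
  have m3 : m <= eta by rewrite ge_min ge_min lexx !orbT.
  split; [|lra|lra|].
    by rewrite lt_min lt_min et0 !divr_gt0.
  by move: m2; rewrite ler_pdivlMr //; lra.
(* The growth rate [2 * L * nu] is [L * (nu / 2) + L * (3 / 2 * nu)]: the slope on the base is at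
   least [- L * (nu / 2)] for [x > - nu / 2], and outside the region the distance to base or graph,
   less than [D x <= 3 / 2 * nu], accounts for the rest. *)
pose D x := nu * (1 + 2 * L * (x + nu / 2)).
have Ln0 : 0 < L * nu by rewrite mulr_gt0.
have DB (x : K) : - (nu / 2) <= x <= a -> nu <= D x <= 3 / 2 * nu.
  move=> /andP[x1 x2]; rewrite /D.
  have h1 : 0 <= L * nu * (x + nu / 2) by rewrite mulr_ge0 //; lra.
  have h2 : 0 <= nu * (1 - 8 * (L * a)) by rewrite mulr_ge0 //; lra.
  have h3 : 0 <= L * nu * (2 * a - (x + nu / 2)) by rewrite mulr_ge0 //; lra.
  lra.
have DD x t : D (x + t) = D x + 2 * (L * nu * t) by rewrite /D; ring.
have key (x y t : K) : - (nu / 2) < x -> - D x < y < g x + D x -> 0 <= t -> x + t < a ->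
    - D (x + t) < y + t * s x y < g (x + t) + D (x + t).
  move=> x1 /andP[y1 y2] t0 xt.
  have /andP[d1 d2] := DB x (ltac:(lra)).
  have xa : `|x| <= a by rewrite ler_norml; lra.
  have xb : `|x| <= b by lra.
  have xtb : `|x + t| <= b by rewrite ler_norml; lra.
  have gx := g_le xb; have gxb : `|g x| <= b by lra.
  have yb : `|y| <= b by move: gx; rewrite !ler_norml => /andP[? ?]; lra.
  have B0 : `|0 : K| <= b by rewrite normr0 ltW.
  have tL : L * t <= 1 / 2.
    have ta : 0 <= 2 * a - t by lra.
    have : 0 <= L * (2 * a - t) by rewrite mulr_ge0 // ltW.
    lra.
  have tL0 : 0 <= L * t by rewrite mulr_ge0 // ltW.
  have gt := g_tan xb xtb (ltac:(lra)).
  have l1 := s_lip xb yb xb gxb; rewrite subrr normr0 add0r in l1.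
  have l2 := s_lip xb yb xb B0; rewrite subrr normr0 add0r subr0 in l2.
  have base : - (L * (nu / 2)) <= s x 0.
    have [x0|x0] := leP 0 x.
      have : 0 <= s x 0 by apply: s_base; move: xb; rewrite ger0_norm // x0.
      lra.
    have := s_lip xb B0 B0 B0; rewrite s00 subrr normr0 !subr0 addr0 (ltr0_norm x0).
    rewrite ler_norml => /andP[h _].
    have : 0 <= L * (nu / 2 + x) by rewrite mulr_ge0 ?(ltW L_gt0) //; lra.
    lra.
  rewrite DD; apply/andP; split.
    have h1 : t * (s x 0 - L * `|y|) <= t * s x y.
      by rewrite ler_wpM2l //; move: l2; rewrite ler_norml => /andP[? ?]; lra.
    have h2 : t * (- (L * (nu / 2))) <= t * s x 0 by rewrite ler_wpM2l.
    have [y0|y0] := leP y 0.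
      rewrite (ler0_norm y0) in h1.
      have : 0 <= (L * t) * (2 * nu - nu / 2 + y) by rewrite mulr_ge0 //; lra.
      lra.
    rewrite (gtr0_norm y0) in h1.
    have : 0 <= (1 - L * t) * y by rewrite mulr_ge0 //; lra.
    have : 0 <= L * nu * t by rewrite mulr_ge0 // ltW.
    lra.
  have h1 : t * s x y <= t * (s x (g x) + L * `|y - g x|).
    by rewrite ler_wpM2l //; move: l1; rewrite ler_norml => /andP[? ?]; lra.
  have gt' : t * s x (g x) <= g (x + t) - g x by move: gt; rewrite addrC addrA addNr add0r mulrC.
  have [y0|y0] := leP 0 (y - g x).
    rewrite (ger0_norm y0) in h1.
    have : 0 <= (L * t) * (2 * nu - (y - g x)) by rewrite mulr_ge0 //; lra.
    lra.
  rewrite (ltr0_norm y0) in h1.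
  have : 0 <= (1 - L * t) * (- (y - g x)) by rewrite mulr_ge0 //; lra.
  have : 0 <= L * nu * t by rewrite mulr_ge0 // ltW.
  lra.
exists (fun x y => - (nu / 2) < x < eta /\ - D x < y < g x + D x); split.
- split; first lra.
  by rewrite g0; have := DB 0 (ltac:(lra)); lra.
- move=> x y [/andP[x1 x2] /andP[y1 y2]].
  have /andP[d1 d2] := DB x (ltac:(lra)).
  have xa : `|x| <= a by rewrite ler_norml; lra.
  have xb : `|x| <= b by lra.
  have := g_le xb; rewrite ler_norml => /andP[? ?].
  by split; [lra|rewrite ltr_norml; lra].
- move=> x y [/andP[x1 x2] /andP[y1 y2]].
  pose e := Num.min (Num.min (x + nu / 2) (eta - x)) (Num.min ((y + D x) / 4) ((g x + D x - y) / 4)).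
  have e0 : 0 < e by rewrite /e !lt_min; do ?[apply/andP; split]; lra.
  have e1 : e <= x + nu / 2 by rewrite /e !ge_min lexx.
  have e2 : e <= eta - x by rewrite /e !ge_min lexx orbT.
  have e3 : e <= (y + D x) / 4 by rewrite /e !ge_min lexx !orbT.
  have e4 : e <= (g x + D x - y) / 4 by rewrite /e !ge_min lexx !orbT.
  exists e => // x' y'; rewrite !ltr_norml => /andP[p1 p2] /andP[q1 q2].
  have xb : `|x| <= b by rewrite ler_norml; lra.
  have xb' : `|x'| <= b by rewrite ler_norml; lra.
  have gl : `|g x - g x'| <= e by apply: le_trans (g_lip xb xb') _; rewrite ler_norml; lra.
  have Dl : `|D x' - D x| <= e.
    have -> : D x' - D x = (2 * L * nu) * (x' - x) by rewrite /D; ring.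
    rewrite normrM ger0_norm; last lra.
    by rewrite -[leRHS]mul1r ler_pM ?normr_ge0 //; [lra|rewrite ler_norml; lra].
  by move: gl Dl; rewrite !ler_norml => /andP[? ?] /andP[? ?]; split; lra.
- move=> x y t [/andP[x1 x2] y12] t0 Nt.
  have [xa|xa] := ltP (x + t) a.
    have := key x y t x1 y12 t0 xa => /andP[k1 k2].
    have [xe|xe] := ltP (x + t) eta; first by split; [lra|rewrite k1 k2].
    have /andP[d1 d2] := DB (x + t) (ltac:(lra)).
    by case: (out (x + t) (y + t * s x y)) => //; lra.
  case/andP: y12 => y1 y2.
  have /andP[d1 d2] := DB x (ltac:(lra)).
  have xb : `|x| <= b by rewrite ler_norml; lra.
  have xe : `|x| <= eta by rewrite ler_norml; lra.
  have := g_le xb; rewrite ler_norml => /andP[? ?].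
  by case: (far x y t) => //; [lra|rewrite ltr_norml; lra|lra].
Qed.

End GraphBarrier.

Lemma nonneg_deriv_mono (K : realType) (g dg : K -> K) (a b : K) : a <= b ->
  (forall t, a <= t <= b -> is_derive t 1 g (dg t)) ->
  (forall t, a <= t <= b -> 0 <= dg t) -> g a <= g b.
Proof.
move=> ab gd d0; have ct : {within `[a, b], continuous g}.
  apply: continuous_in_subspaceT => t /set_mem /=; rewrite in_itv /= => tab.
  by apply: is_derive_cont; exact: gd.
have [t|c] := @MVT_segment _ g dg a b ab _ ct.
  by rewrite in_itv /= => /andP[t1 t2]; apply: gd; rewrite !ltW.
rewrite in_itv /= => cab e.
by rewrite -subr_ge0 e mulr_ge0 ?d0 // subr_ge0.
Qed.

Section Barrier.
Variable K : realType.
Variables (f : K[i] -> K[i]) (M : set K[i]) (c : K -> K[i]) (h rho La : K).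
Hypotheses (h_gt0 : 0 < h) (rho_gt0 : 0 < rho) (La_gt0 : 0 < La).
Hypothesis f0 : f 0 = 1.
Hypothesis f_lip : forall w w', mod w <= rho -> mod w' <= rho ->
  mod (f w - f w') <= La * mod (w - w').
Hypothesis c0 : c 0 = 0.
Hypothesis c_der : forall t : K, `|t| < h -> cder c t (f (c t)).
Hypothesis c_convex : forall s t : K, `|s| < h -> `|t| < h -> s <= t ->
  0 <= complex.Im (f (c t) * (f (c s))^*).
Hypothesis f_base : forall x : K, 0 <= x < h -> 0 <= complex.Im (f x%:C).
Hypothesis M_closed : closed M.
Hypothesis M_ray : forall w (t : K), ~ M w -> 0 <= t -> ~ M (w + t%:C * f w).
Hypothesis c_out : forall t : K, 0 < t < h -> c t <> 0 -> ~ M (c t).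
Hypothesis ray_out : forall t : K, 0 < t -> ~ M t%:C.
Hypothesis ray_far : forall t0 : K, 0 < t0 -> exists2 r : K, 0 < r &
  forall w (t : K), mod w < r -> t0 <= t -> ~ M (w + t%:C * f w).

Let sigma w : K := complex.Im (f w) / complex.Re (f w).

Lemma small_field : exists r : K, [/\ 0 < r, r <= rho & forall w, mod w <= r ->
  [/\ 3 / 4 <= complex.Re (f w), complex.Re (f w) <= 5 / 4 & `|complex.Im (f w)| <= 1 / 4]].
Proof.
exists (Num.min rho (1 / (4 * La))); split.
- by rewrite lt_min rho_gt0 divr_gt0 // mulr_gt0.
- by rewrite ge_min lexx.
- move=> w; rewrite le_min => /andP[wr wL].
  have d : mod (f w - 1) <= 1 / 4.
    rewrite -f0; apply: le_trans (f_lip wr _) _; first by rewrite mod0 ltW.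
    rewrite subr0.
    have h4 : 0 < 4 * La by rewrite mulr_gt0.
    by rewrite ler_pdivlMr // in wL; lra.
  have := le_trans (Re_le_mod _) d; have := le_trans (Im_le_mod _) d.
  rewrite ReD ReN ImD ImN /= oppr0 addr0 => hI; rewrite ler_norml => /andP[h1 h2].
  by split; [lra|lra|exact: hI].
Qed.

(** The real part of the trajectory increases at rate at least 3/4, and its inverse [T] turns the
    trajectory into a graph. The tangent inequality is convexity: for [fs] the field at an earlier
    time, [Re fs * Im (c t) - Im fs * Re (c t)] has as derivative the imaginary part of [f (c t)]
    times the conjugate of [fs]. *)
Lemma graph_exists : exists (A : K) (g : K -> K), [/\ 0 < A, g 0 = 0,
  forall x y, `|x| <= A -> `|y| <= A -> `|g x - g y| <= `|x - y|,
  forall x y, `|x| <= A -> `|y| <= A -> x <= y ->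
    sigma (x +i* g x) * (y - x) <= g y - g x &
  forall x, 0 < x <= A -> ~ M (x +i* g x)].
Proof.
have [r [r0 rr fr]] := small_field.
have cc : {for 0, continuous c} by apply: cder_cont (c_der _); rewrite normr0.
have [b [b0 bh cb]] : exists b : K, [/\ 0 < b, b < h & forall t : K, `|t| <= b -> mod (c t) <= r].
  have := curve_cont_mod cc r0; move=> /nbhs_ballP[d /= d0 dP].
  exists (Num.min (d / 2) (h / 2)); split.
  - by rewrite lt_min !divr_gt0.
  - have hh : h / 2 < h by rewrite ltr_pdivrMr // ltr_pMr // ltr1n.
    by rewrite gt_min hh orbT.
  - move=> t; rewrite le_min => /andP[td _].
    have := dP t; rewrite c0 subr0 /ball /= sub0r normrN => H; apply/ltW/H.
    apply: le_lt_trans td _; by rewrite ltr_pdivrMr // ltr_pMr // ltr1n.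
have bh' (t : K) : `|t| <= b -> `|t| < h by move=> tb; exact: le_lt_trans bh.
have dR (t : K) : `|t| <= b -> is_derive t 1 (fun s => complex.Re (c s)) (complex.Re (f (c t))).
  by move=> /bh' /c_der[].
have dI (t : K) : `|t| <= b -> is_derive t 1 (fun s => complex.Im (c s)) (complex.Im (f (c t))).
  by move=> /bh' /c_der[].
have btw (s t u : K) : `|s| <= b -> `|t| <= b -> s <= u <= t -> `|u| <= b.
  by rewrite !ler_norml; lra.
have mvt (y dy : K -> K) (s t : K) : `|s| <= b -> `|t| <= b -> s <= t ->
    (forall u : K, `|u| <= b -> is_derive u 1 y (dy u)) ->
    exists2 u, `|u| <= b & y t - y s = dy u * (t - s).
  move=> sb tb st yd; have ct : {within `[s, t], continuous y}.
    apply: continuous_in_subspaceT => u /set_mem /=; rewrite in_itv /= => su.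
    by apply: is_derive_cont; apply: yd; exact: btw su.
  have [u|u] := @MVT_segment _ y dy s t st _ ct.
    by rewrite in_itv /= => /andP[u1 u2]; apply: yd; apply: (btw s t) => //; rewrite !ltW.
  by rewrite in_itv /= => su e; exists u => //; exact: btw su.
have Rinc (s t : K) : `|s| <= b -> `|t| <= b -> s <= t ->
    3 / 4 * (t - s) <= complex.Re (c t) - complex.Re (c s).
  move=> sb tb st; have [u ub ->] := mvt _ _ _ _ sb tb st dR.
  by have [f1 _ _] := fr _ (cb _ ub); rewrite ler_wpM2r ?subr_ge0.
have Iinc (s t : K) : `|s| <= b -> `|t| <= b -> s <= t ->
    `|complex.Im (c t) - complex.Im (c s)| <= complex.Re (c t) - complex.Re (c s).
  move=> sb tb st; have [u ub e] := mvt _ _ _ _ sb tb st dI.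
  have [_ _ f3] := fr _ (cb _ ub); rewrite e normrM.
  apply: le_trans (Rinc s t sb tb st); rewrite [`|t - s|]ger0_norm ?subr_ge0 //.
  by rewrite ler_wpM2r ?subr_ge0 //; lra.
have bb : `|b| <= b by rewrite ger0_norm // ltW.
have bN : `|- b| <= b by rewrite normrN.
have b00 : `|0 : K| <= b by rewrite normr0 ltW.
pose A := 3 / 4 * b; have A0 : 0 < A by rewrite mulr_gt0 // divr_gt0.
have inv (x : K) : exists t : K, `|x| <= A -> `|t| <= b /\ complex.Re (c t) = x.
  have [xA|] := boolP (`|x| <= A); last by exists 0.
  have Nb : - b <= b by lra.
  have ct : {within `[- b, b], continuous (fun s => complex.Re (c s))}.
    apply: continuous_in_subspaceT => u /set_mem /=; rewrite in_itv /= => su.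
    by apply: is_derive_cont; apply: dR; exact: btw su.
  have [|t tI tE] := @IVT _ (fun s => complex.Re (c s)) (- b) b x Nb ct.
    have := Rinc 0 b b00 bb (ltW b0).
    have := Rinc (- b) 0 bN b00; rewrite oppr_le0 => /(_ (ltW b0)).
    rewrite c0 /= ge_min le_max => h1 h2; move: xA; rewrite ler_norml /A => /andP[x1 x2].
    by apply/andP; split; apply/orP; [left|right]; lra.
  by exists t => _; rewrite ler_norml; move: tI; rewrite in_itv.
have [T TP] := choice inv; pose g x := complex.Im (c (T x)).
have Tle (x y : K) : `|x| <= A -> `|y| <= A -> x <= y -> T x <= T y.
  move=> xA yA xy; have [tx ex] := TP x xA; have [ty ey] := TP y yA.
  rewrite leNgt; apply/negP => lt; have := Rinc _ _ ty tx (ltW lt).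
  by rewrite ex ey; lra.
have cT (x : K) : `|x| <= A -> x +i* g x = c (T x).
  by move=> xA; apply: complex_eqP => //=; case: (TP x xA).
have T0 : T 0 = 0.
  have A00 : `|0 : K| <= A by rewrite normr0 ltW.
  have [t0b e0] := TP 0 A00; have [t0|t0] := leP 0 (T 0).
    by have := Rinc 0 (T 0) b00 t0b t0; rewrite e0 c0 /=; lra.
  by have := Rinc (T 0) 0 t0b b00 (ltW t0); rewrite e0 c0 /=; lra.
exists A, g; split => //.
- by rewrite /g T0 c0.
- move=> x y; wlog xy : x y / x <= y.
    move=> H xA yA; have [xy|/ltW yx] := leP x y; first exact: H.
    by rewrite distrC [`|x - y|]distrC; exact: H.
  move=> xA yA; have [tx ex] := TP x xA; have [ty ey] := TP y yA.
  have := Iinc _ _ tx ty (Tle _ _ xA yA xy); rewrite ex ey distrC.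
  by rewrite [`|x - y|]distrC [`|y - x|]ger0_norm ?subr_ge0.
- move=> x y xA yA xy; have [tx ex] := TP x xA; have [ty ey] := TP y yA.
  rewrite cT // /sigma; set fs := f (c (T x)).
  have [f1 _ _] := fr _ (cb _ tx); have Rpos : 0 < complex.Re fs by rewrite /fs; lra.
  rewrite mulrAC ler_pdivrMr // mulrC -subr_ge0.
  pose H t := complex.Re fs * complex.Im (c t) - complex.Im fs * complex.Re (c t).
  have -> : (g y - g x) * complex.Re fs - (y - x) * complex.Im fs = H (T y) - H (T x).
    by rewrite /H ex ey /g; ring.
  rewrite subr_ge0; apply: (@nonneg_deriv_mono _ H (fun t => complex.Im (f (c t) * fs^*))).
  + exact: Tle.
  + move=> t tI; have tb : `|t| <= b by exact: btw tI.
    have -> : complex.Im (f (c t) * fs^*) =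
        complex.Re fs *: complex.Im (f (c t)) - complex.Im fs *: complex.Re (f (c t)).
      by rewrite ImM ReJ ImJ /GRing.scale /=; ring.
    apply: is_deriveB; apply: is_deriveZ; [exact: dI|exact: dR].
  + move=> t tI; have tb : `|t| <= b by exact: btw tI.
    by apply: c_convex; [exact: bh'|exact: bh'|case/andP: tI].
- move=> x /andP[x0 xA]; have xA' : `|x| <= A by rewrite ger0_norm // ltW.
  have [tx ex] := TP x xA'; rewrite cT //.
  have n0 : c (T x) <> 0 by move=> e; move: x0; rewrite -ex e /= ltxx.
  apply: c_out => //.
  have A00 : `|0 : K| <= A by rewrite normr0 ltW.
  rewrite (le_lt_trans (ler_norm _) (bh' _ tx)) andbT lt_neqAle.
  have := Tle 0 x A00 xA' (ltW x0); rewrite T0 => ->; rewrite andbT eq_sym.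
  by apply/eqP => Tx0; apply: n0; rewrite Tx0.
Qed.


Lemma slope_lip (r : K) (w w' : K[i]) : r <= rho ->
  (forall w, mod w <= r ->
  [/\ 3 / 4 <= complex.Re (f w), complex.Re (f w) <= 5 / 4 & `|complex.Im (f w)| <= 1 / 4]) ->
  mod w <= r -> mod w' <= r -> `|sigma w - sigma w'| <= 3 * La * mod (w - w').
Proof.
move=> rr fr wr wr'; have [p1 p2 p3] := fr w wr; have [q1 q2 q3] := fr w' wr'.
have lip := f_lip (le_trans wr rr) (le_trans wr' rr).
set d := mod (w - w') in lip *.
have dR := le_trans (Re_le_mod _) lip; have dI := le_trans (Im_le_mod _) lip.
rewrite ReD ReN in dR; rewrite ImD ImN in dI; rewrite /sigma.
set u := complex.Re (f w) in p1 p2 dR *; set v := complex.Im (f w) in p3 dI *.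
set u' := complex.Re (f w') in q1 q2 dR *; set v' := complex.Im (f w') in q3 dI *.
have u0 : 0 < u by lra. have u0' : 0 < u' by lra.
have -> : v / u - v' / u' = ((v - v') * u' - v' * (u - u')) / (u * u').
  by field; rewrite !gt_eqF.
rewrite normrM normfV [`|u * u'|]gtr0_norm ?mulr_gt0 // ler_pdivrMr ?mulr_gt0 //.
have n1 : `|(v - v') * u'| <= La * d * (5 / 4).
  by rewrite normrM (gtr0_norm u0'); apply: ler_pM => //; exact: ltW.
have n2 : `|v' * (u - u')| <= 1 / 4 * (La * d).
  by rewrite normrM; apply: ler_pM.
apply: le_trans (ler_normB _ _) _; apply: le_trans (lerD n1 n2) _.
have d0 : 0 <= La * d by rewrite mulr_ge0 ?mod_ge0 // ltW.
have uu : 9 / 16 <= u * u'.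
  have -> : 9 / 16 = 3 / 4 * (3 / 4) :> K by lra.
  by rewrite ler_pM //; lra.
have : 0 <= La * d * (u * u' - 9 / 16) by rewrite mulr_ge0 // subr_ge0.
lra.
Qed.

Lemma barrier (ep : K) : 0 < ep -> exists W : set K[i],
  [/\ open W, W 0, W `<=` [set w | mod w < ep] &
   forall w (t : K), W w -> 0 <= t -> M (w + t%:C * f w) -> W (w + t%:C * f w)].
Proof.
move=> ep0.
have [r [r0 rr fr]] := small_field; have [A [g [A0 g0 gl gt gout]]] := graph_exists.
pose b := Num.min (Num.min (r / 2) A) (Num.min (h / 2) (ep / 4)).
have b0 : 0 < b by rewrite /b !lt_min A0 !divr_gt0.
have b1 : b <= r / 2 by rewrite /b !ge_min lexx.
have b2 : b <= A by rewrite /b !ge_min lexx !orbT.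
have b3 : b <= h / 2 by rewrite /b !ge_min lexx !orbT.
have b4 : b <= ep / 4 by rewrite /b !ge_min lexx !orbT.
clearbody b.
have hh : h / 2 < h by rewrite ltr_pdivrMr // ltr_pMr // ltr1n.
have bh : b < h by exact: le_lt_trans hh.
have inr (x y : K) : `|x| <= b -> `|y| <= b -> mod (x +i* y) <= r.
  by move=> xb yb; apply: le_trans (mod_le_ReIm _) _ => /=; lra.
pose s x y := sigma (x +i* y).
pose N (x y : K) := M (x +i* y).
(* Rays are reparametrised by their abscissa: time is divided by the real part of the field, which
   lies between 3/4 and 5/4. *)
have E (x y t : K) : `|x| <= b -> `|y| <= b ->
    (x + t) +i* (y + t * s x y) = x +i* y + (t / complex.Re (f (x +i* y)))%:C * f (x +i* y).
  move=> xb yb; have [f1 _ _] := fr _ (inr _ _ xb yb).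
  have n0 : complex.Re (f (x +i* y)) != 0 by rewrite gt_eqF //; lra.
  apply: complex_eqP; rewrite ?ReD ?ImD ?ReM ?ImM /= mul0r ?subr0 ?addr0.
    by rewrite divfK.
  by rewrite /s /sigma; congr (_ + _); field.
have [] := @graph_barrier K s g N b (3 * La) b0 _ _ _ _ g0 _ _ _ _ _ _ _ (Num.min b (ep / 2)).
- by rewrite mulr_gt0.
- move=> x y x' y' xb yb xb' yb'.
  apply: le_trans (slope_lip rr fr (inr _ _ xb yb) (inr _ _ xb' yb')) _.
  rewrite ler_wpM2l ?mulr_ge0 ?(ltW La_gt0) //.
  by apply: le_trans (mod_le_ReIm _) _; rewrite !(ReD, ImD, ReN, ImN).
- by rewrite /s /sigma (_ : 0 +i* 0 = 0) // f0 /= mul0r.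
- move=> x /andP[x0 xb]; rewrite /s /sigma divr_ge0 //.
    by apply: f_base; rewrite x0 /=; exact: le_lt_trans bh.
  have [|f1 _ _] := fr (x +i* 0); last lra.
  by apply: inr; rewrite ?normr0 ?(ltW b0) // ger0_norm.
- by move=> x y xb yb; apply: gl; exact: le_trans b2.
- by move=> x y xb yb xy; apply: gt => //; exact: le_trans b2.
- move=> x y Nxy.
  have : nbhs (x +i* y) (~` M) by apply: open_nbhs_nbhs; split => //; exact: closed_openC.
  move=> /(@nbhsCP K _ _).1 [e e0 eP]; exists (e / 2) => [|x' y' xe ye]; first by rewrite divr_gt0.
  apply: (eP (x' +i* y')); apply: le_lt_trans (mod_le_ReIm _) _.
  by rewrite ReD ReN ImD ImN /=; lra.
- move=> x y t xb yb t0 Nxy; rewrite /N E //; apply: M_ray => //.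
  by rewrite divr_ge0 //; have [f1 _ _] := fr _ (inr _ _ xb yb); lra.
- by move=> x /andP[x0 xb]; apply: gout; rewrite x0 /=; exact: le_trans b2.
- by move=> x x0; apply: ray_out.
- move=> t0 t00; have [r' r0' far] := @ray_far (t0 / 2) (ltac:(by rewrite divr_gt0)).
  exists (Num.min b (r' / 2)); first by rewrite lt_min b0 divr_gt0.
  move=> x y t; rewrite !lt_min => /andP[xb' xr] /andP[yb' yr] tt.
  have xb := ltW xb'; have yb := ltW yb'.
  rewrite /N E //; apply: far.
    by apply: le_lt_trans (mod_le_ReIm _) _ => /=; lra.
  have [f1 f2 _] := fr _ (inr _ _ xb yb).
  have R0 : 0 < complex.Re (f (x +i* y)) by lra.
  rewrite ler_pdivlMr //.
  have : 0 <= t0 / 2 * (5 / 4 - complex.Re (f (x +i* y))) by rewrite mulr_ge0 //; lra.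
  lra.
- by rewrite lt_min b0 divr_gt0.
move=> W [W0 Wb Wo Wr]; exists [set w | W (complex.Re w) (complex.Im w)]; split => //.
- rewrite openE => w /= Ww; have [e e0 eP] := Wo _ _ Ww.
  apply/(@nbhsCP K _ _).2; exists e => // w' we; apply: eP.
    by rewrite -ReN -ReD; apply: le_lt_trans (Re_le_mod _) we.
  by rewrite -ImN -ImD; apply: le_lt_trans (Im_le_mod _) we.
- move=> w /= /Wb; rewrite !lt_min => -[/andP[_ w1] /andP[_ w2]].
  by apply: le_lt_trans (mod_le_ReIm _) _; lra.
- move=> [x y] t /= Ww t0; have := Wb _ _ Ww; rewrite !lt_min => -[/andP[xb' _] /andP[yb' _]].
  have xb := ltW xb'; have yb := ltW yb'.
  have [f1 _ _] := fr _ (inr _ _ xb yb).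
  have R0 : 0 < complex.Re (f (x +i* y)) by lra.
  have := Wr _ _ (t * complex.Re (f (x +i* y))) Ww; rewrite /N E // mulfK ?gt_eqF //.
  rewrite mulr_ge0 ?(ltW R0) // => /(_ isT) H /H.
  have := E x y (t * complex.Re (f (x +i* y))) xb yb; rewrite mulfK ?gt_eqF // => <-.
  by [].
Qed.

End Barrier.

(** * Local Lipschitz bounds for the field *)

Section Lipschitz.
Variable K : realType.
Implicit Types (F G : K[i] -> K[i]) (z : K[i]).

Definition lip_near F z : Prop := exists r L : K, [/\ 0 < r, 0 < L &
  forall w w', mod (w - z) <= r -> mod (w' - z) <= r ->
    mod (F w - F w') <= L * mod (w - w')].

Lemma lip_near_bound F z : lip_near F z -> exists r C : K, [/\ 0 < r, 0 < C &
  forall w, mod (w - z) <= r -> mod (F w) <= C].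
Proof.
move=> [r [L [r0 L0 H]]]; exists r, (mod (F z) + L * r); split => //.
  by rewrite ltr_wpDl ?mod_ge0 // mulr_gt0.
move=> w wr; rewrite -[F w](subrK (F z)) addrC; apply: le_trans (modD _ _) _.
rewrite lerD2l; apply: le_trans (H w z wr _) _; first by rewrite subrr mod0 ltW.
by rewrite ler_wpM2l // ltW.
Qed.

Lemma lip_near_cst a z : lip_near (fun _ => a) z.
Proof.
by exists 1, 1; split => // w w' _ _; rewrite subrr mod0 mul1r mod_ge0.
Qed.

Lemma lip_near_id z : lip_near id z.
Proof. by exists 1, 1; split => // w w' _ _; rewrite mul1r. Qed.

Lemma lip_nearD F G z : lip_near F z -> lip_near G z -> lip_near (fun w => F w + G w) z.
Proof.
move=> [r [L [r0 L0 H]]] [r' [L' [r0' L0' H']]]; exists (Num.min r r'), (L + L').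
split; [by rewrite lt_min r0|by rewrite addr_gt0|].
move=> w w'; rewrite !le_min => /andP[a a'] /andP[b b'].
have -> : F w + G w - (F w' + G w') = (F w - F w') + (G w - G w') by ring.
by apply: le_trans (modD _ _) _; rewrite mulrDl lerD ?H ?H'.
Qed.

Lemma lip_nearM F G z : lip_near F z -> lip_near G z -> lip_near (fun w => F w * G w) z.
Proof.
move=> hF hG; have [s [C [s0 C0 B]]] := lip_near_bound hF.
have [s' [C' [s0' C0' B']]] := lip_near_bound hG.
move: hF hG => [r [L [r0 L0 H]]] [r' [L' [r0' L0' H']]].
exists (Num.min (Num.min r r') (Num.min s s')), (L * C' + C * L').
split; [by rewrite !lt_min r0 r0' s0|by rewrite addr_gt0 ?mulr_gt0|].
move=> w w'; rewrite !le_min => /andP[/andP[a a'] /andP[e e']] /andP[/andP[b b'] /andP[g g']].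
have -> : F w * G w - F w' * G w' = (F w - F w') * G w + F w' * (G w - G w') by ring.
apply: le_trans (modD _ _) _; rewrite !modM.
have h1 : mod (F w - F w') * mod (G w) <= L * mod (w - w') * C'.
  by apply: ler_pM; rewrite ?mod_ge0 ?H ?B'.
have h2 : mod (F w') * mod (G w - G w') <= C * (L' * mod (w - w')).
  by apply: ler_pM; rewrite ?mod_ge0 ?H' ?B.
lra.
Qed.

Lemma lip_nearV F z : lip_near F z -> F z != 0 -> lip_near (fun w => (F w)^-1) z.
Proof.
move=> [r [L [r0 L0 H]]]; rewrite -mod_gt0; set m := mod (F z) => m0.
have Lm : 0 < 2 * L by rewrite mulr_gt0.
pose s := Num.min r (m / (2 * L)).
have s0 : 0 < s by rewrite lt_min r0 divr_gt0.
have sr : s <= r by rewrite ge_min lexx.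
have sm : s * (2 * L) <= m by rewrite -ler_pdivlMr // ge_min lexx orbT.
have lb w : mod (w - z) <= s -> m / 2 <= mod (F w).
  move=> ws; have zr : mod (z - z) <= r by rewrite subrr mod0 ltW.
  have := H z w zr (le_trans ws sr); rewrite [mod (z - w)]modB => h1.
  have h2 : L * mod (w - z) <= L * s by rewrite ler_wpM2l // ltW.
  have := modD (F z - F w) (F w); rewrite subrK -/m => h3; lra.
exists s, (L * (4 / m ^+ 2)); split => //; first by rewrite mulr_gt0 ?divr_gt0 ?exprn_gt0.
move=> w w' ws ws'; have h1 := lb w ws; have h2 := lb w' ws'.
have p1 : 0 < mod (F w) by lra. have p2 : 0 < mod (F w') by lra.
have -> : (F w)^-1 - (F w')^-1 = (F w' - F w) / (F w * F w').
  by field; rewrite -!mod_gt0 p1 p2.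
rewrite modM modV modM ler_pdivrMr ?mulr_gt0 // modB.
apply: le_trans (H w w' (le_trans ws sr) (le_trans ws' sr)) _.
have hX : m ^+ 2 / 4 <= mod (F w) * mod (F w').
  have -> : m ^+ 2 / 4 = m / 2 * (m / 2) by field.
  by apply: ler_pM => //; lra.
set X := mod (F w) * mod (F w') in hX *; set d := mod (w - w').
have -> : L * (4 / m ^+ 2) * d * X = L * d * (4 * X / m ^+ 2).
  by field; rewrite gt_eqF.
rewrite -[leLHS]mulr1 ler_wpM2l ?mulr_ge0 ?mod_ge0 ?(ltW L0) //.
by rewrite ler_pdivlMr ?exprn_gt0 // mul1r; lra.
Qed.

Lemma lip_near_horner (p : {poly K[i]}) z : lip_near (horner p) z.
Proof.
elim/poly_ind: p => [|p c IH].
  have -> : horner (0 : {poly K[i]}) = fun _ => 0 by apply/funext => w; rewrite horner0.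
  exact: lip_near_cst.
have -> : horner (p * 'X + c%:P) = fun w => p.[w] * w + c.
  by apply/funext => w; rewrite hornerMXaddC.
by apply: lip_nearD (lip_near_cst _ _); apply: lip_nearM (lip_near_id z).
Qed.

End Lipschitz.

(** * Rays issued from nearby points, up to infinity *)

Section LocalGlobal.
Variable K : realType.

(** Written as the conjugate of [g] over [|g|^2], the inverse only requires inverting a real
    function. *)
Lemma cderV (g : K -> K[i]) (t : K) v : g t != 0 -> cder g t v ->
  cder (fun s => (g s)^-1) t (- v / g t ^+ 2).
Proof.
move=> g0 gv; have [gr gi] := gv.
have n0 : complex.Re (g t) ^+ 2 + complex.Im (g t) ^+ 2 != 0.
  by rewrite -sqr_mod sqrf_eq0 mod_eq0.
pose n s : K := complex.Re (g s) ^+ 2 + complex.Im (g s) ^+ 2.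
have nd : cder (fun s => (n s)%:C) t (v * (g t)^* + g t * v^*).
  apply: cder_near (cderM gv (cderJ gv)); near=> s.
  by rewrite mulJ sqr_mod.
have nr : is_derive t 1 n (complex.Re (v * (g t)^* + g t * v^*)) by case: nd.
have nV := is_deriveV (f := n) (x := t) (v := 1) n0.
have nnz : (n t)%:C = g t * (g t)^* by rewrite mulJ sqr_mod.
have := cderM (cder_real (nV _ nr)) (cderJ gv).
have gJ : (g t)^* != 0 by rewrite -mod_gt0 modJ mod_gt0.
set d := (X in cder _ _ X -> _); have -> : d = - v / g t ^+ 2.
  set X := v * (g t)^* + g t * v^* in d *.
  have rX : (complex.Re X)%:C = X.
    by apply: complex_eqP => //=; rewrite ImD !ImM ReJ ImJ ReJ ImJ; ring.
  have e1 : ((n t)^-1)%:C = ((n t)%:C)^-1 by rewrite fmorphV.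
  have e2 : (- (n t) ^- 2 *: complex.Re X)%:C = - ((n t)%:C ^- 2) * (complex.Re X)%:C.
    by rewrite -rmorphXn -fmorphV -rmorphN -rmorphM.
  rewrite /d e1 e2 rX nnz /X.
  by field; rewrite g0 gJ.
apply: cder_near; have := curve_cont_mod (cder_cont gv) (e := mod (g t)).
rewrite mod_gt0 => /(_ g0); apply: filterS => s gs.
have s0 : g s != 0.
  by apply: contraTneq gs => ->; rewrite sub0r modN ltxx.
have sJ : (g s)^* != 0 by rewrite -mod_gt0 modJ mod_gt0.
have ns : (n s)%:C = g s * (g s)^* by rewrite mulJ sqr_mod.
have e1 : ((n s)^-1)%:C = ((n s)%:C)^-1 by rewrite fmorphV.
by rewrite e1 ns; field; rewrite s0 sJ.
Unshelve. all: by end_near.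
Qed.

Variables (P Q : {poly K[i]}).
Local Notation q := (rnum P Q).
Local Notation p := (rden P Q).
Local Notation A := (num1 P Q).
Local Notation R := (Rf P Q).
Local Notation dR w := (A.[w] / p.[w] ^+ 2).

Lemma cder_Rf (g : K -> K[i]) (t : K) v : p.[g t] != 0 -> cder g t v ->
  cder (fun s => R (g s)) t (dR (g t) * v).
Proof.
move=> pg gv; have := cderM (cder_horner q gv) (cderV pg (cder_horner p gv)).
set d := (X in cder _ _ X -> _); suff -> : d = dR (g t) * v by [].
rewrite /d /num1 hornerD hornerN !hornerM; by field.
Qed.

Lemma lip_near_Rf z : p.[z] != 0 -> lip_near R z.
Proof.
by move=> pz; apply: lip_nearM (lip_near_horner q z) (lip_nearV (lip_near_horner p z) pz).
Qed.

Lemma Rf_eq z : P.[z] != 0 -> R z = Q.[z] / P.[z].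
Proof.
move=> Pz; have EP := congr1 (horner^~ z) (rdenE P Q).
have EQ := congr1 (horner^~ z) (rnumE P Q).
rewrite /= hornerM in EP; rewrite /= hornerM in EQ.
move: Pz; rewrite -EP -EQ mulf_eq0 negb_or => /andP[p0 g0].
by rewrite /Rf; field; rewrite p0 g0.
Qed.

(** A factor [x] close to 1 shifts the argument [e] of [v] by [atan (Im x / Re x)], which is
    small. *)
Lemma near_direction (e a b : K) (v : K[i]) : v != 0 -> a < e < b ->
  v = (mod v)%:C * (cos e +i* sin e) ->
  exists2 d : K, 0 < d & forall x : K[i], mod (x - 1) < d ->
    exists (s : K) (y : K), [/\ 0 < s, a < y < b & v * x = s%:C * (cos y +i* sin y)].
Proof.
move=> v0 /andP[ae eb] vE; pose c := Num.min (e - a) (b - e).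
have c0 : 0 < c by rewrite lt_min !subr_gt0 ae.
have c1 : c <= e - a by rewrite ge_min lexx.
have c2 : c <= b - e by rewrite ge_min lexx orbT.
have := cont_dist (@continuous_atan K 0) c0 => /nbhs_ballP[d /= d0 dP].
exists (Num.min (1 / 2) (d / 2)) => [|x]; first by rewrite lt_min !divr_gt0.
rewrite lt_min => /andP[x1 x2].
have := le_lt_trans (Re_le_mod _) x1; have := le_lt_trans (Im_le_mod _) x2.
rewrite ReD ImD ReN ImN /= oppr0 addr0 => hI; rewrite ltr_norml => /andP[h1 h2].
case: x x1 x2 hI h1 h2 => m n /= x1 x2 hI h1 h2.
have m0 : 0 < m by lra.
set th := atan (n / m); have thc : `|th| < c.
  have := dP (n / m); rewrite /ball /= sub0r normrN atan0 subr0; apply.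
  rewrite normrM normfV (gtr0_norm m0) ltr_pdivrMr //.
  apply: lt_le_trans hI _; rewrite ler_wpM2l ?(ltW d0) //; lra.
exists (mod v * mod (m +i* n)), (e + th); split.
- rewrite mulr_gt0 // mod_gt0 //; apply/eqP => -[mz _]; by rewrite mz ltxx in m0.
- by move: thc; rewrite ltr_norml => /andP[t1 t2]; apply/andP; split; lra.
- have E := atan_polar n m0; rewrite -/th in E; rewrite cosD sinD.
  set r1 := mod v in vE *; set r2 := mod (m +i* n) in E *; rewrite vE E.
  clearbody r1 r2; clear vE E; by apply: complex_eqP; rewrite ?ReM ?ImM /=; ring.
Qed.

(** [w + t * R w = z1 + t * (v * x')], where [x'] tends to 1 as [w] tends to [z] and [t] to
    infinity; [r] and [T] keep each of the two error terms at most [d / 4], uniformly in [w]. *)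
Lemma cone_far z z1 (a b : K) (e : circle K) : p.[z] != 0 -> R z != 0 ->
  sval e = R z / (mod (R z))%:C -> circle_arc a b e ->
  exists r T : K, [/\ 0 < r, 0 < T & forall w (t : K), mod (w - z) < r -> T <= t ->
    cone z1 (circle_arc a b) (w + t%:C * R w)].
Proof.
move=> pz; set v := R z => v0 eE [x xab ex].
have m0 : 0 < mod v by rewrite mod_gt0.
have vE : v = (mod v)%:C * (cos x +i* sin x).
  have -> : cos x +i* sin x = v / (mod v)%:C by rewrite -ex -eE.
  by rewrite mulrC divfK // fmorph_eq0 gt_eqF.
have [d d0 dP] := near_direction v0 xab vE.
have [r [L [r0 L0 H]]] := lip_near_Rf pz.
have c0 : 0 < d * mod v by rewrite mulr_gt0.
exists (Num.min r (d * mod v / (4 * L))), (4 * (r + mod (z - z1)) / (d * mod v)).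
split; [by rewrite lt_min r0 divr_gt0 ?mulr_gt0| |].
  by rewrite divr_gt0 // mulr_gt0 // ltr_pwDl ?mod_ge0.
move=> w t; rewrite lt_min => /andP[wr wL] tT.
have t0 : 0 < t.
  by apply: lt_le_trans tT; rewrite divr_gt0 // mulr_gt0 // ltr_pwDl ?mod_ge0.
have tC : t%:C != 0 by rewrite fmorph_eq0 gt_eqF.
pose x' := (R w + (w - z1) / t%:C) / v.
have wE : w + t%:C * R w = z1 + t%:C * (v * x').
  by rewrite /x'; field; rewrite v0 tC.
have [|s [y [s0 yab sy]]] := dP x'.
  have -> : x' - 1 = ((R w - v) + ((w - z) + (z - z1)) / t%:C) / v.
    by rewrite /x'; field; rewrite v0 tC.
  rewrite modM modV ltr_pdivrMr //; apply: le_lt_trans (modD _ _) _.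
  have h1 : mod (R w - v) <= d * mod v / 4.
    apply: le_trans (H w z (ltW wr) _) _; first by rewrite subrr mod0 ltW.
    by move: wL; rewrite ltr_pdivlMr ?mulr_gt0 //; lra.
  rewrite modM modV modC (gtr0_norm t0).
  have h2 : (mod (w - z + (z - z1))) / t <= d * mod v / 4.
    rewrite ler_pdivrMr //; apply: le_trans (modD _ _) _.
    by move: tT; rewrite ler_pdivrMr //; lra.
  lra.
have cs : `|cos y +i* sin y : K[i]| == 1.
  by rewrite normE /= cos2Dsin2 sqrtr1.
exists (t * s), (exist _ (cos y +i* sin y) cs); split; first by rewrite mulr_gt0.
  by exists y.
by rewrite wE sy rmorphM -!mulrA.
Qed.

Variables (M : set K[i]) (z : K[i]).
Hypotheses (M_closed : closed M) (pz : p.[z] != 0) (Rz : R z != 0).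

Lemma unit_direction : `|R z / (mod (R z))%:C| == 1.
Proof.
by rewrite normE modM modV modC ger0_norm ?mod_ge0 // divff // mod_eq0.
Qed.

(** Emptiness of [Del] includes the direction at infinity, which settles all large [t] at once
    through [cone_far]. The remaining [t] form the compact interval [[t0, T]], over which one
    neighbourhood of [z] can be chosen. *)
Lemma far_ray_out : Del P Q M z = set0 -> forall t0 : K, 0 < t0 ->
  exists2 r : K, 0 < r & forall w (t : K), mod (w - z) < r -> t0 <= t ->
    ~ M (w + t%:C * R w).
Proof.
move=> D0 t0 t00; pose e : circle K := exist (fun u : K[i] => is_true (`|u| == 1)) _ unit_direction.
have nD x : ~ Del P Q M z x by rewrite D0.
have eR : xclosure (@Fin K @` assoc_ray P Q z) (Dir e).
  move=> N [z1 [a [b [eab ->]]]].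
  have [r [T [r0 T0 H]]] := @cone_far z z1 a b e pz Rz erefl eab.
  exists (Fin (z + T%:C * R z)); split.
    by right; exists (z + T%:C * R z) => //; apply: H => //; rewrite subrr mod0.
  by exists (z + T%:C * R z) => //; exists T => //; exact: ltW.
have /existsNP[N /not_implyP[]] : ~ xclosure (@Fin K @` M) (Dir e).
  by move=> h; apply: (nD (Dir e)); split.
move=> [z1 [a [b [eab NE]]]] NM.
have [r [T [r0 T0 H]]] := @cone_far z z1 a b e pz Rz erefl eab.
have out1 w (t : K) : mod (w - z) < r -> T <= t -> ~ M (w + t%:C * R w).
  move=> wr tT Mw; apply: NM; exists (Fin (w + t%:C * R w)); split; last by exists (w + t%:C * R w).
  by rewrite NE; right; exists (w + t%:C * R w) => //; exact: H.
have [r2 [L [r20 L0 H2]]] := lip_near_Rf pz.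
have mid : \forall w \near z, `[t0, T] `<=` (fun t : K => ~ M (w + t%:C * R w)).
  have cI : compact (`[t0, T] : set K) by exact: segment_compact.
  move/compact_near_coveringP: cI => /(_ _ (nbhs z) (fun w t => ~ M (w + t%:C * R w)) _); apply.
  move=> t /=; rewrite in_itv /= => /andP[tt0 _].
  have tp : 0 < t by apply: lt_le_trans tt0.
  have nM : ~ M (z + t%:C * R z).
    move=> Mz; apply: (nD (Fin (z + t%:C * R z))); split; first split.
    - move=> N' [U Uz ->]; exists (Fin (z + t%:C * R z)).
      split; first by exists (z + t%:C * R z) => //; exact: nbhs_singleton.
      by exists (z + t%:C * R z) => //; exists t => //; exact: ltW.
    - move=> [] /eqP; rewrite -subr_eq0 addrAC subrr add0r mulf_eq0 (negPf Rz) orbF.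
      by rewrite fmorph_eq0 gt_eqF.
    - move=> N' [U Uz ->]; exists (Fin (z + t%:C * R z)).
      split; first by exists (z + t%:C * R z) => //; exact: nbhs_singleton.
      by exists (z + t%:C * R z).
  have : nbhs (z + t%:C * R z) (~` M) by apply: open_nbhs_nbhs; split => //; exact: closed_openC.
  move=> /(@nbhsCP K _ _).1 [d d0 dP].
  pose c := mod (R z) + 1; have c0 : 0 < c by rewrite ltr_wpDl ?mod_ge0.
  pose l := 1 + (t + 1) * L; have l0 : 0 < l by rewrite ltr_pwDl // mulr_ge0 ?(ltW L0) //; lra.
  pose s1 := Num.min 1 (d / (2 * c)).
  pose s2 := Num.min r2 (Num.min (1 / L) (d / (2 * l))).
  exists (ball t s1, [set w | mod (w - z) < s2]).
    split; first by apply: nbhsx_ballx; rewrite lt_min ltr01 divr_gt0 ?mulr_gt0.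
    by apply: near_mod; rewrite !lt_min r20 !divr_gt0 ?mulr_gt0.
  move=> [t' w] [/=]; rewrite /ball /= !lt_min => /andP[a1 a2] /and3P[b1 b2 b3].
  apply: (dP (w + t'%:C * R w)).
  have -> : w + t'%:C * R w - (z + t%:C * R z) =
     (w - z) + (t'%:C * (R w - R z) + (t' - t)%:C * R z) by rewrite rmorphB; ring.
  have h := H2 w z (ltW b1); rewrite subrr mod0 in h; have {}h := h (ltW r20).
  apply: le_lt_trans (modD _ _) _.
  have hD : mod (t'%:C * (R w - R z) + (t' - t)%:C * R z) <=
      `|t'| * mod (R w - R z) + `|t' - t| * mod (R z).
    apply: le_trans (modD _ _) _.
    by rewrite [mod (t'%:C * _)]modM [mod (_ * R z)]modM !modC.
  have a1' : `|t'| <= t + 1 by move: a1; rewrite ltr_norml ler_norml; lra.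
  have e1 : `|t'| * mod (R w - R z) <= (t + 1) * (L * mod (w - z)).
    by apply: ler_pM => //; exact: mod_ge0.
  have e2 : `|t' - t| * mod (R z) <= `|t - t'| * c.
    by rewrite distrC ler_wpM2l // /c; lra.
  move: a2 b3; rewrite !ltr_pdivlMr ?mulr_gt0 // => a2 b3.
  have : mod (w - z) + (t + 1) * (L * mod (w - z)) = mod (w - z) * l by rewrite /l; ring.
  lra.
have [r3 r30 H3] := (@nbhsCP K _ _).1 mid.
exists (Num.min r r3) => [|w t]; first by rewrite lt_min r0.
rewrite lt_min => /andP[wr wr3] tt; have [tT|tT] := leP T t; first exact: out1.
by apply: (H3 w wr3); rewrite /= in_itv /= tt ltW.
Qed.

End LocalGlobal.

(** * Normalisation of the field at a boundary point *)

Section LocalBarrier.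
Variable K : realType.
Variables (P Q : {poly K[i]}) (M : set K[i]) (z : K[i]) (J : K[i] -> K[i]).
Local Notation p := (rden P Q).
Local Notation A := (num1 P Q).
Local Notation R := (Rf P Q).
Local Notation dR w := (A.[w] / p.[w] ^+ 2).
Local Notation v := (R z).
Hypotheses (M_closed : closed M) (pz : p.[z] != 0) (Rz : R z != 0).
Hypotheses (JD : forall a b, J (a + b) = J a + J b)
  (JM : forall a b, J (a * b) = J a * J b)
  (JJ : forall a, J (J a) = a) (JC : forall x : K, J x%:C = x%:C)
  (Jmod : forall a, mod (J a) = mod a)
  (Jder : forall g (t : K) u, cder g t u -> cder (fun s => J (g s)) t (J u)).
Hypothesis M_ray : forall w (t : K), ~ M w -> 0 <= t -> ~ M (w + t%:C * R w).
Hypothesis Gam0 : Gam P Q M z = set0.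
Hypothesis Del0 : Del P Q M z = set0.
Hypothesis turn : 0 < complex.Im (J (dR z)).

(** This chart sends 0 to [z] and the nonnegative real axis to the ray of [z]. [J] stands for the
    identity or for conjugation, whichever makes Im R' positive. [f] is the field read in the chart
    ([phi_f]) and [F1] its derivative along curves ([f_der]). *)
Let phi (w : K[i]) := z + v * J w.
Let psi (w : K[i]) := J ((w - z) / v).
Let f (w : K[i]) := J (R (phi w) / v).
Let F1 (w : K[i]) := J (dR (phi w)).

Let J0 : J 0 = 0. Proof. exact: JC 0. Qed.
Let JN a : J (- a) = - J a.
Proof. by apply/eqP; rewrite -addr_eq0 -JD addNr J0. Qed.

Let phiK w : phi (psi w) = w.
Proof. by rewrite /phi /psi JJ; field. Qed.

Let phi0 : phi 0 = z.
Proof. by rewrite /phi J0 mulr0 addr0. Qed.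

Let modphi w w' : mod (phi w - phi w') = mod v * mod (w - w').
Proof.
have -> : phi w - phi w' = v * J (w - w') by rewrite /phi JD JN; ring.
by rewrite [LHS]modM Jmod.
Qed.

Let phi_f w (t : K) : phi (w + t%:C * f w) = phi w + t%:C * R (phi w).
Proof. by rewrite {1}/phi /f JD JM JC JJ /phi; field. Qed.

Let f0 : f 0 = 1.
Proof. by rewrite /f phi0 divff //; exact: JC 1. Qed.

Let modf w w' : mod (f w - f w') = mod (R (phi w) - R (phi w')) / mod v.
Proof.
have -> : f w - f w' = J ((R (phi w) - R (phi w')) / v) by rewrite mulrBl JD JN.
by rewrite Jmod [LHS]modM modV.
Qed.

Let v0 : 0 < mod v. Proof. by rewrite mod_gt0. Qed.

Let f_lip : lip_near f 0.
Proof.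
have [r [L [r0 L0 H]]] := lip_near_Rf pz.
exists (r / mod v), L; split => [|//|w w'].
  by rewrite divr_gt0.
rewrite !subr0 !ler_pdivlMr // => wr wr'; rewrite modf ler_pdivrMr // -mulrA.
rewrite [mod (w - w') * _]mulrC -modphi; apply: H.
  by have := modphi w 0; rewrite phi0 subr0 mulrC => ->.
by have := modphi w' 0; rewrite phi0 subr0 mulrC => ->.
Qed.

Let f_der g (t : K) u : p.[phi (g t)] != 0 -> cder g t u ->
  cder (fun s => f (g s)) t (F1 (g t) * u).
Proof.
move=> pg gu.
have d1 : cder (fun s => phi (g s)) t (v * J u).
  have := cderD (cder_cst z t) (cderM (cder_cst v t) (Jder gu)).
  by rewrite mul0r !add0r.
have := Jder (cderM (cder_Rf pg d1) (cder_cst v^-1 t)).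
rewrite mulr0 addr0 /f /F1; set d := J _; suff -> : d = J (dR (phi (g t))) * u by [].
by rewrite /d -[RHS]/(_ * _) -{2}[u]JJ -JM; congr J; field; rewrite Rz pg.
Qed.

(** The third clause will give the sign of the slope on the base, the fourth the convexity of the
    trajectory. With [m = |R'(z)|], the number in the fourth clause differs by at most [(2 + m) * e]
    from [J (R'(z))], whose imaginary part is [b]; hence the choice [e * (3 + m) <= b]. *)
Let small : exists r : K, [/\ 0 < r,
  forall w, mod w < r -> p.[phi w] != 0,
  forall w, mod w < r -> 0 <= complex.Im (F1 w) &
  forall w w', mod w < r -> mod w' < r -> 0 <= complex.Im (F1 w * f w * (f w')^*)].
Proof.
pose b := complex.Im (J (dR z)); have turn' : 0 < b := turn; set m := mod (dR z).
have m0 : 0 <= m by exact: mod_ge0.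
pose e := Num.min 1 (b / (3 + m)); have e0 : 0 < e.
  by rewrite lt_min ltr01 divr_gt0 // ltr_wpDr.
have e1 : e <= 1 by rewrite ge_min lexx.
have eb : e * (3 + m) <= b by rewrite -ler_pdivlMr ?ltr_wpDr // ge_min lexx orbT.
have cp : {for z, continuous (fun w => p.[w])} by exact: horner_continuous_at.
have cR : {for z, continuous R}.
  apply: contC_M; first exact: horner_continuous_at.
  by apply: contC_V.
have cp2 : {for z, continuous (fun w => p.[w] ^+ 2)}.
  by apply: contC_X; exact: horner_continuous_at.
have cdR : {for z, continuous (fun w => dR w)}.
  apply: contC_M; first exact: horner_continuous_at.
  by apply: (contC_V cp2); rewrite expf_neq0.
have cG : {for z, continuous (fun w => dR w * (R w / v))}.
  apply: contC_M; first exact: cdR.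
  by apply: contC_M; [exact: cR|exact: contC_cst].
have n1 : \forall w \near z, p.[w] != 0 by exact: near_rden.
have [r1 r10 H1] := (@nbhsCP K _ _).1 n1.
have [r2 r20 H2] := (@nbhsCP K _ _).1 (cont_mod cdR e0).
have [r3 r30 H3] := (@nbhsCP K _ _).1 (cont_mod cG e0).
have ev : 0 < e * mod v by rewrite mulr_gt0.
have [r4 r40 H4] := (@nbhsCP K _ _).1 (cont_mod cR ev).
pose r := Num.min (Num.min r1 r2) (Num.min r3 r4).
have r0 : 0 < r by rewrite !lt_min r10 r20 r30.
exists (r / mod v).
have near w : mod w < r / mod v -> [/\ mod (phi w - z) < r1, mod (phi w - z) < r2,
    mod (phi w - z) < r3 & mod (phi w - z) < r4].
  rewrite ltr_pdivlMr //; have := modphi w 0; rewrite phi0 subr0 mulrC => <-.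
  by rewrite !lt_min => /andP[/andP[? ?] /andP[? ?]].
split.
- by rewrite divr_gt0.
- by move=> w /near[a _ _ _]; exact: H1.
- move=> w /near[_ a _ _]; have := H2 _ a => /= h.
  have := le_lt_trans (Im_le_mod (F1 w - J (dR z))) (_ : _ < e).
  rewrite /F1 -JN -JD Jmod => /(_ h); rewrite JD JN ImD ImN -/b ltr_norml => /andP[h1 _].
  have : 0 <= e * (2 + m) by rewrite mulr_ge0 ?addr_ge0 // ltW.
  lra.
- move=> w w' /near[_ _ a _] /near[_ _ _ a']; have := H3 _ a; have := H4 _ a' => /= h4 h3.
  have g4 : mod (f w' - 1) < e.
    by rewrite -f0 modf phi0 ltr_pdivrMr.
  have g3 : mod (F1 w * f w - J (dR z)) < e.
    have -> : F1 w * f w - J (dR z) = J (dR (phi w) * (R (phi w) / v) - dR z * (R z / v)).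
      by rewrite /F1 /f -JM -JN -JD divff // mulr1.
    by rewrite Jmod.
  have -> : F1 w * f w * (f w')^* = J (dR z) + ((F1 w * f w - J (dR z)) * (f w')^* +
       J (dR z) * (f w' - 1)^*).
    have -> : (f w' - 1)^* = (f w')^* - 1 by rewrite rmorphB rmorph1.
    by ring.
  rewrite ImD -/b; set X := (X in _ + complex.Im X).
  have X1 : mod X <= e * 2 + m * e.
    apply: le_trans (modD _ _) _; rewrite lerD //.
      rewrite modM modJ; apply: ler_pM; rewrite ?mod_ge0 ?(ltW g3) //.
      by rewrite -[f w'](subrK 1); apply: le_trans (modD _ _) _; rewrite mod1; lra.
    by rewrite modM modJ Jmod; apply: ler_pM; rewrite ?mod_ge0 ?(ltW g4) // /m.
  have := le_trans (Im_le_mod X) X1; rewrite ler_norml => /andP[h _].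
  lra.
Qed.

(** Transport of [barrier] through the chart. Its two sign hypotheses come from integrating the
    clauses of [small], along the real axis for the base and along the trajectory for convexity. *)
Lemma local_barrier (ep : K) : 0 < ep -> exists W : set K[i],
  [/\ open W, W z, W `<=` [set w | mod (w - z) < ep] &
   forall w (t : K), W w -> 0 <= t -> M (w + t%:C * R w) -> W (w + t%:C * R w)].
Proof.
move=> ep0; have [r [r0 rp rI rC]] := small.
have [r1 [L [r10 L0 lip]]] := f_lip.
have [r2 [C [r20 C0 bnd]]] := lip_near_bound f_lip.
pose s := Num.min r1 r2; have s0 : 0 < s by rewrite lt_min r10.
have [d d0 [c c0 cd]] : exists2 d : K, 0 < d & exists2 c : K -> K[i], c 0 = 0 &
    forall t : K, `|t| < d -> cder c t (f (c t)).
  apply: (@picard K f 0 s L C s0 L0 C0).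
    by move=> w w'; rewrite !le_min => /andP[? _] /andP[? _]; exact: lip.
  by move=> w; rewrite !le_min => /andP[_ ?]; exact: bnd.
have cc : {for 0, continuous c} by apply: cder_cont (cd _ _); rewrite normr0.
have /nbhs_ballP[h1 /= h10 hP] := curve_cont_mod cc r0.
pose h := Num.min (Num.min d h1) (r / 2).
have h0 : 0 < h by rewrite !lt_min d0 h10 divr_gt0.
have hd (t : K) : `|t| < h -> `|t| < d by rewrite !lt_min => /andP[/andP[]].
have hr (t : K) : `|t| < h -> mod (c t) < r.
  rewrite !lt_min => /andP[/andP[_ th] _]; have := hP t.
  by rewrite c0 subr0 /ball /= sub0r normrN; apply.
have hr' (t : K) : `|t| < h -> `|t| < r.
  by rewrite !lt_min => /andP[_ tr]; apply: lt_trans tr _; lra.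
have hb (a b u : K) : `|a| < h -> `|b| < h -> a <= u <= b -> `|u| < h.
  by rewrite !ltr_norml; lra.
have xder (t : K) : `|t| < h -> cder (fun u => phi (c u)) t (R (phi (c t))).
  move=> th; have := cderD (cder_cst z t) (cderM (cder_cst v t) (Jder (cd t (hd t th)))).
  set e := (X in cder _ _ X -> _); suff -> : e = R (phi (c t)) by [].
  by rewrite /e /f JJ mul0r !add0r mulrC divfK.
have cdC (x : K) : cder (fun u : K => u%:C) x 1.
  by apply: (@cder_real K id x 1); exact: is_derive_id.
have := @barrier K f [set w | M (phi w)] c h s L h0 s0 L0 f0 _ c0 _ _ _ _ _ _ _ _ (ep / mod v).
case.
- by move=> w w'; rewrite !le_min => /andP[? _] /andP[? _]; apply: lip; rewrite subr0.
- by move=> t th; apply: cd; exact: hd.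
- move=> a b ah bh ab; pose H t := complex.Im (f (c t) * (f (c a))^*).
  have <- : H a = 0 by rewrite /H mulJ.
  apply: (@nonneg_deriv_mono K H (fun t => complex.Im (F1 (c t) * f (c t) * (f (c a))^*))) => // t tab.
    have th := hb _ _ _ ah bh tab.
    have := cderM (f_der (rp _ (hr _ th)) (cd _ (hd _ th))) (cder_cst (f (c a))^* t).
    by rewrite mulr0 addr0 => -[].
  by apply: rC; apply: hr => //; exact: hb tab.
- move=> x /andP[x0 xh]; pose H (t : K) := complex.Im (f t%:C).
  have H0 : H 0 = 0 by rewrite /H f0.
  rewrite -H0 -/(H x).
  have hn : `|0 : K| < h by rewrite normr0.
  have hx : `|x| < h by rewrite ger0_norm.
  apply: (@nonneg_deriv_mono K H (fun t => complex.Im (F1 t%:C))) => // t tx.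
    have th : mod t%:C < r by rewrite modC; apply: hr'; exact: hb tx.
    have := f_der (g := fun u : K => u%:C) (rp _ th) (cdC t).
    by rewrite mulr1 => -[].
  by apply: rI; rewrite modC; apply: hr'; exact: hb tx.
- have -> : [set w | M (phi w)] = phi @^-1` M by [].
  apply: closed_comp; last exact: M_closed.
  move=> w _; apply: mod_cont => e e0.
  have em : 0 < e / mod v by rewrite divr_gt0.
  near=> w'; rewrite modphi mulrC -ltr_pdivlMr //; near: w'; exact: (near_mod w em).
- by move=> w t /= Mw t0; rewrite phi_f; exact: M_ray.
- move=> t /andP[t0 th] ct0 /= Mc.
  have th' : `|t| < h by rewrite gtr0_norm.
  have hn : `|0 : K| < h by rewrite normr0.
  have : Gam P Q M z (Fin (phi (c t))); last by rewrite Gam0.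
  split.
    split.
      exists (phi (c t)); last reflexivity.
      exists t, (fun u => phi (c u)); split.
      - exact: ltW.
      - by rewrite c0 phi0.
      - reflexivity.
      - apply: continuous_in_subspaceT => u /set_mem /=; rewrite in_itv /= => ut.
        by apply: cder_cont; apply: xder; exact: hb ut.
      - split=> u; rewrite in_itv /= => ut.
          by apply: rp; apply: hr; exact: hb ut.
        apply/cderP/xder; apply: (hb 0 t) => //; case/andP: ut => u0 ut.
        by rewrite !ltW.
    move=> [] /eqP; rewrite /phi -subr_eq0 addrAC subrr add0r mulf_eq0 (negPf Rz) /= => /eqP e.
    by apply: ct0; rewrite -[c t]JJ e J0.
  move=> N' [U Uz ->]; exists (Fin (phi (c t))).
  by split; [exists (phi (c t)) => //; exact: nbhs_singleton|exists (phi (c t))].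
- move=> t t0 /=; have [r3 r30 far] := far_ray_out M_closed pz Rz Del0 t0.
  have -> : phi t%:C = z + t%:C * R z by rewrite /phi JC mulrC.
  by apply: far => //; rewrite subrr mod0.
- move=> t0 t00; have [r3 r30 far] := far_ray_out M_closed pz Rz Del0 t00.
  exists (r3 / mod v); first by rewrite divr_gt0.
  move=> w t; rewrite ltr_pdivlMr // => wr tt /=; rewrite phi_f; apply: far => //.
  by have := modphi w 0; rewrite phi0 subr0 mulrC => ->.
- by rewrite divr_gt0.
move=> W [Wo W0 Wb Wr]; exists [set w | W (psi w)]; split.
- rewrite openE => w /= Ww; have : nbhs (psi w) W by apply: open_nbhs_nbhs.
  move=> /(@nbhsCP K _ _).1 [e e0 eP]; apply/(@nbhsCP K _ _).2.
  exists (e * mod v); first by rewrite mulr_gt0.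
  move=> w' ww; apply: eP; have := modphi (psi w') (psi w); rewrite !phiK mulrC => E.
  by rewrite E ltr_pM2r in ww.
- by rewrite /= /psi subrr mul0r J0.
- move=> w /= /Wb /=; rewrite ltr_pdivlMr //.
  by have := modphi (psi w) 0; rewrite phiK phi0 subr0 mulrC => <-.
- move=> w t /= Ww t0 Mw.
  have E : psi (w + t%:C * R w) = psi w + t%:C * f (psi w).
    rewrite /f phiK /psi; have -> : (w + t%:C * R w - z) / v = (w - z) / v + t%:C * (R w / v).
      by field; exact: Rz.
    by rewrite JD [J (t%:C * _)]JM JC.
  by rewrite E; apply: Wr => //=; rewrite phi_f phiK.
Unshelve. all: by end_near.
Qed.

End LocalBarrier.

(** * Boundary points off the curve of inflections *)

Section LocalOrGlobal.
Variable K : realType.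
Variables (P Q : {poly K[i]}) (M : set K[i]).
Hypotheses (P_neq0 : P != 0) (M_minimal : minimal_TCH P Q M).
Local Notation p := (rden P Q).
Local Notation q := (rnum P Q).
Local Notation A := (num1 P Q).
Local Notation R := (Rf P Q).

(** If the polynomial vanishes, then [t R = u - z], so R' is the real constant [- 1 / t] and every
    regular point is on the curve. Off the curve this alternative of invariance is thus void. *)
Lemma degenerate_inflection (u : K[i]) (t : K) z : p.[z] != 0 ->
  t%:C *: Q + P * ('X - u%:P) = 0 -> inflection P Q z.
Proof.
move=> pz E0; have g0 : gcdp P Q != 0 by rewrite gcdp_eq0 negb_and P_neq0.
have E : t%:C *: q + p * ('X - u%:P) = 0.
  apply: (mulIf g0); rewrite mul0r mulrDl -scalerAl rnumE -E0; congr (_ + _).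
  by rewrite mulrAC rdenE.
have t0 : t != 0.
  apply: contra_neq pz => t0; move: E; rewrite t0 scale0r add0r => /eqP.
  by rewrite mulf_eq0 polyXsubC_eq0 orbF => /eqP ->; rewrite horner0.
have E' : t%:C *: A = - (p * p).
  have qE : t%:C *: q = - (p * ('X - u%:P)) by apply/eqP; rewrite -addr_eq0 E.
  rewrite /num1 scalerBr !scalerAl -derivZ qE derivN derivM derivXsubC; ring.
apply/(inflectionP pz).
have := congr1 (horner^~ z) E'; rewrite hornerZ hornerN hornerM => Ez.
have -> : A.[z] * p.[z]^* ^+ 2 = (- (mod p.[z] ^+ 2) ^+ 2 / t)%:C.
  have tC : t%:C != 0 by rewrite fmorph_eq0.
  have -> : (- (mod p.[z] ^+ 2) ^+ 2 / t)%:C = - ((mod p.[z] ^+ 2)%:C) ^+ 2 / t%:C.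
    by rewrite -rmorphXn -fmorphV -rmorphN -rmorphM.
  by rewrite -mulJ; apply: (mulfI tC); rewrite mulrA Ez; field.
by [].
Qed.

(** For [t = 0] the polynomial is [P (X - u)], so the roots of [P] lie in [M]; any other [w] is a
    root of the polynomial attached to [u = w + t R(w)]. *)
Lemma minimal_ray z w (t : K) : p.[z] != 0 -> ~ inflection P Q z -> M z -> ~ M w ->
  0 <= t -> ~ M (w + t%:C * R w).
Proof.
move=> pz nz Mz nMw t0 Mu; have [_ /TCH_invariantP[cM iM] _] := M_minimal.
have [Pw|Pw] := eqVneq P.[w] 0.
  have [/(degenerate_inflection pz)//|H] := iM z 0 Mz (lexx 0).
  by apply/nMw/H; rewrite /root hornerD hornerZ hornerM Pw !mul0r addr0.
have [/(degenerate_inflection pz)//|H] := iM _ t Mu t0.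
apply/nMw/H; rewrite /root hornerD hornerZ hornerM hornerXsubC Rf_eq //.
by apply/eqP; field.
Qed.

Lemma local_or_global z m : ~ zeros_PQ P Q z -> ~ inflection P Q z -> M z -> M m ->
  m <> z -> Gam P Q M z !=set0 \/ Del P Q M z !=set0.
Proof.
move=> nz ni Mz Mm mz; apply: contrapT => /not_orP[G0 D0].
have [_ /TCH_invariantP[cM iM] _] := M_minimal.
move: nz; rewrite /zeros_PQ /= rootM => /negP; rewrite negb_or /root => /andP[Pz Qz].
have EP := congr1 (horner^~ z) (rdenE P Q).
have pz : p.[z] != 0 by move: Pz; rewrite -EP /= hornerM mulf_eq0 negb_or => /andP[].
have Rz : R z != 0 by rewrite Rf_eq // mulf_neq0 // invr_eq0.
have G0' : Gam P Q M z = set0 by apply: contrapT => /eqP /set0P.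
have D0' : Del P Q M z = set0 by apply: contrapT => /eqP /set0P.
have ray w (t : K) := @minimal_ray z w t pz ni Mz.
have turn : complex.Im (A.[z] / p.[z] ^+ 2) != 0.
  apply: contra_notN ni; rewrite Im_div_eq0 ?expf_neq0 // => /eqP e.
  by apply/(inflectionP pz); rewrite -[RHS]e rmorphXn.
have nP : \forall w \near z, P.[w] != 0.
  by apply: near_neq0 => //; exact: horner_continuous_at.
have [r r0 rP] := (@nbhsCP K _ _).1 nP.
(* [r] keeps [P] nonzero on [W], and [mod (m - z)] keeps [m] outside [W], so that [M] minus [W] is
   nonempty. *)
pose ep := Num.min r (mod (m - z)); have ep0 : 0 < ep.
  by rewrite lt_min r0 mod_gt0 subr_eq0; exact/eqP.
have [W [Wo Wz Wb Wr]] : exists W : set K[i],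
  [/\ open W, W z, W `<=` [set w | mod (w - z) < ep] &
   forall w (t : K), W w -> 0 <= t -> M (w + t%:C * R w) -> W (w + t%:C * R w)].
  have [I0|I0] := ltP 0 (complex.Im (A.[z] / p.[z] ^+ 2)).
    exact: (@local_barrier K P Q M z id).
  apply: (@local_barrier K P Q M z (fun w => w^*)) => //.
  - by move=> a b; rewrite rmorphD.
  - by move=> a b; rewrite rmorphM.
  - exact: conjcK.
  - by move=> x; apply: complex_eqP => //=; rewrite oppr0.
  - exact: modJ.
  - by move=> g t u; exact: cderJ.
  - by rewrite ImJ oppr_gt0 lt_neqAle turn.
have iS : alg_invariant P Q (M `&` ~` W).
  split; first by apply: closedI; [exact: cM|exact: open_closedC].
  move=> u t [Mu nWu] t0; have [|H] := iM u t Mu t0; [by left|right=> w wr].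
  split; first exact: H.
  move=> Ww; apply: nWu; have Pw := rP w (_ : mod (w - z) < r).
  have {}Pw : P.[w] != 0 by apply: Pw; move: (Wb _ Ww) => /=; rewrite lt_min => /andP[].
  (* The ray of a root [w] in [W] passes through [u], so the barrier puts [u] in [W] too, a
     contradiction. *)
  have uE : u = w + t%:C * R w.
    rewrite Rf_eq //; move: wr; rewrite /root hornerD hornerZ hornerM hornerXsubC => /eqP e.
    apply/eqP; rewrite -subr_eq0; apply/eqP.
    have -> : u - (w + t%:C * (Q.[w] / P.[w])) = - (t%:C * Q.[w] + P.[w] * (w - u)) / P.[w] by field.
    by rewrite e oppr0 mul0r.
  by rewrite uE; apply: Wr => //; rewrite -uE.
have MW : (M `&` (M `&` ~` W)) !=set0.
  exists m; split => //; split => // /Wb /=.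
  by rewrite lt_min ltxx andbF.
by have [_] := minimal_sub M_minimal iS MW Mz.
Qed.

End LocalOrGlobal.

(** * Bezout's theorem *)

Section Bezout.
Variable L : closedFieldType.
Implicit Types (F G H U : {poly {poly L}}) (c d : {poly L}).

(** Total degree, [i] being the exponent of the inner variable and [j] that of the outer one; these
    will be z and its conjugate. *)
Definition tdeg_le F (n : nat) : Prop := forall i j, F`_j`_i != 0 -> (i + j <= n)%N.

Lemma tdeg_leD F G n : tdeg_le F n -> tdeg_le G n -> tdeg_le (F + G) n.
Proof.
move=> Fn Gn i j; rewrite !coefD; have [->|/Fn//] := eqVneq (F`_j`_i) 0.
by rewrite add0r => /Gn.
Qed.

Lemma tdeg_leN F n : tdeg_le F n -> tdeg_le (- F) n.
Proof. by move=> Fn i j; rewrite !coefN oppr_eq0 => /Fn. Qed.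

Lemma tdeg_le_widen F m n : tdeg_le F m -> (m <= n)%N -> tdeg_le F n.
Proof. by move=> Fm mn i j /Fm h; exact: leq_trans mn. Qed.

Lemma tdeg_leC c n : (size c <= n.+1)%N -> tdeg_le c%:P n.
Proof.
move=> cn i j; rewrite coefC; case: (j =P 0%N) => [->|_]; last by rewrite coef0 eqxx.
rewrite addn0 => ci; have := leq_trans (_ : i < size c)%N cn; rewrite ltnS; apply.
by rewrite ltnNge; apply: contra ci => h; rewrite nth_default.
Qed.

Lemma tdeg_le_map c n : (size c <= n.+1)%N -> tdeg_le (map_poly polyC c) n.
Proof.
move=> cn i j; rewrite coef_map coefC; case: (i =P 0%N) => [->|_]; last by rewrite eqxx.
rewrite add0n => ci; have := leq_trans (_ : j < size c)%N cn; rewrite ltnS; apply.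
by rewrite ltnNge; apply: contra ci => h; rewrite nth_default.
Qed.

Lemma sum_neq0 (I : Type) (r : seq I) (P : pred I) (V : nmodType) (f : I -> V) :
  \sum_(i <- r | P i) f i != 0 -> exists i, f i != 0.
Proof.
move=> h; apply: contrapT => no; case/eqP: h; apply: big1 => i _.
by apply/eqP; apply: contrapT => fi; apply: no; exists i; apply/negP.
Qed.

Lemma coef2M F G i j : (F * G)`_j`_i =
  \sum_(k < j.+1) \sum_(l < i.+1) F`_k`_l * G`_(j - k)`_(i - l).
Proof. by rewrite coefM coef_sum; apply: eq_bigr => k _; rewrite coefM. Qed.

Lemma tdeg_leM F G m n : tdeg_le F m -> tdeg_le G n -> tdeg_le (F * G) (m + n).
Proof.
move=> Fm Gn i j; rewrite coef2M => /sum_neq0[k /sum_neq0[l]].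
rewrite mulf_eq0 negb_or => /andP[/Fm h1 /Gn h2].
by have := ltn_ord k; have := ltn_ord l; rewrite !ltnS; lia.
Qed.

(** The leading monomial for the order by total degree, then by [j]: it maximises [(i + j) * N + j],
    where [N] exceeds every exponent. *)
Lemma top_coef F : F != 0 -> exists i j, F`_j`_i != 0 /\
  forall i' j', F`_j'`_i' != 0 -> (i' + j' <= i + j)%N /\
    (i' + j' = i + j -> j' <= j)%N.
Proof.
move=> F0; pose N := (size F + \max_(k < size F) size (F`_k)%R).+1%N.
have lt i j : F`_j`_i != 0 -> (i < N)%N /\ (j < N)%N.
  move=> h; have jF : (j < size F)%N.
    by rewrite ltnNge; apply: contra h => hj; rewrite (nth_default _ hj) coef0.
  split; last by rewrite /N; lia.
  have : (i < size (F`_j)%R)%N.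
    by rewrite ltnNge; apply: contra h => hj; rewrite nth_default.
  have : (size (F`_j)%R <= \max_(k < size F) size (F`_k)%R)%N.
    exact: (@leq_bigmax _ (fun k : 'I_(size F) => size (F`_k)%R) (Ordinal jF)).
  by rewrite /N; lia.
pose i0 := (size (lead_coef F)).-1; pose j0 := (size F).-1.
have h0 : F`_j0`_i0 != 0.
  by rewrite -[_`_i0]/(lead_coef (lead_coef F)) !lead_coef_eq0.
have [a0 b0] := lt _ _ h0.
pose P (t : 'I_N * 'I_N) := F`_(t.2)`_(t.1) != 0.
pose t0 : 'I_N * 'I_N := (Ordinal a0, Ordinal b0).
case: (@arg_maxnP _ t0 P (fun t => (t.1 + t.2) * N + t.2)%N h0) => -[i j] /= hij mx.
exists i, j; split => // i' j' h; have [a b] := lt _ _ h.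
have /= := mx (Ordinal a, Ordinal b) h; have := ltn_ord j.
set x := (i' + j')%N; set y := (i + j)%N => jN w.
have xy : (x <= y)%N by rewrite leqNgt; apply/negP => yx; nia.
by split => // e; rewrite e leq_add2l in w.
Qed.

(** Leading monomials multiply without cancellation, so total degrees add up. *)
Lemma tdeg_le_divl H F n : H != 0 -> tdeg_le (H * F) n -> tdeg_le F n.
Proof.
move=> H0 HF; have [->|F0] := eqVneq F 0; first by move=> i j; rewrite !coef0 eqxx.
have [a [b [ab Hab]]] := top_coef H0; have [c [d [cd Fcd]]] := top_coef F0.
have : (H * F)`_(b + d)`_(a + c) != 0.
  rewrite coef2M.
  have bl : (b < (b + d).+1)%N by lia. have al : (a < (a + c).+1)%N by lia.
  have key (k l : nat) : (k <= b + d)%N -> (l <= a + c)%N ->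
      H`_k`_l * F`_(b + d - k)`_(a + c - l) != 0 -> k = b /\ l = a.
    move=> kb la; rewrite mulf_eq0 negb_or => /andP[/Hab[h1 h2] /Fcd[h3 h4]]; lia.
  rewrite (bigD1 (Ordinal bl)) //= [X in _ + X]big1 ?addr0.
    rewrite (bigD1 (Ordinal al)) //= [X in _ + X]big1 ?addr0; last first.
      move=> l /eqP nl; apply/eqP; apply: contrapT => /negP /(key _ _ _ _)[||_ e].
      - lia.
      - by have := ltn_ord l; lia.
      - by apply: nl; apply: val_inj.
    by rewrite !addKn mulf_neq0.
  move=> k /eqP nk; apply: big1 => l _; apply/eqP; apply: contrapT => /negP /(key _ _ _ _)[||e _].
  - by have := ltn_ord k; lia.
  - by have := ltn_ord l; lia.
  - by apply: nk; apply: val_inj.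
by move=> /HF h i j /Fcd[h1 _]; lia.
Qed.

Lemma divide_linear H (z : L) : map_poly (horner_eval z) H = 0 ->
  exists H0, H = ('X - z%:P) *: H0.
Proof.
move=> h; exists (\poly_(i < size H) (H`_i %/ ('X - z%:P))).
apply/polyP => i; rewrite coefZ coef_poly; case: ltnP => iH; last by rewrite mulr0 nth_default.
rewrite divpKC // dvdp_XsubCl; have := congr1 (fun f : {poly L} => f`_i) h.
by rewrite coef_map coef0 /= horner_evalE => /eqP.
Qed.

(* Gauss's lemma, removing the roots of c one by one. *)
Lemma scale_factor c F H U : c != 0 -> c *: F = H * U ->
  exists d e H' U', [/\ d != 0, e != 0, H = d *: H', U = e *: U' & F = H' * U'].
Proof.
have [n] := ubnP (size c); elim: n c H U => // n IH c H U cn c0 E.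
have [c1|c1] := leqP (size c) 1.
  have [k k0 cE] : exists2 k : L, k != 0 & c = k%:P.
    by exists c`_0; [move: c0; rewrite {1}(size1_polyC c1) polyC_eq0|exact: size1_polyC].
  exists 1, k%:P, H, (k^-1%:P *: U); split.
  - exact: oner_neq0.
  - by rewrite polyC_eq0.
  - by rewrite scale1r.
  - by rewrite scalerA -polyCM divff // scale1r.
  - by rewrite -scalerAr -E cE scalerA -polyCM mulVf // scale1r.
have /closed_rootP[z rz] : size c != 1%N by rewrite gtn_eqF.
have [c' cE] := factor_theorem c z rz.
have c'0 : c' != 0 by apply: contraNneq c0 => e; rewrite cE e mul0r.
have c'n : (size c' < n)%N.
  by move: cn; rewrite cE size_Mmonic ?monicXsubC // size_XsubC addn2.
have X0 : 'X - z%:P != 0 :> {poly L} by rewrite polyXsubC_eq0.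
have inj (Y Z : {poly {poly L}}) : ('X - z%:P) *: Y = ('X - z%:P) *: Z -> Y = Z.
  by move=> /polyP h; apply/polyP => i; have := h i; rewrite !coefZ; exact: mulfI.
have : map_poly (horner_eval z) H * map_poly (horner_eval z) U == 0.
  rewrite -rmorphM -E; apply/eqP/polyP => i.
  by rewrite coef_map coefZ /= horner_evalE hornerM (rootP rz) mul0r coef0.
rewrite mulf_eq0 => /orP[] /eqP /divide_linear[Y YE].
  have : c' *: F = Y * U by apply: inj; rewrite scalerA mulrC -cE E YE scalerAl.
  move=> /(IH _ _ _ c'n c'0)[d [e [H' [U' [d0 e0 hE uE FE]]]]].
  exists (('X - z%:P) * d), e, H', U'; split => //; first by rewrite mulf_neq0.
  by rewrite YE hE scalerA.
have : c' *: F = H * Y by apply: inj; rewrite scalerA mulrC -cE E YE scalerAr.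
move=> /(IH _ _ _ c'n c'0)[d [e [H' [U' [d0 e0 hE uE FE]]]]].
exists d, (('X - z%:P) * e), H', U'; split => //; first by rewrite mulf_neq0.
by rewrite YE uE scalerA.
Qed.

(** Over the domain [{poly L}] the greatest common divisor divides only up to powers of its leading
    coefficient. [scale_factor], applied to both products, cancels these scalars, so that [H]
    divides [F] and [G] exactly. *)
Lemma coprime_factors F G : F != 0 -> exists H F1 G1,
  [/\ H != 0, F1 != 0, F = H * F1, G = H * G1 & coprimep F1 G1].
Proof.
move=> F0; have cop := @Pdiv.Idomain.coprimep_div_gcd _ F G (introT orP (or_introl F0)).
have g0 : gcdp F G != 0 by rewrite gcdp_eq0 negb_and F0.
have EF := Pdiv.Idomain.divpK (dvdp_gcdl F G); have EG := Pdiv.Idomain.divpK (dvdp_gcdr F G).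
set g := gcdp F G in cop g0 EF EG; set U := F %/ g in cop EF; set V := G %/ g in cop EG.
have lc n : lead_coef g ^+ n != 0 by rewrite expf_neq0 // lead_coef_eq0.
have [d [e [g1 [U1 [d0 e0 gE UE FE]]]]] := scale_factor (lc _) (esym (etrans (mulrC _ _) EF)).
have EG' : lead_coef g ^+ scalp G g *: G = g1 * (d *: V).
  by rewrite -EG gE -!mul_polyC; ring.
have [d' [e' [H [V1 [d0' e0' g1E VE GE]]]]] := scale_factor (lc _) EG'.
exists H, (d' *: U1), V1; split => //.
- by apply: contraNneq g0 => h; rewrite gE g1E h !scaler0.
- by apply: contraNneq F0 => h; rewrite FE g1E -scalerAl scalerAr h mulr0.
- by rewrite FE g1E -scalerAl scalerAr.
rewrite Pdiv.Idomain.coprimepZl // -(Pdiv.Idomain.coprimepZl _ _ e0) -UE.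
by rewrite -(Pdiv.Idomain.coprimepZr _ _ e0') -VE Pdiv.Idomain.coprimepZr.
Qed.

Lemma tdeg_le_size F n l : tdeg_le F n -> F`_l != 0 -> ((size (F`_l)%R).-1 + l <= n)%N.
Proof. by move=> Fn h; apply: Fn; rewrite -/(lead_coef F`_l) lead_coef_eq0. Qed.

Let weight_le (a k j m : nat) : (k <= j)%N -> (a.-1 + (j - k) <= m)%N ->
  (a <= (m + k - j).+1)%N /\ (j <= m + k)%N.
Proof. by lia. Qed.

(** A nonzero entry of the Sylvester matrix in row [i] and column [j] has degree at most [M i - j],
    where [M i] is [m + k] or [n + k] for row [k] of its block. In each term of the determinant the
    columns form a permutation, so its degree is at most [e2 * m + e1 * n - e1 * e2 = m * n - (m -
    e1) * (n - e2)]. *)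
Lemma size_resultant F G m n : F != 0 -> G != 0 -> tdeg_le F m -> tdeg_le G n ->
  (size (resultant F G) <= (m * n).+1)%N.
Proof.
move=> F0 G0 Fm Gn; set e1 := (size F).-1; set e2 := (size G).-1.
have e1m : (e1 <= m)%N.
  by have := tdeg_le_size Fm (_ : F`_e1 != 0); rewrite -/(lead_coef F) lead_coef_eq0 => /(_ F0); lia.
have e2n : (e2 <= n)%N.
  by have := tdeg_le_size Gn (_ : G`_e2 != 0); rewrite -/(lead_coef G) lead_coef_eq0 => /(_ G0); lia.
rewrite /resultant /determinant; apply: leq_trans (size_sum _ _ _) _.
apply/bigmax_leqP => s _; rewrite size_Msign.
pose E i := Sylvester_mx F G i (s i); pose t (i : 'I_(e2 + e1)) : nat := s i.
have -> : \prod_i Sylvester_mx F G i (s i) = \prod_i E i by [].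
have [/existsP[i /eqP i0]|] := boolP [exists i, E i == 0].
  by rewrite (bigD1 i) //= i0 mul0r size_poly0.
rewrite negb_exists => /forallP nz.
pose M (i : 'I_(e2 + e1)) : nat := match fintype.split i with inl k => (m + k)%N | inr k => (n + k)%N end.
have ent (i : 'I_(e2 + e1)) : (size (E i) <= (M i - t i).+1)%N /\ (t i <= M i)%N.
  have := nz i; rewrite /E /t Sylvester_mxE /M; case: (fintype.split i) => k /=.
    case: leqP => [ks|]; last by rewrite mulr0n eqxx.
    by rewrite mulr1n => h; exact: weight_le ks (tdeg_le_size Fm h).
  case: leqP => [ks|]; last by rewrite mulr0n eqxx.
  by rewrite mulr1n => h; exact: weight_le ks (tdeg_le_size Gn h).
have szp : (size (\prod_i E i)%R <= (\sum_i (M i - t i)).+1)%N.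
  elim/big_ind2: _ => [|f a g b ha hb|i _]; [by rewrite size_poly1| |by case: (ent i)].
  by apply: leq_trans (size_polyMleq _ _) _; lia.
apply: leq_trans szp _; rewrite ltnS.
have sum1 : (\sum_i (M i - t i) + \sum_(i < e2 + e1) i = \sum_i M i)%N.
  rewrite [X in (_ + X)%N = _](reindex_inj (@perm_inj _ s)) -big_split /=.
  by apply: eq_bigr => i _; rewrite subnK //; case: (ent i).
have sum2 : (\sum_i M i = \sum_(k < e2) (m + k) + \sum_(k < e1) (n + k))%N.
  rewrite big_split_ord /=; congr (_ + _)%N; apply: eq_bigr => k _; rewrite /M.
    by rewrite -[lshift _ _]/(unsplit (inl k)) unsplitK.
  by rewrite -[rshift _ _]/(unsplit (inr k)) unsplitK.
have sum3 : (\sum_(i < e2 + e1) i = \sum_(k < e2) k + \sum_(k < e1) (e2 + k))%N.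
  by rewrite big_split_ord.
move: sum1; rewrite sum2 sum3 !big_split /= !sum_nat_const !card_ord.
set a := (\sum_i (M i - t i))%N; move: a (\sum_(k < e2) k)%N (\sum_(k < e1) k)%N => a x y.
nia.
Qed.

(** Zeros are counted by their first coordinate, [f] supplying the second, so that distinct points
    of [s] are distinct roots of the resultant. *)
Lemma bezout F G m n (s : seq L) (f : L -> L) : (0 < m)%N -> (0 < n)%N ->
  F != 0 -> coprimep F G -> tdeg_le F m -> tdeg_le G n -> uniq s ->
  (forall z, z \in s -> F.[(f z)%:P].[z] = 0 /\ G.[(f z)%:P].[z] = 0) ->
  (size s <= m * n)%N.
Proof.
move=> m0 n0 F0 cop Fm Gn us sP.
have const (c : {poly L}) k : c != 0 -> tdeg_le c%:P k ->
    (forall z, z \in s -> c.[z] = 0) -> (size s <= k)%N.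
  move=> c0 ck cs; have h : all (root c) s by apply/allP => z /cs e; apply/eqP.
  have := max_poly_roots c0 h us; have := tdeg_le_size ck (_ : c%:P`_0 != 0).
  rewrite coefC eqxx /= => /(_ c0); rewrite addn0; case: (size c) => [|k'] //= h1 h2.
  by rewrite ltnS in h2; exact: leq_trans h2 h1.
(* The resultant identity requires both polynomials to involve the outer variable. If [F] does not,
   the zeros are roots of a single polynomial of degree at most [m]; likewise for [G]. *)
have [F1|F1] := leqP (size F) 1.
  have FE := size1_polyC F1; have f0 : F`_0 != 0 by move: F0; rewrite {1}FE polyC_eq0.
  apply: leq_trans (const F`_0 m f0 _ _) _; [by rewrite -FE| |by rewrite leq_pmulr].
  by move=> z /sP[+ _]; rewrite FE hornerC coefC eqxx.
have [G1|G1] := leqP (size G) 1.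
  have GE := size1_polyC G1.
  have g0 : G`_0 != 0.
    apply: contraTneq cop => g0; rewrite GE g0 Pdiv.Idomain.coprimep_def gcdp0.
    by rewrite neq_ltn F1 orbT.
  apply: leq_trans (const G`_0 n g0 _ _) _; [by rewrite -GE| |by rewrite leq_pmull].
  by move=> z /sP[_ +]; rewrite GE hornerC coefC eqxx.
have G0 : G != 0 by rewrite -size_poly_gt0 (ltn_trans _ G1).
have r0 : resultant F G != 0.
  by rewrite resultant_eq0 -leqNgt; move: cop; rewrite Pdiv.Idomain.coprimep_def => /eqP ->.
have h : all (root (resultant F G)) s.
  apply/allP => z /sP[Fz Gz]; have [[u v] /= _ E] := resultant_in_ideal F1 G1.
  have := congr1 (fun c : {poly {poly L}} => c.[(f z)%:P].[z]) E.
  rewrite /= hornerC hornerD !hornerM hornerD !hornerM Fz Gz !mulr0 addr0 => e.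
  exact/eqP.
by have := leq_trans (max_poly_roots r0 h us) (size_resultant F0 G0 Fm Gn); rewrite ltnS.
Qed.

End Bezout.

(** * Invariant lines *)

Section InvariantLines.
Variable K : realType.
Variables (P Q : {poly K[i]}).
Hypotheses (P_neq0 : P != 0) (Q_neq0 : Q != 0) (B_neq0 : num2 P Q != 0).
Local Notation p := (rden P Q).
Local Notation q := (rnum P Q).
Local Notation A := (num1 P Q).
Local Notation B := (num2 P Q).
Local Notation R := (Rf P Q).
Local Notation dR w := (A.[w] / p.[w] ^+ 2).

Lemma Im_conj (z : K[i]) : complex.Im z = 0 <-> z^* = z.
Proof.
case: z => x y /=; split=> [->|[] /eqP]; first by rewrite oppr0.
by rewrite -subr_eq0 -opprD oppr_eq0 -mulr2n mulrn_eq0 => /eqP.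
Qed.

Lemma cder_dR (g : K -> K[i]) (t : K) v : p.[g t] != 0 -> cder g t v ->
  cder (fun s => dR (g s)) t (B.[g t] / p.[g t] ^+ 3 * v).
Proof.
move=> pg gv; have hp := cder_horner p gv.
have p2 : p.[g t] * p.[g t] != 0 by rewrite mulf_neq0.
have := cderM (cder_horner A gv) (cderV p2 (cderM hp hp)).
set d := (X in cder _ _ X -> _); have -> : d = B.[g t] / p.[g t] ^+ 3 * v.
  by rewrite /d num2E; field.
by apply: cder_near; near=> s; rewrite expr2.
Unshelve. all: by end_near.
Qed.

Lemma infl_fun_dR z : p.[z] != 0 -> infl_fun P Q z = 0 <-> complex.Im (dR z) = 0.
Proof.
move=> pz; have := Im_div_eq0 A.[z] (expf_neq0 2 pz).
have -> : (p.[z] ^+ 2)^* = p.[z]^* * p.[z]^* by rewrite expr2 conjM.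
by move=> h; split => /eqP e; apply/eqP; [rewrite h|rewrite -h].
Qed.

Lemma infl_gradE z : p.[z] != 0 ->
  infl_grad P Q z = (mod p.[z] ^+ 2)%:C ^+ 2 * (B.[z] / p.[z] ^+ 3).
Proof. by move=> pz; rewrite /infl_grad -mulJ; field. Qed.

Definition invariant_line (a v : K[i]) : Prop := forall t : K,
  p.[a + t%:C * v] != 0 -> complex.Im (R (a + t%:C * v) / v) = 0.

Let cder_line (a v : K[i]) (t : K) : cder (fun s : K => a + s%:C * v) t v.
Proof.
have h : cder (fun s : K => s%:C) t 1 by apply: (@cder_real K id t 1); exact: is_derive_id.
have := cderD (cder_cst a t) (cderM h (cder_cst v t)).
by rewrite add0r mul1r mulr0 addr0.
Qed.

Let near_line (U : set K[i]) (a v : K[i]) (t : K) : (\forall w \near a + t%:C * v, U w) ->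
  \forall s \near t, U (a + s%:C * v).
Proof. by move=> h; apply: (cder_cont (cder_line a v t)). Qed.

(** Along the line R / v is real, hence so are its successive derivatives R' and R'' v. The product
    of R / v and R'' v is then real, which is the tangency equation. *)
Lemma invariant_line_tangency a v z : v != 0 -> invariant_line a v -> line a v z ->
  p.[z] != 0 -> B.[z] != 0 -> tangency_locus P Q z.
Proof.
move=> v0 inv [t ->]; set z' := a + t%:C * v => pz Bz.
have step1 (s : K) : p.[a + s%:C * v] != 0 -> complex.Im (dR (a + s%:C * v)) = 0.
  move=> ps; have := cderM (cder_Rf ps (cder_line a v s)) (cder_cst v^-1 s).
  rewrite mulr0 addr0 mulfK // => h; apply: (cder_Re0 h).
  by have := near_line (near_rden ps); apply: filterS => s' /inv.
have h2 : complex.Im (B.[z'] / p.[z'] ^+ 3 * v) = 0.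
  apply: (cder_Re0 (cder_dR pz (cder_line a v t))).
  by have := near_line (near_rden pz); apply: filterS => s'; exact: step1.
apply/tangency_locusP => //; split => //.
  by apply/inflection_fun => //; apply/infl_fun_dR => //; exact: step1.
rewrite infl_gradE //.
have h1 := (Im_conj _).1 (inv t pz); rewrite -/z' in h1; have {}h2 := (Im_conj _).1 h2.
set X := (mod p.[z'] ^+ 2)%:C ^+ 2; have XJ : X^* = X.
  by rewrite /X -rmorphXn; apply/Im_conj.
apply/Im_conj; have -> : R z' * (X * (B.[z'] / p.[z'] ^+ 3)) =
   (R z' / v) * (X * (B.[z'] / p.[z'] ^+ 3 * v)) by field; exact/andP.
by rewrite conjM [(X * _)^*]conjM h1 h2 XJ.
Qed.

(** Otherwise R' would be real around [z], and R''(z) v real for every [v], in particular for 1 and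
    ['i]. *)
Lemma inflection_thin z : p.[z] != 0 -> B.[z] != 0 ->
  ~ \forall w \near z, infl_fun P Q w = 0.
Proof.
move=> pz Bz h; have n : \forall w \near z, complex.Im (dR w) = 0.
  near=> w; apply/infl_fun_dR; first by near: w; exact: near_rden.
  by near: w.
have E v : complex.Im (B.[z] / p.[z] ^+ 3 * v) = 0.
  have e : z + (0 : K)%:C * v = z by rewrite mul0r addr0.
  have c := cder_line z v 0; have pe : p.[z + (0 : K)%:C * v] != 0 by rewrite e.
  have := cder_dR pe c; rewrite e => h'; apply: (cder_Re0 h').
  by apply: (near_line (U := fun w => complex.Im (dR w) = 0)); rewrite e.
have /eqP : B.[z] / p.[z] ^+ 3 = 0.
  have := E 'i; have := E 1; rewrite mulr1; move: (_ / _) => [x y] /= y0.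
  by rewrite y0 mulr1 mulr0 addr0 => ->.
by rewrite mulf_eq0 (negPf Bz) invr_eq0 expf_eq0 (negPf pz).
Unshelve. all: by end_near.
Qed.

Lemma nonroot (f : {poly K[i]}) : f != 0 -> exists z, f.[z] != 0.
Proof.
move=> f0; apply: contrapT => h; case/eqP: f0.
apply: (@infinite_ball_poly K f 0 1) => // x _; apply/eqP; apply: contrapT => /eqP h'.
by apply: h; exists (0 + x%:C).
Qed.

Local Notation cj f := (map_poly (fun w : K[i] => w^*) f).
Local Notation lf f a v := (f \Po (a%:P + v *: 'X)).

Lemma horner_cj (f : {poly K[i]}) z : (cj f).[z^*] = (f.[z])^*.
Proof. exact: (horner_map (@conjc K)). Qed.

Lemma horner_lf (f : {poly K[i]}) a v x : (lf f a v).[x] = f.[a + v * x].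
Proof. by rewrite horner_comp hornerD hornerC hornerZ hornerX. Qed.

Let conj_real (t : K) : (t%:C)^* = t%:C.
Proof. by apply: complex_eqP => //=; rewrite oppr0. Qed.

Lemma horner_cjlf (f : {poly K[i]}) a v x : (cj (lf f a v)).[x] = (cj f).[a^* + v^* * x].
Proof.
have -> : x = (x^*)^* by rewrite conjcK.
by rewrite horner_cj horner_lf -horner_cj conjD conjM.
Qed.

(** At a real [t] where [p] does not vanish, this is a nonzero multiple of the imaginary part of R /
    v. So invariance of a line is the vanishing of one polynomial. *)
Definition line_poly (a v : K[i]) : {poly K[i]} :=
  v^* *: (lf q a v * cj (lf p a v)) - v *: (cj (lf q a v) * lf p a v).

Lemma horner_line_poly a v (t : K) (w := a + t%:C * v) : (line_poly a v).[t%:C] =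
  v^* * (q.[w] * p.[w]^*) - v * (q.[w]^* * p.[w]).
Proof.
rewrite /line_poly hornerD hornerN !hornerZ !hornerM !horner_cjlf !horner_lf.
have -> : a^* + v^* * t%:C = (a + v * t%:C)^* by rewrite conjD conjM conj_real.
by rewrite !horner_cj /w [t%:C * v]mulrC.
Qed.

Lemma real_ratio a v (t : K) (w := a + t%:C * v) : v != 0 -> p.[w] != 0 ->
  complex.Im (R w / v) = 0 <-> (line_poly a v).[t%:C] = 0.
Proof.
move=> v0 pw; rewrite horner_line_poly -/w Im_conj /Rf.
have pJ : p.[w]^* != 0 by rewrite -mod_gt0 modJ mod_gt0.
have vJ : v^* != 0 by rewrite -mod_gt0 modJ mod_gt0.
have -> : (q.[w] / p.[w] / v)^* = q.[w]^* / p.[w]^* / v^*.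
  by rewrite !conjM !fmorphV.
split=> [h|/eqP]; last first.
  rewrite subr_eq0 => /eqP h.
  apply: (mulIf pJ); apply: (mulIf vJ); apply: (mulIf pw); apply: (mulIf v0).
  transitivity (v * (q.[w]^* * p.[w])); first by field; rewrite pJ vJ.
  by rewrite -h; field; rewrite pw v0.
have -> : q.[w]^* = (q.[w] / p.[w] / v) * p.[w]^* * v^* by rewrite -h; field; rewrite pJ vJ.
by field; rewrite pw v0.
Qed.

Lemma invariant_lineP a v : v != 0 -> invariant_line a v <-> line_poly a v = 0.
Proof.
move=> v0; split=> [inv|D0 t pw]; last by apply/real_ratio => //; rewrite D0 horner0.
apply: (@infinite_ball_poly K _ 0 1) => // t _; rewrite add0r /root.
have [pw|pw] := eqVneq p.[a + t%:C * v] 0; last by apply/eqP/real_ratio => //; exact: inv.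
by rewrite horner_line_poly pw conjc0 !mulr0 subrr.
Qed.

(** Restricted to the line, [p] and [q] stay coprime, so the vanishing of [line_poly] makes each
    divide its own conjugate, which has the same size. Their roots are thus symmetric about the
    line. *)
Lemma invariant_line_conj a v : v != 0 -> invariant_line a v ->
  exists nu, cj (lf (p * q) a v) = nu *: lf (p * q) a v.
Proof.
move=> v0 /(invariant_lineP _ v0) /eqP; rewrite subr_eq0 => /eqP D.
have vJ : v^* != 0 by rewrite -mod_gt0 modJ mod_gt0.
have sz (f : {poly K[i]}) : size (cj f) = size f.
  by apply: (size_map_poly (@conjc K)).
have cop : coprimep (lf p a v) (lf q a v).
  by apply: coprimep_comp_poly; exact: rden_rnum_coprime.
have ext (f : {poly K[i]}) : lf f a v %| cj (lf f a v) ->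
    exists c, cj (lf f a v) = c *: lf f a v.
  move=> /dvdp_size_eqp; rewrite sz eqxx => /esym; rewrite eqp_sym => /eqpf_eq[c _ ->].
  by exists c.
have [c1 e1] : exists c, cj (lf p a v) = c *: lf p a v.
  apply: ext; rewrite -(Gauss_dvdpr _ cop) -(dvdpZr _ _ vJ) D dvdpZr //.
  by rewrite dvdp_mull.
have [c2 e2] : exists c, cj (lf q a v) = c *: lf q a v.
  have cop' : coprimep (lf q a v) (lf p a v) by rewrite coprimep_sym.
  apply: ext; rewrite -(Gauss_dvdpl _ cop') -(dvdpZr _ _ v0) -D dvdpZr //.
  by rewrite dvdp_mulr.
exists (c1 * c2); rewrite comp_polyM.
have -> : cj (lf p a v * lf q a v) = cj (lf p a v) * cj (lf q a v).
  exact: (rmorphM (map_poly (@conjc K))).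
by rewrite e1 e2 -scalerAl -scalerAr scalerA.
Qed.

(* Differentiating S preserves the symmetry, so that the center of symmetry is
   the one of a linear polynomial: the centroid of the roots of S. *)
Lemma symmetry_center (S : {poly K[i]}) : (1 < size S)%N -> exists c, forall a v nu,
  v != 0 -> cj (lf S a v) = nu *: lf S a v -> complex.Im ((c - a) / v) = 0.
Proof.
have [n] := ubnP (size S); elim: n S => // n IH S Sn S1.
have [S2|S2] := eqVneq (size S) 2%N.
  have SE w : S.[w] = S`_0 + S`_1 * w.
    by rewrite horner_coef S2 !big_ord_recl big_ord0 expr0 mulr1 expr1 addr0.
  have s1 : S`_1 != 0.
    have : lead_coef S != 0 by rewrite lead_coef_eq0 -size_poly_eq0 S2.
    by rewrite /lead_coef S2.
  exists (- S`_0 / S`_1) => a v nu v0 /polyP E.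
  have h x : (S.[a + v * x^*])^* = nu * S.[a + v * x].
    have : (cj (lf S a v)).[x] = (nu *: lf S a v).[x] by congr horner; apply/polyP.
    rewrite hornerZ horner_lf horner_cjlf => <-.
    by rewrite -horner_cj conjD conjM conjcK.
  have h0 := h 0; have h1 := h 1; rewrite conjc0 conjc1 mulr0 addr0 in h0 h1.
  rewrite mulr1 in h1.
  set y := S.[a] in h0; have xE : S.[a + v] = y + S`_1 * v by rewrite /y !SE; ring.
  rewrite xE conjD h0 mulrDr in h1.
  have {}h1 : (S`_1 * v)^* = nu * (S`_1 * v) by apply: (addrI (nu * y)).
  have x0 : S`_1 * v != 0 by rewrite mulf_neq0.
  have xJ : nu * (S`_1 * v) != 0 by rewrite -h1 -mod_gt0 modJ mod_gt0.
  have nu0 : nu != 0 by apply: contraNneq xJ => ->; rewrite mul0r.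
  have -> : (- S`_0 / S`_1 - a) / v = - (y / (S`_1 * v)).
    by rewrite /y SE; field; rewrite s1 v0.
  rewrite ImN; apply/eqP; rewrite oppr_eq0; apply/eqP/Im_conj.
  rewrite conjM fmorphV /= h0 h1; field.
  by rewrite nu0 s1 v0.
have S3 : (2 < size S)%N by rewrite ltn_neqAle eq_sym S2.
have d0 : S^`()`_(size S - 2) != 0.
  have n0 : ((size S - 2).+1%:R : K[i]) != 0 by rewrite pnatr_eq0.
  rewrite coef_deriv -mulr_natr mulf_neq0 //.
  have -> : (size S - 2).+1 = (size S).-1 by lia.
  rewrite -/(lead_coef S) lead_coef_eq0 -size_poly_gt0; exact: ltn_trans S1.
have sd : (1 < size S^`())%N.
  rewrite ltnNge; apply: contra d0 => h; rewrite nth_default //; apply: leq_trans h _; lia.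
have sd' : (size S^`() < n)%N.
  have : (size S^`() < size S)%N.
    by apply: lt_size_deriv; rewrite -size_poly_gt0; exact: ltn_trans S1.
  by move=> h; apply: leq_trans h _; rewrite -ltnS.
have [c cP] := IH _ sd' sd; exists c => a v nu v0 E.
have vJ : v^* != 0 by rewrite -mod_gt0 modJ mod_gt0.
apply: (cP a v (nu * v / v^*) v0).
have dl : (lf S a v)^`() = v *: lf S^`() a v.
  by rewrite deriv_comp derivD derivC derivZ derivX add0r -scalerAr mulr1.
have := congr1 (@deriv _) E; rewrite derivZ.
have -> : (cj (lf S a v))^`() = cj ((lf S a v)^`()) by exact: (deriv_map (@conjc K) _).
rewrite dl; have -> : cj (v *: lf S^`() a v) = v^* *: cj (lf S^`() a v).
  exact: (map_polyZ (@conjc K)).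
move=> h; apply: (scalerI vJ); rewrite h !scalerA; congr (_ *: _).
by field.
Qed.

(** Evaluating [line_poly c v] at [x / v] and dividing by [v] leaves an expression in [u = v^* / v]
    alone, with [x] as a parameter. This [u] determines the direction up to a real factor. *)
Definition direction_poly (c x : K[i]) : {poly K[i]} :=
  q.[c + x] *: ('X * (cj p \Po ((c^*)%:P + x *: 'X))) -
  p.[c + x] *: (cj q \Po ((c^*)%:P + x *: 'X)).

Lemma horner_direction_poly c x u : (direction_poly c x).[u] =
  q.[c + x] * (u * (cj p).[c^* + x * u]) - p.[c + x] * (cj q).[c^* + x * u].
Proof.
by rewrite /direction_poly hornerD hornerN !hornerZ hornerM hornerX !horner_comp !hornerD
  !hornerC !hornerZ !hornerX.
Qed.

Lemma size_direction_poly c x : (size (direction_poly c x) <= deg P + deg Q + 2)%N.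
Proof.
have sz (f : {poly K[i]}) : size (cj f) = size f by apply: (size_map_poly (@conjc K)).
have sl : (size ((c^*)%:P + x *: 'X)%R <= 2)%N.
  rewrite (leq_trans (size_polyD _ _)) // geq_max (leq_trans (size_polyC_leq1 _)) //.
  by rewrite (leq_trans (size_scale_leq _ _)) // size_polyX.
have sc (f g : {poly K[i]}) : (size f <= (size g).-1.+1)%N ->
    (size (cj f \Po ((c^*)%:P + x *: 'X))%R <= (size g).-1.+1)%N.
  move=> fg; apply: leq_trans (size_comp_poly_leq _ _) _; rewrite sz ltnS.
  apply: leq_trans (leq_mul (leqnn _) (_ : _ <= 1)%N) _; first by move: sl; lia.
  by rewrite muln1; move: fg; lia.
have pP : (size p <= (size P).-1.+1)%N by apply: leq_trans (size_rden _ _) _; lia.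
have qQ : (size q <= (size Q).-1.+1)%N by apply: leq_trans (size_rnum _ _) _; lia.
have := sc _ _ pP; have := sc _ _ qQ; set f := cj q \Po _; set g := cj p \Po _ => hf hg.
rewrite /direction_poly -/f -/g /deg; apply: leq_trans (size_polyD _ _) _.
rewrite geq_max size_polyN; apply/andP; split; apply: leq_trans (size_scale_leq _ _) _.
  apply: leq_trans (size_polyMleq _ _) _; rewrite size_polyX add2n /=.
  by apply: leq_ltn_trans hg _; rewrite addn2 !ltnS leq_addr.
by apply: leq_trans hf _; rewrite addn2 ltnS (leq_trans (leq_addl _ _) (leqnSn _)).
Qed.

Lemma invariant_direction c v x : v != 0 -> invariant_line c v ->
  root (direction_poly c x) (v^* / v).
Proof.
move=> v0 /(invariant_lineP _ v0) D; have := congr1 (fun f => f.[x / v]) D.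
rewrite /= horner0 /line_poly hornerD hornerN !hornerZ !hornerM !horner_cjlf !horner_lf.
have -> : v * (x / v) = x by field.
have -> : v^* * (x / v) = x * (v^* / v) by field.
move=> h; rewrite /root horner_direction_poly; apply/eqP; apply: (mulfI v0).
by rewrite mulr0 -[RHS]h; field.
Qed.

Lemma direction_invariant c : (forall x, direction_poly c x = 0) ->
  forall v, v != 0 -> invariant_line c v.
Proof.
move=> h v v0 t pw; apply/real_ratio => //; rewrite horner_line_poly.
have := congr1 (fun f => f.[v^* / v]) (h (t%:C * v)).
rewrite /= horner0 horner_direction_poly.
have -> : c^* + t%:C * v * (v^* / v) = (c + t%:C * v)^*.
  by rewrite conjD conjM conj_real; field.
rewrite !horner_cj => e; rewrite -[RHS](mulr0 v) -e; by field.
Qed.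

Lemma direction_poly_neq0 c : exists x, direction_poly c x != 0.
Proof.
apply: contrapT => no; have all0 x : direction_poly c x = 0.
  by apply/eqP; apply: contrapT => /negP h; apply: no; exists x.
have f0 : p * B * ('X - c%:P) != 0.
  by rewrite !mulf_neq0 ?polyXsubC_eq0 // rden_neq0.
have [z zP] := nonroot f0.
move: (zP); rewrite !hornerM !mulf_eq0 !negb_or => /andP[/andP[pz Bz] _].
apply: (inflection_thin pz Bz); near=> w.
have : (p * B * ('X - c%:P)).[w] != 0.
  by near: w; apply: near_neq0 zP; exact: horner_continuous_at.
rewrite !hornerM hornerXsubC !mulf_eq0 !negb_or => /andP[/andP[pw Bw] wc].
apply/inflection_fun => //.
have inv := direction_invariant all0 wc.
have lw : line c (w - c) w by exists 1; rewrite mul1r addrC subrK.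
by have [] := (tangency_locusP P_neq0 B_neq0 w).1 (invariant_line_tangency wc inv lw pw Bw).
Unshelve. all: by end_near.
Qed.

Lemma line_reparam (a v c v' : K[i]) : v != 0 -> v' != 0 -> v^* / v = v'^* / v' ->
  complex.Im ((c - a) / v) = 0 -> forall w, line a v w <-> line c v' w.
Proof.
move=> v0 v0' uu ca w.
have r1 : complex.Im (v / v') = 0.
  apply/Im_conj; rewrite conjM fmorphV /=.
  have vJ' : v'^* != 0 by rewrite -mod_gt0 modJ mod_gt0.
  have -> : v^* = v'^* / v' * v by rewrite -uu; field.
  by field; rewrite vJ' v0'.
have rC (x : K[i]) : complex.Im x = 0 -> x = (complex.Re x)%:C.
  by move=> x0; apply: complex_eqP.
have cE := rC _ ca; have vE := rC _ r1.
have v1 : v / v' != 0 by rewrite mulf_neq0 ?invr_eq0.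
have vx : complex.Re (v / v') != 0 by apply: contraNneq v1 => e; rewrite vE e.
split=> -[t ->].
  exists ((t - complex.Re ((c - a) / v)) * complex.Re (v / v')).
  set x := complex.Re ((c - a) / v) in cE *; set y := complex.Re (v / v') in vE *.
  have -> : ((t - x) * y)%:C = (t%:C - x%:C) * y%:C by rewrite rmorphM rmorphB.
  by rewrite -vE -cE; field; rewrite v0 v0'.
exists (complex.Re ((c - a) / v) + t / complex.Re (v / v')).
set x := complex.Re ((c - a) / v) in cE *; set y := complex.Re (v / v') in vE *.
have -> : (x + t / y)%:C = x%:C + t%:C / y%:C by rewrite rmorphD rmorphM fmorphV.
rewrite -vE -cE; field.
by rewrite v0 v0'.
Qed.

Lemma invariant_line_reparam a v c v' : v != 0 -> v' != 0 -> v^* / v = v'^* / v' ->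
  complex.Im ((c - a) / v) = 0 -> invariant_line a v -> invariant_line c v'.
Proof.
move=> v0 v0' uu ca inv t; have [s sE] := (line_reparam v0 v0' uu ca (c + t%:C * v')).2
  (ex_intro _ t erefl).
rewrite sE => ps; have := inv s ps; move/Im_conj => h; apply/Im_conj.
have vJ : v^* != 0 by rewrite -mod_gt0 modJ mod_gt0.
have vJ' : v'^* != 0 by rewrite -mod_gt0 modJ mod_gt0.
set w := a + s%:C * v in h *; rewrite conjM fmorphV /= in h; rewrite conjM fmorphV /=.
have -> : (R w)^* = R w / v * v^* by rewrite -h; field.
have -> : v^* = v'^* / v' * v by rewrite -uu; field.
by field; rewrite vJ' v0 v0'.
Qed.

(** Every invariant line passes through the centre [c] and its direction is a root of
    [direction_poly c x]. Roots that give no invariant line are filtered out. *)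
Lemma invariant_lines : exists lines : seq (K[i] * K[i]),
  [/\ (size lines <= deg P + deg Q + 1)%N,
      forall l, l \in lines -> l.2 != 0 /\ invariant_line l.1 l.2 &
      forall a v w, v != 0 -> invariant_line a v -> line a v w ->
        exists2 l, l \in lines & line l.1 l.2 w].
Proof.
have S1 : (1 < size (p * q)%R)%N.
  rewrite ltnNge; apply: contra B_neq0 => s1.
  have p0 := rden_neq0 Q P_neq0; have q0 := rnum_neq0 P Q_neq0.
  move: s1; rewrite size_mul //.
  have := size_poly_gt0 p; have := size_poly_gt0 q; rewrite p0 q0 => q1 p1 s1.
  have aux (i j : nat) : (0 < i)%N -> (0 < j)%N -> ((i + j).-1 <= 1)%N ->
      (i <= 1)%N /\ (j <= 1)%N by lia.
  have [sp sq] := aux _ _ p1 q1 s1.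
  have cq : q^`() = 0 by rewrite (size1_polyC sq) derivC.
  have cp : p^`() = 0 by rewrite (size1_polyC sp) derivC.
  have A0 : A = 0 by rewrite /num1 cq cp mul0r mulr0 subrr.
  by rewrite /num2 A0 deriv0 !mul0r mul0rn subrr.
have [c cP] := symmetry_center S1; have [x x0] := direction_poly_neq0 c.
have [rs rsE] := closed_field_poly_normal (direction_poly c x).
have lc : lead_coef (direction_poly c x) != 0 by rewrite lead_coef_eq0.
have rsP u : root (direction_poly c x) u -> u \in rs.
  by rewrite rsE rootZ // root_prod_XsubC.
have rs_size : (size rs <= deg P + deg Q + 1)%N.
  have := size_direction_poly c x; rewrite rsE size_scale // size_prod_XsubC.
  by rewrite addn2 addn1 ltnS.
(* Recovers a direction from [u = v^* / v]: as [u] has modulus 1, [1 + u] is [u] times its conjugate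
   [1 + u^*]. For [u = -1] this direction degenerates and [i] is taken. *)
pose vd (u : K[i]) : K[i] := if u == -1 then 0 +i* 1 else 1 + u^*.
pose ok (l : K[i] * K[i]) := `[< l.2 != 0 /\ invariant_line l.1 l.2 >].
exists [seq l <- [seq (c, vd u) | u <- rs] | ok l]; split.
- by apply: leq_trans rs_size; rewrite size_filter (leq_trans (count_size _ _)) // size_map.
- by move=> l; rewrite mem_filter => /andP[/asboolP].
move=> a v w v0 inv lw; have [nu nuE] := invariant_line_conj v0 inv.
have ca := cP a v nu v0 nuE; set u := v^* / v.
have vJ : v^* != 0 by rewrite -mod_gt0 modJ mod_gt0.
have uJ : u^* * u = 1 by rewrite /u conjM fmorphV /= conjcK; field; rewrite v0 vJ.
have [vd0 vdu] : vd u != 0 /\ v^* / v = (vd u)^* / vd u.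
  rewrite /vd -/u; case: (u =P -1) => [u1|/eqP u1]; first rewrite u1.
    split; first by apply/eqP => -[] /eqP; rewrite oner_eq0.
    have iJ : (0 +i* 1 : K[i])^* = - (0 +i* 1) by apply: complex_eqP => //=; rewrite oppr0.
    have i0 : (0 +i* 1 : K[i]) != 0 by apply/eqP => -[] /eqP; rewrite oner_eq0.
    by rewrite iJ; field.
  have n0 : 1 + u^* != 0.
    apply: contraNneq u1 => e; have -> : u = u * (- u^*) + u * (1 + u^*) by ring.
    by rewrite e mulr0 addr0 mulrN mulrC uJ.
  split => //; rewrite conjD conjcK conjc1.
  have -> : 1 + u = u * (1 + u^*) by rewrite mulrDr mulr1 mulrC uJ addrC.
  by rewrite mulfK.
have invc : invariant_line c (vd u) := invariant_line_reparam v0 vd0 vdu ca inv.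
exists (c, vd u); last by apply/(line_reparam v0 vd0 vdu ca).
rewrite mem_filter; apply/andP; split; first exact/asboolP.
apply: map_f; apply: rsP.
have invcv : invariant_line c v by exact: invariant_line_reparam inv.
exact: invariant_direction.
Qed.

End InvariantLines.

(** * The tangency locus *)

Section Evaluation.
Variable K : realType.
Implicit Types (F G : {poly {poly K[i]}}).

(** The outer variable stands for the conjugate of [z]. *)
Definition ev F (z : K[i]) : K[i] := F.[(z^*)%:P].[z].

Lemma evD F G z : ev (F + G) z = ev F z + ev G z.
Proof. by rewrite /ev !hornerD. Qed.

Lemma evN F z : ev (- F) z = - ev F z.
Proof. by rewrite /ev !hornerN. Qed.

Lemma evM F G z : ev (F * G) z = ev F z * ev G z.
Proof. by rewrite /ev !hornerM. Qed.

Lemma evC c z : ev c%:P z = c.[z].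
Proof. by rewrite /ev hornerC. Qed.

Lemma ev_map c z : ev (map_poly polyC c) z = c.[z^*].
Proof. by rewrite /ev horner_map hornerC. Qed.

Let ev_ind F c z : ev (F * 'X + c%:P) z = ev F z * z^* + c.[z].
Proof. by rewrite /ev hornerMXaddC hornerD hornerM hornerC. Qed.

Lemma cont_ev F z : {for z, continuous (ev F)}.
Proof.
elim/poly_ind: F => [|F c IH].
  have -> : ev 0 = fun _ => 0 by apply/funext => w; rewrite /ev !horner0.
  exact: contC_cst.
have -> : ev (F * 'X + c%:P) = fun w => ev F w * w^* + c.[w].
  by apply/funext => w; exact: ev_ind.
apply: contC_D; last exact: horner_continuous_at.
by apply: contC_M; [exact: IH|apply: contC_J; exact: cvg_id].
Qed.

Lemma cder_ev F (g : K -> K[i]) (t : K) v : cder g t v ->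
  exists u, cder (fun s => ev F (g s)) t u.
Proof.
move=> gv; elim/poly_ind: F => [|F c [u IH]].
  exists 0; have -> : (fun s => ev 0 (g s)) = fun _ => 0.
    by apply/funext => s; rewrite /ev !horner0.
  exact: cder_cst.
exists (u * (g t)^* + ev F (g t) * v^* + c^`().[g t] * v).
have -> : (fun s => ev (F * 'X + c%:P) (g s)) = fun s => ev F (g s) * (g s)^* + c.[g s].
  by apply/funext => s; exact: ev_ind.
exact: cderD (cderM IH (cderJ gv)) (cder_horner c gv).
Qed.

End Evaluation.

Lemma near_mem_seq (K : realType) (s : seq K[i]) (z : K[i]) :
  \forall w \near z, w \in s -> w = z.
Proof.
elim: s => [|a s IH]; first by near=> w; rewrite in_nil.
have [za|za] := eqVneq a z.
  by apply: filterS IH => w h; rewrite in_cons => /orP[/eqP ->|].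
have n : \forall w \near z, w - a != 0.
  apply: near_neq0; last by rewrite subr_eq0 eq_sym.
  by apply: contC_D; [exact: cvg_id|exact: contC_cst].
near=> w; rewrite in_cons => /orP[/eqP wa|].
  by have : w - a != 0 by [near: w]; rewrite wa subrr eqxx.
by near: w.
Unshelve. all: by end_near.
Qed.

Lemma bounded_seq_set (T : choiceType) (F : set T) (N : nat) :
  (forall s : seq T, uniq s -> (forall x, x \in s -> F x) -> (size s <= N)%N) ->
  exists s : seq T, (size s <= N)%N /\ (forall x, F x <-> x \in s).
Proof.
move=> H; pose S n := `[< exists s : seq T, [/\ uniq s, (forall x, x \in s -> F x) & size s = n] >].
have S0 : exists n, S n by exists 0%N; apply/asboolP; exists [::].
have SN n : S n -> (n <= N)%N by move=> /asboolP[s [us sF <-]]; exact: H.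
have [n /asboolP[s [us sF sn]] mx] := ex_maxnP S0 SN.
exists s; split; first by rewrite sn; apply: SN; apply/asboolP; exists s.
move=> x; split; last exact: sF.
move=> Fx; apply: contrapT => /negP xs; have /mx : S (size s).+1.
  apply/asboolP; exists (x :: s); split => //=; first by rewrite xs.
  by move=> y; rewrite in_cons => /orP[/eqP ->|/sF].
by rewrite sn ltnn.
Qed.

Lemma card_le_seq (K : realType) (A : set K[i]) (s : seq K[i]) (N : nat) :
  (size s <= N)%N -> (forall x, A x -> x \in s) -> A #<= `I_N.
Proof.
move=> sN H; apply: card_le_trans (card_image_le (nth 0 s) `I_N).
apply: subset_card_le => x /H xs; exists (index x s); last exact: nth_index.
by apply: leq_trans sN; rewrite index_mem.
Qed.

Lemma card_le_roots (K : realType) (A : set K[i]) (f : {poly K[i]}) (N : nat) :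
  f != 0 -> (size f <= N.+1)%N -> (forall x, A x -> root f x) -> A #<= `I_N.
Proof.
move=> f0 fN H; have bd (s : seq K[i]) : uniq s -> (forall x, x \in s -> A x) -> (size s <= N)%N.
  move=> us sA; have h : all (root f) s by apply/allP => x /sA /H.
  by have := leq_trans (max_poly_roots f0 h us) fN; rewrite ltnS.
have [s [sN sP]] := bounded_seq_set bd.
by apply: (@card_le_seq _ _ s) => // x /sP.
Qed.

(** * Equations of the tangency locus and its isolated points *)

Section TangencyStructure.
Variable K : realType.
Variables (P Q : {poly K[i]}).
Hypotheses (P_neq0 : P != 0) (Q_neq0 : Q != 0) (B_neq0 : num2 P Q != 0).
Local Notation p := (rden P Q).
Local Notation q := (rnum P Q).
Local Notation A := (num1 P Q).
Local Notation B := (num2 P Q).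
Local Notation R := (Rf P Q).
Local Notation dR w := (A.[w] / p.[w] ^+ 2).
Local Notation cj f := (map_poly (fun w : K[i] => w^*) f).
Local Notation infl := (infl_fun P Q).
Local Notation grad := (infl_grad P Q).
Local Notation Tan := (tangency_locus P Q).

Let pbar : {poly {poly K[i]}} := map_poly polyC (cj p).

(** A number minus its conjugate: [ev] gives [2 i] times [infl_fun]. The total degree is at most
    [(deg P + deg Q - 1) + 2 deg P = d]. *)
Definition infl_poly : {poly {poly K[i]}} :=
  A%:P * pbar ^+ 2 - map_poly polyC (cj A) * p%:P ^+ 2.

(** [R * infl_grad] times [|p|^4] is [q B] times the fourth power of the conjugate of [p], of total
    degree at most [(2 deg P + 2 deg Q - 2) + 4 deg P = 2 d]; the second term is its conjugate. *)
Definition tan_poly : {poly {poly K[i]}} :=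
  (q * B)%:P * pbar ^+ 4 - map_poly polyC (cj (q * B)) * p%:P ^+ 4.

Let ev_cj (f : {poly K[i]}) z : ev (map_poly polyC (cj f)) z = (f.[z])^*.
Proof. by rewrite ev_map; exact: (horner_map (@conjc K)). Qed.

Let sub_conj (x : K[i]) : x - x^* = 0 <-> complex.Im x = 0.
Proof.
rewrite Im_conj; split=> [/eqP|->]; last by rewrite subrr.
by rewrite subr_eq0 => /eqP.
Qed.

Lemma ev_infl_poly z : ev infl_poly z =
  A.[z] * (p.[z]^* * p.[z]^*) - (A.[z] * (p.[z]^* * p.[z]^*))^*.
Proof.
rewrite /infl_poly evD evN !evM !evC /pbar !ev_cj !conjM conjcK; ring.
Qed.

Lemma infl_polyP z : ev infl_poly z = 0 <-> infl z = 0.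
Proof. by rewrite ev_infl_poly; exact: sub_conj. Qed.

Lemma tan_polyP z : p.[z] != 0 ->
  ev tan_poly z = 0 <-> complex.Im (R z * grad z) = 0.
Proof.
move=> pz; set x := q.[z] * B.[z] * p.[z]^* ^+ 4.
have pJ : p.[z]^* != 0 by rewrite -mod_gt0 modJ mod_gt0.
have -> : ev tan_poly z = x - x^*.
  rewrite /tan_poly evD evN !evM !evC /pbar !ev_cj hornerM /x !conjM.
  by rewrite conjcK; ring.
rewrite sub_conj; have -> : x = (mod p.[z] ^+ 2)%:C ^+ 2 * (R z * grad z).
  by rewrite /x /Rf /infl_grad -mulJ; field.
have m0 : mod p.[z] ^+ 2 ^+ 2 != 0 by rewrite !expf_neq0 // mod_eq0.
rewrite -rmorphXn ImMC; split=> [/eqP|->]; last by rewrite mulr0.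
by rewrite mulf_eq0 (negPf m0) => /eqP.
Qed.

Lemma infl_poly_neq0 : infl_poly != 0.
Proof.
have pB : p * B != 0 by rewrite mulf_neq0 // rden_neq0.
have [z zP] := nonroot pB; move: (zP); rewrite hornerM mulf_eq0 negb_or => /andP[pz Bz].
apply/eqP => F0; apply: (inflection_thin pz Bz); near=> w.
by apply/infl_polyP; rewrite F0 /ev !horner0.
Unshelve. all: by end_near.
Qed.

(** The last inequality, a consequence of [B_neq0], keeps the truncated subtractions of degrees
    exact, including the one in [curve_d]. *)
Let sizes : [/\ (size p <= (deg P).+1)%N, (size A <= deg P + deg Q)%N,
  (size (q * B)%R <= (2 * deg P + 2 * deg Q).-1)%N & (2 <= 2 * deg P + deg Q)%N].
Proof.
have sd (f : {poly K[i]}) : (size f^`() <= (size f).-1)%N by exact: size_poly.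
have nat1 (n m k : nat) : (n <= m)%N -> (m <= k)%N -> (n <= k)%N by exact: leq_trans.
have P1 : (0 < size P)%N by rewrite size_poly_gt0.
have Q1 : (0 < size Q)%N by rewrite size_poly_gt0.
have sp : (size p <= (deg P).+1)%N by apply: nat1 (size_rden P Q) _; rewrite /deg prednK.
have sq : (size q <= (deg Q).+1)%N by apply: nat1 (size_rnum P Q) _; rewrite /deg prednK.
have p0 : (0 < size p)%N by rewrite size_poly_gt0 rden_neq0.
have mul (f g : {poly K[i]}) (i j : nat) : (size f <= i)%N -> (size g <= j.+1)%N ->
    (size (f * g)%R <= i + j)%N.
  move=> fi gj; apply: nat1 (size_polyMleq _ _) _.
  have aux (x y : nat) : (x <= i)%N -> (y <= j.+1)%N -> ((x + y).-1 <= i + j)%N by lia.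
  exact: aux.
have der (f : {poly K[i]}) (i : nat) : (size f <= i.+1)%N -> (size f^`() <= i)%N.
  move=> fi; apply: nat1 (sd f) _; move: fi; case: (size f) => //.
have sA : (size A <= deg P + deg Q)%N.
  rewrite /num1; apply: nat1 (size_polyD _ _) _; rewrite geq_max size_polyN.
  rewrite {1}addnC mul ?der //= mulrC mul ?der //.
have [a b sA'] : exists2 n, (deg P + deg Q = n.+1)%N & (size A <= n.+1)%N.
  move: sA; case: (deg P + deg Q)%N => [|n h]; last by exists n.
  rewrite leqn0 size_poly_eq0 => /eqP A0; case/eqP: B_neq0.
  by rewrite /num2 A0 deriv0 !mul0r mul0rn subrr.
have sB : (size B <= a + deg P)%N.
  rewrite /num2; apply: nat1 (size_polyD _ _) _; rewrite geq_max size_polyN.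
  rewrite mul ?der //= -mulr_natr -polyC_natr mulrC mul_polyC.
  apply: (leq_trans (size_scale_leq _ _)); rewrite mulrC.
  by rewrite addnC; apply: mul; [exact: der|exact: sA'].
have B1 : (0 < size B)%N by rewrite size_poly_gt0.
have ab : (0 < a + deg P)%N by exact: nat1 sB.
split => //; last by move: b ab; lia.
rewrite mulrC; apply: (leq_trans (mul _ _ _ _ sB sq)); move: b ab; lia.
Qed.

Lemma size_irregular : (size (p * B)%R <= (2 * curve_d P Q).+1)%N.
Proof.
have [sp _ sqB pos] := sizes; apply: leq_trans (size_polyMleq _ _) _.
have sB : (size B <= (2 * deg P + 2 * deg Q).-1)%N.
  apply: leq_trans sqB; rewrite size_mul ?rnum_neq0 //.
  have q0 : (0 < size q)%N by rewrite size_poly_gt0 rnum_neq0.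
  by rewrite -(prednK q0) addSn /= leq_addl.
have aux (x y : nat) : (x <= (deg P).+1)%N -> (y <= (2 * deg P + 2 * deg Q).-1)%N ->
    ((x + y).-1 <= (2 * curve_d P Q).+1)%N by rewrite /curve_d; move: pos; lia.
exact: aux.
Qed.

Let size_cj (f : {poly K[i]}) : size (cj f) = size f.
Proof. exact: (size_map_poly (@conjc K)). Qed.

Lemma tdeg_infl_poly : tdeg_le infl_poly (curve_d P Q).
Proof.
have [sp sA _ pos] := sizes.
have tp : tdeg_le p%:P (deg P) by exact: tdeg_leC.
have tpb : tdeg_le pbar (deg P) by apply: tdeg_le_map; rewrite size_cj.
have sA' : (size A <= (deg P + deg Q).-1.+1)%N by rewrite prednK //; move: pos; lia.
have tA : tdeg_le A%:P (deg P + deg Q).-1 by exact: tdeg_leC.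
have tAb : tdeg_le (map_poly polyC (cj A)) (deg P + deg Q).-1.
  by apply: tdeg_le_map; rewrite size_cj.
have e : ((deg P + deg Q).-1 + (deg P + deg P) <= curve_d P Q)%N.
  by rewrite /curve_d; move: pos; lia.
rewrite /infl_poly; apply: tdeg_leD; last apply: tdeg_leN.
  by apply: tdeg_le_widen (tdeg_leM tA (tdeg_leM tpb tpb)) e.
by apply: tdeg_le_widen (tdeg_leM tAb (tdeg_leM tp tp)) e.
Qed.

Lemma tdeg_tan_poly : tdeg_le tan_poly (2 * curve_d P Q).
Proof.
have [sp _ sG pos] := sizes.
have tp : tdeg_le p%:P (deg P) by exact: tdeg_leC.
have tpb : tdeg_le pbar (deg P) by apply: tdeg_le_map; rewrite size_cj.
have sG' : (size (q * B)%R <= (2 * deg P + 2 * deg Q).-2.+1)%N.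
  by apply: leq_trans sG _; move: pos; lia.
have tG : tdeg_le (q * B)%:P (2 * deg P + 2 * deg Q).-2 by exact: tdeg_leC.
have tGb : tdeg_le (map_poly polyC (cj (q * B))) (2 * deg P + 2 * deg Q).-2.
  by apply: tdeg_le_map; rewrite size_cj.
have e : ((2 * deg P + 2 * deg Q).-2 + (deg P + (deg P + (deg P + deg P))) <= 2 * curve_d P Q)%N.
  by rewrite /curve_d; move: pos; lia.
rewrite /tan_poly; apply: tdeg_leD; last apply: tdeg_leN.
  by apply: tdeg_le_widen (tdeg_leM tG (tdeg_leM tpb (tdeg_leM tpb (tdeg_leM tpb tpb)))) e.
by apply: tdeg_le_widen (tdeg_leM tGb (tdeg_leM tp (tdeg_leM tp (tdeg_leM tp tp)))) e.
Qed.

Let curve_d_gt0 : (0 < curve_d P Q)%N.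
Proof. by have [_ _ _ pos] := sizes; rewrite /curve_d; lia. Qed.

(* A common factor H of the two equations vanishing at a smooth point of the
   curve defines the whole curve near this point. *)
Lemma infl_factor (H F1 : {poly {poly K[i]}}) z : infl_poly = H * F1 ->
  p.[z] != 0 -> B.[z] != 0 -> infl z = 0 -> ev H z = 0 -> ev F1 z != 0.
Proof.
move=> FE pz Bz Iz Hz; apply/eqP => F1z.
(* If both factors vanished at [z], the product rule would annihilate the derivative of [infl] along
   [v], which is [|grad|^2]. *)
pose v := 'i * (grad z)^*; pose g (s : K) := z + s%:C * v.
have g0 : g 0 = z by rewrite /g mul0r addr0.
have gd : cder g 0 v.
  have h : cder (fun s : K => s%:C) 0 1 by apply: (@cder_real K id 0 1); exact: is_derive_id.
  by have := cderD (cder_cst z 0) (cderM h (cder_cst v 0)); rewrite add0r mul1r mulr0 addr0.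
have [u1 hu1] := cder_ev H gd; have [u2 hu2] := cder_ev F1 gd.
have := cderM hu1 hu2; rewrite g0 Hz F1z mul0r mulr0 addr0 => -[_ hI].
have hd := infl_fun_cder P Q gd.
have E : (fun s => complex.Im (ev H (g s) * ev F1 (g s))) = fun s => infl (g s) + infl (g s).
  apply/funext => s; rewrite -evM -FE ev_infl_poly; set x := _ * _.
  by rewrite ImD ImN ImJ opprK.
rewrite E in hI; have h2 := is_deriveD hd hd.
have [_ e1] := hI; have [_ e2] := h2; have := e2; rewrite e1 g0 dinfl_funE //.
have -> : complex.Im (v * grad z) = mod (grad z) ^+ 2.
  have -> : v * grad z = 'i * (mod (grad z) ^+ 2)%:C by rewrite /v -mulJ; ring.
  by rewrite ImM /=; ring.
move=> /= /esym /eqP; rewrite -mulr2n mulrn_eq0 /= expf_eq0 /= mod_eq0.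
by rewrite (negPf (infl_grad_neq0 pz Bz)).
Qed.

(** [Z] is the set of tangency points where the common factor [H] is nonzero. There both cofactors
    vanish, so Bezout bounds [Z]; being finite and cut out by an open condition, it is isolated in
    the locus. Where [H] vanishes, it is a local equation of the curve by [infl_factor], and it
    divides the tangency equation. *)
Lemma tangency_split : exists Z : set K[i], exists s : seq K[i],
  [/\ (size s <= curve_d P Q * (2 * curve_d P Q))%N, forall x, Z x <-> x \in s,
   Z `<=` isolated Tan &
   forall z, Tan z -> Z z \/ \forall w \near z, infl w = 0 -> Tan w].
Proof.
have [H [F1 [G1 [H0 F10 FE GE cop]]]] := coprime_factors tan_poly infl_poly_neq0.
have tF : tdeg_le F1 (curve_d P Q).
  by apply: (tdeg_le_divl H0); rewrite -FE; exact: tdeg_infl_poly.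
have tG : tdeg_le G1 (2 * curve_d P Q).
  by apply: (tdeg_le_divl H0); rewrite -GE; exact: tdeg_tan_poly.
have pos2 : (0 < 2 * curve_d P Q)%N by rewrite muln_gt0 curve_d_gt0.
pose Z0 := [set z : K[i] | ev F1 z = 0 /\ ev G1 z = 0].
have bz (s : seq K[i]) : uniq s -> (forall x, x \in s -> Z0 x) ->
    (size s <= curve_d P Q * (2 * curve_d P Q))%N.
  by move=> us sZ; apply: (bezout curve_d_gt0 pos2 F10 cop tF tG us (f := fun w => w^*)).
pose Z := [set z | Tan z /\ ev H z != 0].
have TP := tangency_locusP P_neq0 B_neq0.
have ZZ0 z : Z z -> Z0 z.
  move=> [/TP[pz Bz /(inflection_fun pz) Iz Gz] Hz]; split; apply: (mulfI Hz); rewrite mulr0 -evM.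
    by rewrite -FE; exact/infl_polyP.
  by rewrite -GE; exact/tan_polyP.
have bZ (s : seq K[i]) : uniq s -> (forall x, x \in s -> Z x) ->
    (size s <= curve_d P Q * (2 * curve_d P Q))%N.
  by move=> us sZ; apply: bz => // x /sZ; exact: ZZ0.
have [s [sN sP]] := bounded_seq_set bZ.
exists Z, s; split => //.
  move=> z Zz; have [Tz Hz] := Zz; split; first by rewrite inE.
  exists [set w | Tan w -> w = z].
    near=> w => Tw; have ws : w \in s.
      by apply/sP; split => //; near: w; apply: near_neq0 Hz; exact: cont_ev.
    by move: ws; near: w; exact: near_mem_seq.
  by apply/seteqP; split=> [w [h /h]|w ->].
move=> z Tz; have [Hz|Hz] := eqVneq (ev H z) 0; last by left.
right; have [pz Bz /(inflection_fun pz) Iz _] := (TP z).1 Tz.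
have F1z := infl_factor FE pz Bz Iz Hz.
near=> w => Iw.
have F1w : ev F1 w != 0 by near: w; apply: near_neq0 F1z; exact: cont_ev.
have pw : p.[w] != 0 by near: w; exact: near_rden.
have Bw : B.[w] != 0 by near: w; apply: near_neq0 Bz; exact: horner_continuous_at.
have Hw : ev H w = 0.
  by apply: (mulIf F1w); rewrite mul0r -evM -FE; exact/infl_polyP.
apply/TP; split => //; first exact/inflection_fun.
by apply/tan_polyP => //; rewrite GE evM Hw mul0r.
Unshelve. all: by end_near.
Qed.

End TangencyStructure.

(** * Straightness of tangency arcs and the decomposition of the locus *)

Section Straightness.
Variable K : realType.
Variables (P Q : {poly K[i]}).
Hypotheses (P_neq0 : P != 0) (Q_neq0 : Q != 0) (B_neq0 : num2 P Q != 0).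
Local Notation p := (rden P Q).
Local Notation q := (rnum P Q).
Local Notation A := (num1 P Q).
Local Notation B := (num2 P Q).
Local Notation R := (Rf P Q).
Local Notation dR w := (A.[w] / p.[w] ^+ 2).
Local Notation infl := (infl_fun P Q).
Local Notation grad := (infl_grad P Q).
Local Notation Tan := (tangency_locus P Q).

Lemma deriv0_const (y : K -> K) (t0 e s : K) :
  (forall u : K, `|u - t0| < e -> is_derive u 1 y 0) -> `|s - t0| < e -> y s = y t0.
Proof.
move=> yd se; have yN (u : K) : `|u - t0| < e -> is_derive u 1 (fun w => - y w) 0.
  by move=> /yd h; have := is_deriveN h; rewrite oppr0.
have mono (x : K -> K) (a b : K) : (forall u : K, `|u - t0| < e -> is_derive u 1 x 0) ->
    `|a - t0| < e -> `|b - t0| < e -> a <= b -> x a <= x b.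
  move=> xd ae be ab; apply: (@nonneg_deriv_mono K x (fun=> 0)) => // u /andP[au ub].
  apply: xd; move: ae be; rewrite !ltr_norml => /andP[? ?] /andP[? ?]; apply/andP; split; lra.
have te : `|t0 - t0| < e by rewrite subrr normr0; apply: le_lt_trans se; exact: normr_ge0.
have [ts|/ltW st] := leP t0 s.
  by have := mono _ _ _ yd te se ts; have := mono _ _ _ yN te se ts; lra.
by have := mono _ _ _ yd se te st; have := mono _ _ _ yN se te st; lra.
Qed.

Lemma cder0_const (g : K -> K[i]) (t0 e s : K) :
  (forall u : K, `|u - t0| < e -> cder g u 0) -> `|s - t0| < e -> g s = g t0.
Proof.
move=> gd se; apply: complex_eqP.
  by apply: (@deriv0_const (fun s => complex.Re (g s)) t0 e s) => // u /gd[].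
by apply: (@deriv0_const (fun s => complex.Im (g s)) t0 e s) => // u /gd[].
Qed.

(* Along a tangent arc both the field and the velocity have a constant
   direction: the ratio of R(g) to its conjugate has derivative zero. *)
Lemma tangent_arc_straight (g : K -> K[i]) (t0 e : K) (ka : K -> K) : 0 < e ->
  (forall s : K, `|s - t0| < e -> [/\ p.[g s] != 0, infl (g s) = 0, R (g s) != 0 &
     cder g s ((ka s)%:C * R (g s))]) ->
  (forall s s' : K, `|s - t0| < e -> `|s' - t0| < e -> g s = g s' -> s = s') ->
  invariant_line P Q (g t0) (R (g t0)).
Proof.
move=> e0 H inj; set v := R (g t0); set a := g t0.
have te : `|t0 - t0| < e by rewrite subrr normr0.
have v0 : v != 0 by have [] := H t0 te.
have vJ : v^* != 0 by rewrite -mod_gt0 modJ mod_gt0.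
have RJ s : `|s - t0| < e -> (R (g s))^* != 0.
  by move=> /H[_ _ h _]; rewrite -mod_gt0 modJ mod_gt0.
have phi s : `|s - t0| < e -> R (g s) * ((R (g s))^*)^-1 = v * (v^*)^-1.
  move=> se; apply: (@cder0_const (fun s => R (g s) * ((R (g s))^*)^-1) t0 e s) => // u ue.
  have [pu Iu Ru gu] := H u ue.
  have dr := (Im_conj _).1 ((infl_fun_dR pu).1 Iu).
  have hR := cder_Rf pu gu; have := cderM hR (cderV (RJ u ue) (cderJ hR)).
  set d := (X in cder _ _ X -> _); suff -> : d = 0 by [].
  have kJ : ((ka u)%:C)^* = (ka u)%:C by apply: complex_eqP => //=; rewrite oppr0.
  have E : (dR (g u) * ((ka u)%:C * R (g u)))^* = dR (g u) * ((ka u)%:C * (R (g u))^*).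
    by rewrite [LHS]conjM dr; congr (_ * _); rewrite [LHS]conjM kJ.
  rewrite /d E; have := RJ u ue; set r := (R (g u))^*; set x := dR (g u) => r0.
  by field.
have real s : `|s - t0| < e -> (R (g s) / v)^* = R (g s) / v.
  move=> se; rewrite conjM fmorphV /=; apply: (mulIf v0); apply: (mulIf vJ).
  have := phi s se; move: (RJ s se); set r := R (g s) => r0 E.
  have -> : r^* / v^* * v * v^* = r^* * v by field.
  have -> : r / v * v * v^* = r * v^* by field.
  apply: (mulIf (mulf_neq0 (invr_neq0 r0) (invr_neq0 vJ))).
  transitivity (v / v^*); first by field; rewrite vJ r0.
  by rewrite -E; field; rewrite vJ r0.
(* The position along [v] vanishes at [t0] and has real velocity, so it is real and the arc lies on
   the line. *)
pose x s := (g s - a) / v.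
have xreal s : `|s - t0| < e -> x s - (x s)^* = 0.
  move=> se; have <- : x t0 - (x t0)^* = 0 by rewrite /x subrr mul0r conjc0 subrr.
  apply: (@cder0_const (fun s => x s - (x s)^*) t0 e s) => // u ue.
  have [pu Iu Ru gu] := H u ue.
  have hx : cder x u ((ka u)%:C * R (g u) / v).
    have := cderM (cderD gu (cder_cst (- a) u)) (cder_cst v^-1 u).
    by rewrite mulr0 !addr0.
  have := cderD hx (cderN (cderJ hx)); set d := (X in cder _ _ X -> _); suff -> : d = 0 by [].
  have kJ : ((ka u)%:C)^* = (ka u)%:C by apply: complex_eqP => //=; rewrite oppr0.
  have E : ((ka u)%:C * R (g u) / v)^* = (ka u)%:C * R (g u) / v.
    by rewrite -mulrA [LHS]conjM kJ real.
  by rewrite /d E subrr.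
have xE s : `|s - t0| < e -> g s = a + (complex.Re (x s))%:C * v.
  move=> se; have -> : (complex.Re (x s))%:C = x s.
    have /eqP := xreal s se; rewrite subr_eq0 => /eqP h.
    by apply: complex_eqP => //=; apply/esym/Im_conj.
  by rewrite /x divfK // addrC subrK.
apply/invariant_lineP => //; apply: contrapT => /eqP D0.
(* The arc gives infinitely many real parameters at which [line_poly] vanishes; as many as its size
   already contradict that it is nonzero. *)
pose n := size (line_poly P Q a v); pose sk (k : nat) : K := t0 + e / k.+2%:R.
have skP k : `|sk k - t0| < e.
  rewrite /sk addrC addKr ger0_norm ?divr_ge0 ?(ltW e0) //.
  by rewrite ltr_pdivrMr // ltr_pMr // ltr1n.
pose rs := [seq (complex.Re (x (sk k)))%:C | k <- iota 0 n].
have rs_root : all (root (line_poly P Q a v)) rs.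
  apply/allP => w /mapP[k _ ->]; have [pu Iu Ru gu] := H _ (skP k).
  apply/eqP; apply/real_ratio => //; rewrite -xE //.
  by apply/Im_conj; exact: real.
have rs_uniq : uniq rs.
  rewrite map_inj_uniq ?iota_uniq // => k l kl.
  have := inj _ _ (skP k) (skP l); rewrite xE // kl -xE // => /(_ erefl).
  rewrite /sk => /addrI /(mulfI (lt0r_neq0 e0)) /invr_inj /eqP.
  by rewrite eqr_nat => /eqP[].
by have := max_poly_roots D0 rs_root rs_uniq; rewrite size_map size_iota ltnn.
Qed.

Lemma lineP (a v z : K[i]) : v != 0 -> line a v z <-> (z - a) / v - ((z - a) / v)^* = 0.
Proof.
move=> v0; split=> [[t ->]|/eqP].
  rewrite addrAC subrr add0r mulfK //; apply/eqP; rewrite subr_eq0; apply/eqP.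
  by apply: complex_eqP => //=; rewrite oppr0.
rewrite subr_eq0 => /eqP h; exists (complex.Re ((z - a) / v)).
have -> : (complex.Re ((z - a) / v))%:C = (z - a) / v.
  by apply: complex_eqP => //=; apply/esym/Im_conj.
by rewrite divfK // addrC subrK.
Qed.

Lemma near_off_lines (ls : seq (K[i] * K[i])) z : (forall l, l \in ls -> l.2 != 0) ->
  (forall l, l \in ls -> ~ line l.1 l.2 z) ->
  \forall w \near z, forall l, l \in ls -> ~ line l.1 l.2 w.
Proof.
elim: ls => [|l ls IH] l0 lz; first by near=> w => l; rewrite in_nil.
have l20 : l.2 != 0 by apply: l0; rewrite mem_head.
pose F w := (w - l.1) / l.2 - ((w - l.1) / l.2)^*.
have Fz : F z != 0 by apply/eqP => /(lineP _ _ l20); apply: lz; rewrite mem_head.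
have c1 : {for z, continuous (fun w => (w - l.1) / l.2)}.
  apply: contC_M; last exact: contC_cst.
  by apply: contC_D; [exact: cvg_id|exact: contC_cst].
have Fc : {for z, continuous F}.
  by apply: contC_D; [exact: c1|apply: contC_N; apply: contC_J; exact: c1].
have n1 := near_neq0 Fc Fz.
have n2 : \forall w \near z, forall l', l' \in ls -> ~ line l'.1 l'.2 w.
  by apply: IH => l' l's; [apply: l0|apply: lz]; rewrite in_cons l's orbT.
near=> w.
have Fw : F w != 0 by near: w.
have nw : forall l', l' \in ls -> ~ line l'.1 l'.2 w by near: w.
move=> l'; rewrite in_cons => /orP[/eqP ->|]; last exact: nw.
by move=> /(lineP _ _ l20); exact/eqP.
Unshelve. all: by end_near.
Qed.

(** The lines are finitely many and closed, so a point off all of them has a neighbourhood off them;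
    but points of the arc close to [z] lie on invariant lines. These are taken different from [z],
    where the field may vanish. *)
Lemma tangency_arc_on_line (ls : seq (K[i] * K[i])) z :
  (forall l, l \in ls -> l.2 != 0) ->
  (forall a v w, v != 0 -> invariant_line P Q a v -> line a v w ->
        exists2 l, l \in ls & line l.1 l.2 w) ->
  Tan z -> (\forall w \near z, infl w = 0 -> Tan w) ->
  exists2 l, l \in ls & line l.1 l.2 z.
Proof.
move=> ls0 lsP Tz arcT; apply: contrapT => off.
have offz l : l \in ls -> ~ line l.1 l.2 z by move=> lls lz; apply: off; exists l.
have nl := near_off_lines ls0 offz.
have [pz Bz Iz _] := (tangency_locusP P_neq0 B_neq0 z).1 Tz.
have [g gpar] := regular_param B_neq0 pz Bz Iz; have [gP _] := gpar.
have [g0 _ ginj _] := gP.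
have [d /andP[d0 d1] dP] := param_infl_fun pz gpar.
have nU : \forall w \near z, [/\ B.[w] != 0, infl w = 0 -> Tan w,
    w != z -> q.[w] != 0 & forall l, l \in ls -> ~ line l.1 l.2 w].
  near=> w; split; last by near: w.
  - by near: w; apply: near_neq0 Bz; exact: horner_continuous_at.
  - by near: w.
  - by near: w; apply: near_punctured_root; exact: rnum_neq0.
have [d' /andP[d0' d1'] dP'] := arc_near gP nU.
have [m [m0 md md']] : exists m : K, [/\ 0 < m, m <= d & m <= d'].
  by exists (Num.min d d'); rewrite lt_min d0 !ge_min !lexx orbT.
(* The window [|s - t0| < t0] excludes the parameter 0 of [z], and its upper end [2 * t0] stays
   below [m]. *)
pose t0 : K := m / 4; have t00 : 0 < t0 by rewrite divr_gt0.
have rng (s : K) : `|s - t0| < t0 -> [/\ 0 < s, `|s| < d, `|s| < d' & `|s| < 1].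
  rewrite ltr_norml => /andP[s1 s2]; have s0 : 0 < s by lra.
  have st : s < m by move: s2; rewrite /t0; lra.
  by rewrite gtr0_norm //; split => //; lra.
have I1 (s : K) : `|s| < 1 -> s \in `[-1, 1].
  by rewrite in_itv /= ltr_norml => /andP[/ltW -> /ltW ->].
have st s : `|s - t0| < t0 -> [/\ p.[g s] != 0, infl (g s) = 0, R (g s) != 0 &
    cder g s ((complex.Re (curve_deriv g s / R (g s)))%:C * R (g s))].
  move=> /rng[s0 sd sd' s1]; have [ps Is] := dP s (ltW sd).
  have [Bs Ts qs _] := dP' s (ltW sd').
  have gz : g s != z.
    apply/eqP; rewrite -g0 => /ginj; rewrite !I1 // ?normr0 // => /(_ isT isT) e.
    by rewrite e ltxx in s0.
  have Rs : R (g s) != 0 by rewrite mulf_neq0 ?qs ?invr_eq0.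
  split => //; have [_ _ _ RG] := (tangency_locusP P_neq0 B_neq0 _).1 (Ts Is).
  have nI : \forall u \near s, infl (g u) = 0.
    have := near_norm_lt sd; apply: filterS => u ud.
    by have [] := dP u (ltW ud).
  have DG := arc_tangent gP s1 ps nI.
  have G0 := infl_grad_neq0 ps Bs.
  have -> : (complex.Re (curve_deriv g s / R (g s)))%:C = curve_deriv g s / R (g s).
    apply: complex_eqP => //=; apply/esym/Im_conj.
    move/Im_conj: RG => RG; move/Im_conj: DG => DG.
    have -> : curve_deriv g s / R (g s) = (curve_deriv g s * grad (g s)) / (R (g s) * grad (g s)).
      by set x := curve_deriv g s; set y := R (g s) in Rs *; field; rewrite G0 Rs.
    by rewrite conjM fmorphV /= DG RG.
  rewrite divfK; last exact: Rs.
  exact: (smooth_arc_cder gP s1).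
have te : `|t0 - t0| < t0 by rewrite subrr normr0.
have inv : invariant_line P Q (g t0) (R (g t0)).
  apply: (tangent_arc_straight t00 st) => s s' /rng[_ _ _ s1] /rng[_ _ _ s1'] /ginj.
  by apply; exact: I1.
have [_ _ R0 _] := st t0 te; have lg : line (g t0) (R (g t0)) (g t0).
  by exists 0; rewrite mul0r addr0.
have [l lls lg'] := lsP _ _ _ R0 inv lg.
have [_ _ td' _] := rng t0 te; have [_ _ _ offg] := dP' t0 (ltW td').
exact: offg lls lg'.
Unshelve. all: by end_near.
Qed.

Definition line_piece (l : K[i] * K[i]) (I : interval K) : set K[i] :=
  [set z | exists2 t : K, t \in I & z = l.1 + t%:C * l.2].

(** Nonempty and open, expressed without endpoints. This survives the removal of a point and implies
    the nondegeneracy asked by [straight_piece]. *)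
Let fat (I : interval K) : Prop := (exists r, r \in I) /\
  forall r : K, r \in I -> exists s t, [/\ s \in I, t \in I, s < r & r < t].

Lemma itv_between (I : interval K) (s t x : K) : s \in I -> t \in I -> s <= x <= t -> x \in I.
Proof.
case: I => l u; rewrite !itv_boundlr => /andP[ls _] /andP[_ tu] /andP[sx xt].
apply/andP; split; first by apply: le_trans ls _; rewrite bnd_simp.
by apply: le_trans tu; rewrite bnd_simp.
Qed.

Lemma complement_intervals (rs : seq K) : exists Is : seq (interval K),
  (forall I, I \in Is -> fat I) /\
  forall t : K, t \notin rs <-> exists2 I, I \in Is & t \in I.
Proof.
elim: rs => [|r rs [Is [IsF IsP]]].
  exists [:: `]-oo, +oo[]; split=> [I|t]; last first.
    by split => // _; exists `]-oo, +oo[; rewrite ?mem_head // in_itv.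
  rewrite mem_seq1 => /eqP ->; split; first by exists 0; rewrite in_itv.
  by move=> s _; exists (s - 1), (s + 1); rewrite !in_itv /=; split => //; lra.
pose cut (I : interval K) := let: Interval l u := I in
  if r \in I then [:: Interval l (BLeft r); Interval (BRight r) u] else [:: I].
have cutP (I : interval K) (t : K) :
    (exists2 J, J \in cut I & t \in J) <-> (t \in I) && (t != r).
  case: I => l u; rewrite /cut; case: ifPn => rI; last first.
    split=> [[J]|/andP[tI _]]; last by exists (Interval l u); rewrite ?mem_head.
    rewrite mem_seq1 => /eqP -> tI; rewrite tI /=; by apply: contraNneq rI => <-.
  move: (rI); rewrite itv_boundlr => /andP[lr ru].
  split=> [[J]|/andP[]].
    rewrite in_cons mem_seq1 => /orP[] /eqP ->; rewrite !itv_boundlr => /andP[a b]; rewrite bnd_simp in a b *.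
      by rewrite a lt_eqF // andbT (le_trans _ ru) // bnd_simp ltW.
    by rewrite b gt_eqF // andbT (le_trans lr) // bnd_simp ltW.
  rewrite itv_boundlr => /andP[a b]; rewrite neq_lt => /orP[] tr.
    by exists (Interval l (BLeft r)); rewrite ?mem_head // itv_boundlr a bnd_simp.
  by exists (Interval (BRight r) u); rewrite ?in_cons ?eqxx ?orbT // itv_boundlr b bnd_simp tr.
have cutF I J : fat I -> J \in cut I -> fat J.
  case: I => l u fI; have [_ F] := fI; rewrite /cut; case: ifPn => rI; last first.
    by rewrite mem_seq1 => /eqP ->.
  have [s [t [sI tI sr rt]]] := F r rI.
  move: (rI); rewrite itv_boundlr => /andP[lr ru].
  have Lo (x : K) : x \in Interval l (BLeft r) = (x \in Interval l u) && (x < r).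
    rewrite !itv_boundlr bnd_simp; case: (ltP x r) => xr; rewrite ?andbF ?andbT //.
    by rewrite (le_trans _ ru) ?andbT // bnd_simp ltW.
  have Hi (x : K) : x \in Interval (BRight r) u = (x \in Interval l u) && (r < x).
    rewrite !itv_boundlr bnd_simp; case: (ltP r x) => xr; rewrite ?andbF ?andbT //.
    by rewrite (le_trans lr) // bnd_simp ltW.
  rewrite in_cons mem_seq1 => /orP[] /eqP ->; split.
  - by exists s; rewrite Lo sI.
  - move=> x; rewrite Lo => /andP[xI xr]; have [s' [t' [s'I t'I s'x _]]] := F x xI.
    exists s', ((x + r) / 2); rewrite !Lo; split => //.
    + by rewrite s'I (lt_trans s'x).
    + rewrite (itv_between xI rI) /=; lra.
    + lra.
  - by exists t; rewrite Hi tI.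
  - move=> x; rewrite Hi => /andP[xI xr]; have [s' [t' [s'I t'I _ xt']]] := F x xI.
    exists ((x + r) / 2), t'; rewrite !Hi; split => //.
    + rewrite (itv_between rI xI) /=; lra.
    + by rewrite t'I (lt_trans xr).
    + lra.
exists (flatten [seq cut X | X <- Is]); split.
  by move=> J /flatten_mapP[I IIs JI]; apply: cutF JI; exact: IsF.
move=> t; rewrite in_cons negb_or; split.
  move=> /andP[tr /IsP[I IIs tI]].
  have [|J JI tJ] := (cutP I t).2; first by rewrite tI.
  by exists J => //; apply/flatten_mapP; exists I.
move=> [J /flatten_mapP[I IIs JI] tJ].
have /andP[tI tr] := (cutP I t).1 (ex_intro2 _ _ J JI tJ).
by rewrite tr; apply/IsP; exists I.
Qed.

(** On an invariant line every point with [p B] nonzero is a tangency point, so the pieces are the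
    open intervals that the roots of [p B] leave on each line; [Z] supplies the remaining points. *)
Lemma tangency_decomposition :
  exists (lines : seq (K[i] * K[i])) (n : nat) (C : 'I_n -> set K[i]) (F : set K[i]),
         [/\ (size lines <= deg P + deg Q + 1)%N,
             forall l, l \in lines -> l.2 != 0,
             forall i, straight_piece (C i) /\
               exists2 l, l \in lines & C i `<=` line l.1 l.2,
             F #<= `I_(2 * curve_d P Q ^ 2) /\ F `<=` isolated Tan &
             Tan = (\bigcup_i C i) `|` F].
Proof.
have [ls [lsN lsI lsP]] := invariant_lines P_neq0 Q_neq0 B_neq0.
have ls0 l : l \in ls -> l.2 != 0 by move=> /lsI[].
have [Z [s [sN sP Ziso Tsplit]]] := tangency_split P_neq0 Q_neq0 B_neq0.
have pB : p * B != 0 by rewrite mulf_neq0 // rden_neq0.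
have ex (l : K[i] * K[i]) : exists Is : seq (interval K), l.2 != 0 ->
    (forall I, I \in Is -> fat I) /\
    forall t : K, (p * B).[l.1 + t%:C * l.2] != 0 <-> exists2 I, I \in Is & t \in I.
  have [l20|] := boolP (l.2 != 0); last by exists [::].
  pose f := (p * B) \Po (l.1%:P + l.2 *: 'X).
  have fE (x : K[i]) : f.[x] = (p * B).[l.1 + l.2 * x].
    by rewrite /f horner_comp hornerD hornerC hornerZ hornerX.
  have f0 : f != 0.
    have [w] := nonroot pB; apply: contraNneq => f0.
    have := fE ((w - l.1) / l.2); rewrite f0 horner0 mulrCA divff // mulr1 addrC subrK.
    by move=> <-.
  pose F0 := [set t : K | (p * B).[l.1 + t%:C * l.2] = 0].
  have bd (rs : seq K) : uniq rs -> (forall x, x \in rs -> F0 x) -> (size rs <= size f)%N.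
    move=> us rsF; pose rs' : seq K[i] := [seq t%:C | t <- rs].
    have us' : uniq rs' by rewrite map_inj_uniq // => x y [].
    have h : all (root f) rs'.
      by apply/allP => x /mapP[t /rsF e ->]; apply/eqP; rewrite fE [l.2 * _]mulrC.
    by have := max_poly_roots f0 h us'; rewrite size_map; exact: ltnW.
  have [rs [_ rsP]] := bounded_seq_set bd.
  have [Is [IsF IsP]] := complement_intervals rs; exists Is => _; split => // t.
  rewrite -IsP; split=> h.
    by apply/negP => /rsP e; move: h; rewrite e eqxx.
  by apply/eqP => e; move/negP: h; apply; apply/rsP.
have [Is IsP] := choice ex.
pose pieces := flatten [seq [seq (l, X) | X <- Is l] | l <- ls].
have piecesP l I : (l, I) \in pieces <-> l \in ls /\ I \in Is l.
  split=> [/flatten_mapP[l' l'ls /mapP[J JI [-> ->]]] //|[lls II]].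
  by apply/flatten_mapP; exists l => //; exact: map_f.
pose x0 : (K[i] * K[i]) * interval K := ((0, 0), `]-oo, +oo[).
pose C (i : 'I_(size pieces)) := let lI := nth x0 pieces i in line_piece lI.1 lI.2.
have Cin (i : 'I_(size pieces)) : exists l I, [/\ l \in ls, I \in Is l & C i = line_piece l I].
  have := mem_nth x0 (ltn_ord i); case E : (nth x0 pieces i) => [l I] /piecesP[lls II].
  by exists l, I; rewrite /C E.
exists ls, (size pieces), C, Z; split => //.
- move=> i; have [l [I [lls II ->]]] := Cin i; have l20 := ls0 l lls.
  have [fatI _] := IsP l l20; have [[r rI] F] := fatI I II; split; last first.
    by exists l => // z [t _ ->]; exists t.
  exists l.1, l.2, I; split => //; have [x [t [xI tI xr rt]]] := F r rI.
  by exists x, t; split => //; exact: lt_trans rt.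
- split => //; apply: (@card_le_seq _ _ s) => [|z /sP //].
  by apply: leq_trans sN _; rewrite mulnCA mulnn.
apply/seteqP; split=> z.
  move=> Tz; have [|arc] := Tsplit z Tz; first by right.
  have [l lls [t zE]] := tangency_arc_on_line ls0 lsP Tz arc; left.
  have [pz Bz _ _] := (tangency_locusP P_neq0 B_neq0 z).1 Tz.
  have [_ IsT] := IsP l (ls0 l lls).
  have [|I II tI] := (IsT t).1; first by rewrite -zE hornerM mulf_neq0.
  have lI : (l, I) \in pieces by apply/piecesP.
  have k : (index (l, I) pieces < size pieces)%N by rewrite index_mem.
  by exists (Ordinal k) => //; rewrite /C /= nth_index //; exists t.
move=> [[i _]|/Ziso]; last exact: isolatedS.
have [l [I [lls II ->]]] := Cin i => -[t tI ->].
have [l20 inv] := lsI l lls; have [_ IsT] := IsP l l20.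
have : (p * B).[l.1 + t%:C * l.2] != 0 by apply/IsT; exists I.
rewrite hornerM mulf_eq0 negb_or => /andP[pz Bz].
by apply: (invariant_line_tangency P_neq0 B_neq0 l20 inv) => //; exists t.
Qed.

End Straightness.

Theorem theorem1p9 (K : realType) (P Q : {poly K[i]}) (M : set K[i])
    (P_neq0 : P != 0) (Q_neq0 : Q != 0)
    (not_both_constant : (1 < size P)%N || (1 < size Q)%N)
    (M_minimal : minimal_TCH P Q M) (M_interior : M° !=set0) :
  [/\ zeros_PQ P Q #<= `I_(deg P + deg Q),
      singular_locus P Q #<= `I_(2 * curve_d P Q),
      (exists (lines : seq (K[i] * K[i])) (n : nat) (A : 'I_n -> set K[i])
              (F : set K[i]),
         [/\ (size lines <= deg P + deg Q + 1)%N,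
             forall l, l \in lines -> l.2 != 0,
             forall i, straight_piece (A i) /\
               exists2 l, l \in lines & A i `<=` line l.1 l.2,
             F #<= `I_(2 * curve_d P Q ^ 2) /\
               F `<=` isolated (tangency_locus P Q) &
             tangency_locus P Q = (\bigcup_i A i) `|` F]) &
      forall z, boundary M z ->
        [\/ zeros_PQ P Q z,
            singular_locus P Q z,
            tangency_locus P Q z |
            [/\ transverse_locus P Q z, ~ zeros_PQ P Q z &
              [\/ bouncing_type P Q M z, switch_type P Q M z,
                  C1_inflection_type P Q M z | C2_inflection_type P Q M z]] \/
            [/\ ~ inflection P Q z, ~ zeros_PQ P Q z &
              [\/ local_type P Q M z, global_type P Q M z |
                  extruding_type P Q M z]]]].
Proof.
have [Mn0 /TCH_invariantP[cM _] _] := M_minimal.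
have E0 : num2 P Q = 0 -> inflection P Q = set0.
  exact: (inflection_empty P_neq0 Q_neq0 not_both_constant M_minimal M_interior).
split.
- apply: (@card_le_roots K _ (P * Q)) => //; first by rewrite mulf_neq0.
  rewrite size_mul // /deg; have := size_poly_gt0 P; have := size_poly_gt0 Q.
  by rewrite P_neq0 Q_neq0; move: (size P) (size Q) => a b; lia.
(* In the degenerate case the curve is empty, and with it the singular and tangency loci. *)
- have [B0|B0] := eqVneq (num2 P Q) 0.
    have -> : singular_locus P Q = set0.
      by apply/seteqP; split => // z [] /=; rewrite E0.
    exact: card_ge0.
  apply: (@card_le_roots K _ (rden P Q * num2 P Q)).
  + by rewrite mulf_neq0 // rden_neq0.
  + exact: size_irregular.
  + move=> z Sz; rewrite /root hornerM mulf_eq0; apply: contrapT => /negP.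
    by rewrite negb_or => /andP[pz Bz]; exact: (regular_not_singular pz Bz).
- have [B0|B0] := eqVneq (num2 P Q) 0; last exact: tangency_decomposition.
  have -> : tangency_locus P Q = set0.
    by apply/seteqP; split => // z [] /=; rewrite E0.
  exists [::], 0%N, (fun=> set0), set0; split => //; first by case.
  by apply/seteqP; split => // z [[[]]|].
move=> z [cz nz]; have Mz : M z by rewrite -(closure_id M).1 in cz.
have [Zz|Zz] := pselect (zeros_PQ P Q z); first by constructor 1.
have [Sz|Sz] := pselect (singular_locus P Q z); first by constructor 2.
have [Tz|Tz] := pselect (tangency_locus P Q z); first by constructor 3.
have emp (T : Type) (A : set T) : A !=set0 \/ A = set0.
  by have [->|/set0P] := eqVneq A set0; [right|left].
constructor 4; have [Iz|Iz] := pselect (inflection P Q z); [left|right].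
  have B0 : num2 P Q != 0 by apply/eqP => /E0 e; rewrite e in Iz.
  split => //; first exact: (transverse_locusP P_neq0 B0).
  (* The four subclasses only record which of [Del_plus], [Gam] and [Del_minus] are empty, and they
     cover all patterns. *)
  have [p0|p0] := emp _ (Del_plus P Q M z).
    have [m0|m0] := emp _ (Gam P Q M z `|` Del_minus P Q M z).
      by constructor 1.
    by constructor 2.
  have [m0|m0] := emp _ (Del_minus P Q M z); last by constructor 4; split => //; left.
  have [g0|g0] := emp _ (Gam P Q M z); last by constructor 3.
  by constructor 4; split => //; right.
(* The interior provides a second point of [M], which survives the removal of a small neighbourhood
   of [z]. *)
split => //; have [m Mm mz] : exists2 m, M m & m <> z.
  have [w /(@nbhsCP K _ _).1[e e0 eP]] := M_interior.
  have [wz|wz] := eqVneq w z; last by exists w; [apply: eP; rewrite subrr mod0|exact/eqP].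
  have e2 : 0 < e / 2 by rewrite divr_gt0.
  exists (w + (e / 2)%:C).
    by apply: eP; rewrite addrC addKr modC gtr0_norm // ltr_pdivrMr // ltr_pMr // ltr1n.
  rewrite -wz => /eqP; rewrite -subr_eq0 addrC addKr fmorph_eq0.
  by rewrite gt_eqF.
have := local_or_global P_neq0 M_minimal Zz Iz Mz Mm mz.
have [g0|g0] := emp _ (Gam P Q M z); have [d0|d0] := emp _ (Del P Q M z).
- by constructor 3.
- by constructor 1.
- by constructor 2.
- by rewrite g0 d0 => -[] [].
Qed.
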